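(* Fix $\varepsilon>0$. Let $L_1,L_2$ be positive integers, $K_{-L_1},\dots,K_{L_2}\subseteq[N]$ pairwise disjoint with union $[N]$, $x_0=\sum_{i=-L_1}^{L_2}i\,\mathbb{1}_{K_i}$, $K=\bigcup_{i\ne0}K_i$, $\hat K=K\setminus(K_{-L_1}\cup K_{L_2})$, $k_i=|K_i|$ for $i\in\{-L_1,0,L_2\}$, $\hat k=|\hat K|$. Let $A\in\mathbb{R}^{m\times N}$ be a Gaussian matrix and $b=Ax_0$. If $$m\ge\inf_{\tau\ge0}\Big\{\hat k(1+\tau^2)+k_{-L_1}\int_{-\tau}^{\infty}(u+\tau)^2\phi(u)\,du+k_{L_2}\int_{-\infty}^\tau(u-\tau)^2\phi(u)\,du+2k_0\int_\tau^\infty(u-\tau)^2\phi(u)\,du\Big\}+\sqrt{8\log(4/\varepsilon)N},$$ with $\phi(u)=(2\pi)^{-1/2}e^{-u^2/2}$, then with probability larger than $1-\varepsilon$, $x_0$ is the unique solution of $\min\|x\|_1$ subject to $Ax=b$ and $x\in[-L_1,L_2]^N$.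
   Context: $\mathbb{1}_S$ has entries $1$ on $S$, $0$ elsewhere. A Gaussian matrix is $A=m^{-1/2}[a_{ij}]$ with $a_{ij}$ i.i.d. standard normal. $\log$ is the natural logarithm. *)

(* Defs.v *)
From HB Require Import structures.
From mathcomp Require Import all_boot all_order all_algebra.
From mathcomp Require Import all_classical all_reals all_analysis.
Set Implicit Arguments. Unset Strict Implicit. Unset Printing Implicit Defensive.
Import Order.TTheory GRing.Theory Num.Theory.
Local Open Scope classical_set_scope.
Local Open Scope ring_scope.

Definition phi {R : realType} (u : R) : R :=
  (Num.sqrt (pi *+ 2))^-1 * expR (- (u ^+ 2) / 2).

(* a : 'I_m -> 'I_N -> T -> R are i.i.d. standard normal random variables on P:
   each is measurable, has law N(0,1), and they are mutually independent
   (product rule for every choice of Borel sets; taking B = setT for some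
   indices gives the product rule for every subfamily). *)
Definition iid_std_gaussian {R : realType} {d : measure_display}
  {T : measurableType d} (P : probability T R) (m N : nat)
  (a : 'I_m -> 'I_N -> T -> R) : Prop :=
  [/\ (forall i j, measurable_fun setT (a i j)),
      (forall i j (B : set R), measurable B ->
          P (a i j @^-1` B) = normal_prob 0 1 B) &
      (forall B : 'I_m -> 'I_N -> set R, (forall i j, measurable (B i j)) ->
          P [set w | forall i j, B i j (a i j w)] =
          (\prod_(i < m) \prod_(j < N) P (a i j @^-1` B i j))%E)].

Definition gauss_mx {R : realType} {T : Type} (m N : nat)
  (a : 'I_m -> 'I_N -> T -> R) (w : T) : 'M[R]_(m, N) :=
  (Num.sqrt (m%:R))^-1 *: \matrix_(i, j) a i j w.

Definition norm1 {R : realType} (N : nat) (x : 'cV[R]_N) : R :=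
  \sum_(j < N) `|x j 0|.

Definition feasible {R : realType} (m N L1 L2 : nat) (A : 'M[R]_(m, N))
  (b : 'cV[R]_m) (x : 'cV[R]_N) : Prop :=
  A *m x = b /\ forall j, - (L1%:R) <= x j 0 <= L2%:R.

Definition unique_solution {R : realType} (m N L1 L2 : nat) (A : 'M[R]_(m, N))
  (b : 'cV[R]_m) (x0 : 'cV[R]_N) : Prop :=
  feasible L1 L2 A b x0 /\
  forall x, feasible L1 L2 A b x -> x <> x0 -> norm1 x0 < norm1 x.

(* The partition K_{-L1}, ..., K_{L2} of [N] = 'I_N is encoded by the label
   c : 'I_N -> int (c j = i iff j \in K_i), with values in [-L1, L2]. *)
Definition Kset (N : nat) (c : 'I_N -> int) (i : int) : {set 'I_N} :=
  [set j | c j == i].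

Definition x0_of {R : realType} (N : nat) (c : 'I_N -> int) : 'cV[R]_N :=
  \col_j ((c j)%:~R).

Definition Khat (N L1 L2 : nat) (c : 'I_N -> int) : {set 'I_N} :=
  [set j | [&& c j != 0, c j != - (L1%:Z) & c j != L2%:Z]].

Definition Ige {R : realType} (t : R) : set R := `[t, +oo[.
Definition Ile {R : realType} (t : R) : set R := `]-oo, t].

Definition bound_fun {R : realType} (khat kL1 kL2 k0 : nat) (tau : R) : \bar R :=
  ((khat%:R * (1 + tau ^+ 2))%:E
   + (kL1%:R)%:E * (\int[lebesgue_measure]_(u in Ige (- tau))
                        (((u + tau) ^+ 2) * phi u)%:E)
   + (kL2%:R)%:E * (\int[lebesgue_measure]_(u in Ile tau)
                        (((u - tau) ^+ 2) * phi u)%:E)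
   + ((k0 *+ 2)%:R)%:E * (\int[lebesgue_measure]_(u in Ige tau)
                        (((u - tau) ^+ 2) * phi u)%:E))%E.

(* Main.v *)
(* Recovery fails only if the kernel of A meets the descent cone C of the norm and the box at
   x0 outside 0. Let h be a Gaussian row independent of A. If A x = 0 for some nonzero x in C,
   then with conditional probability at least 1/2 the cone C intersected with the kernel of A
   has a nonzero projection f of h, and the optimality conditions give h + l A = f + w with f in
   a face F of C and w in the corresponding normal cone W. In coordinates adapted to F, the
   vector f is the projection of the F-part of h on the kernel of a Gaussian matrix. Its law is
   rotation invariant, so it gives the open cone F at most the Gaussian measure of F, and the
   event has probability at most gamma(F) gamma(W), and 0 if dim F <= m. Up to a factor
   k ^ dim F <= k ^ m, scaling the F-part of h by k < 1 expresses gamma(F) gamma(W) as the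
   expectation of exp ((1 - k ^ 2) / 2 |f| ^ 2) on F + W, and |f| ^ 2 is at most the squared
   distance psi(h) from h to tau times the subdifferential plus the normal cone of the box.
   The sets F + W being disjoint, the failure probability is at most
   2 k ^ m E exp ((1 - k ^ 2) / 2 psi). The coordinates of psi are independent, and a one
   dimensional estimate bounds the expectation by exp (u delta), where delta = E psi is the
   value of the bound at tau and k ^ 2 = 1 / (1 + 2 u). Choosing u = (m - delta) / (2 N)
   yields 2 exp (- (m - delta) ^ 2 / (4 N)) < eps. *)
Require Import Defs.
From HB Require Import structures.
From mathcomp Require Import all_boot all_order all_algebra.
From mathcomp Require Import all_classical all_reals all_analysis.
From mathcomp Require Import measurable_realfun ring lra zify.
Import Order.TTheory GRing.Theory Num.Theory.
Import numFieldNormedType.Exports.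
Set Implicit Arguments. Unset Strict Implicit. Unset Printing Implicit Defensive.
Local Open Scope classical_set_scope.
Local Open Scope ring_scope.

(** * Gaussian matrices *)

Section measurable_matrix.
Context {R : realType} (p q : nat).

(** The auxiliary row [h] replaces the existence of some kernel vector in the cone by a statement on
    one random vector, a projection of [h], whose law can be compared with a Gaussian one. The
    comparison passes through a smoothing of the invariant law, so it is one-sided and asks for open
    cones: this is why faces are taken relatively open, indexed by their exact sets of active
    constraints, and why their spans are rotated onto coordinate axes before comparing. Neither
    intrinsic volumes nor Lipschitz concentration enter. The change of scale puts the same
    exponential weight on every face, so the sum over the faces collapses to a single exponential
    moment, which factors over the coordinates. The bound [exp (u delta)] of that moment has no term
    of second order in [u]; the quadratic cost comes only from [k ^ m <= exp (m (u ^ 2 - u))]. Under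
    the square root 4 would be enough in place of 8. The slack pays for an infimum that need not be
    attained. If [N <= m] the kernel is almost surely trivial; otherwise [m u ^ 2 <= N u ^ 2]
    explains the [N] in the exponent. *)

Definition mx_rect (B : 'I_p -> 'I_q -> set R) : set 'M[R]_(p, q) :=
  [set X | forall i j, B i j (X i j)].

(** Rectangles are stable under intersection, so a law on matrices is determined by its values on
    them, and these are what independence of the entries prescribes. *)
Definition mx_rects : set (set 'M[R]_(p, q)) :=
  [set A | exists2 B, (forall i j, measurable (B i j)) & A = mx_rect B].

Definition mx_display : measure_display. Proof. exact: default_measure_display. Qed.

HB.instance Definition _ := @isMeasurable.Build mx_display
  'M[R]_(p, q) <<s mx_rects >> (@sigma_algebra0 _ setT mx_rects)
  (@sigma_algebraC _ mx_rects) (@sigma_algebra_bigcup _ setT mx_rects).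

Lemma measurable_mx_rect B : (forall i j, measurable (B i j)) ->
  measurable (mx_rect B).
Proof. by move=> mB; apply: sub_sigma_algebra; exists B. Qed.

Lemma measurable_entry i j :
  measurable_fun setT (fun X : 'M[R]_(p, q) => X i j).
Proof.
move=> _ Y mY; rewrite setTI.
pose B i' j' := if (i' == i) && (j' == j) then Y else setT.
rewrite (_ : _ @^-1` _ = mx_rect B).
  by apply: measurable_mx_rect => i' j'; rewrite /B; case: ifP.
apply/seteqP; split => [X /= YX i' j'|X /= /(_ i j)]; rewrite /B.
  by case: ifP => // /andP[/eqP -> /eqP ->].
by rewrite !eqxx.
Qed.

Lemma measurable_entry_comp d (T : measurableType d) (f : T -> 'M[R]_(p, q)) i j :
  measurable_fun setT f -> measurable_fun setT (fun t => f t i j).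
Proof. by move=> mf; apply: (measurableT_comp (measurable_entry i j)). Qed.

Lemma measurable_mxP d (T : measurableType d) (f : T -> 'M[R]_(p, q)) :
  (forall i j, measurable_fun setT (fun t => f t i j)) ->
  measurable_fun setT f.
Proof.
move=> mf; apply: (@measurability _ _ _ _ _ _ mx_rects) => //.
move=> _ [_ [B mB ->] <-]; rewrite setTI.
rewrite (_ : _ @^-1` _ = \bigcap_(i in [set: 'I_p]) \bigcap_(j in [set: 'I_q])
  ((fun t => f t i j) @^-1` B i j)); last first.
  apply/seteqP; split => [t /= Bf i _ j _|t Bt i j]; first exact: Bf.
  exact: Bt.
apply: fin_bigcap_measurable => [|i _]; first exact: finite_finset.
apply: fin_bigcap_measurable => [|j _]; first exact: finite_finset.
by rewrite -[X in measurable X]setTI; exact: mf.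
Qed.

Lemma mx_measure_unique (m1 m2 : probability 'M[R]_(p, q) R) :
  (forall B, (forall i j, measurable (B i j)) ->
     m1 (mx_rect B) = m2 (mx_rect B)) ->
  forall A, measurable A -> m1 A = m2 A.
Proof.
move=> m12 A mA.
apply: (@measure_unique _ R 'M[R]_(p, q) mx_rects (fun=> setT)) => //.
- move=> _ _ [B mB ->] [C mC ->].
  exists (fun i j => B i j `&` C i j); first by move=> i j; exact: measurableI.
  apply/seteqP; split => [X [/= BX CX] i j|X /= BC]; first by split; [exact: BX|exact: CX].
  by split => i j; have [] := BC i j.
- by move=> _; exists (fun _ _ => setT) => //; apply/seteqP; split.
- by apply/seteqP; split => // x _; exists 0%N.
- by move=> _ [B mB ->]; exact: m12.
- by move=> _ /=; rewrite (le_lt_trans (probability_le1 _ _)) ?ltry.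
Qed.

End measurable_matrix.
#[global] Hint Extern 0 (measurable_fun _ (fun X => fun_of_matrix X _ _)) =>
  solve [apply: measurable_entry] : core.

Section gaussian_matrix.
Context {R : realType}.
Local Notation normal1 := (@normal_prob R 0 1).

Definition is_gauss_mx p q (mu : set 'M[R]_(p, q) -> \bar R) :=
  forall B, (forall i j, measurable (B i j)) ->
    mu (mx_rect B) = (\prod_(i < p) \prod_(j < q) normal1 (B i j))%E.

Lemma measurable_row_mx p q1 q2 : measurable_fun setT
  (fun X : 'M[R]_(p, q1) * 'M[R]_(p, q2) => row_mx X.1 X.2).
Proof.
apply: measurable_mxP => i j.
case: (split_ordP j) => k ->.
  under eq_fun do rewrite row_mxEl; exact: measurable_entry_comp.
under eq_fun do rewrite row_mxEr; exact: measurable_entry_comp.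
Qed.

Lemma measurable_col_mx p1 p2 q : measurable_fun setT
  (fun X : 'M[R]_(p1, q) * 'M[R]_(p2, q) => col_mx X.1 X.2).
Proof.
apply: measurable_mxP => i j.
case: (split_ordP i) => k ->.
  under eq_fun do rewrite col_mxEu; exact: measurable_entry_comp.
under eq_fun do rewrite col_mxEd; exact: measurable_entry_comp.
Qed.

Lemma is_gauss_row_mx p q1 q2 (m1 : probability 'M[R]_(p, q1) R)
    (m2 : probability 'M[R]_(p, q2) R) :
  is_gauss_mx m1 -> is_gauss_mx m2 ->
  is_gauss_mx (pushforward (m1 \x m2)%E (fun X => row_mx X.1 X.2)).
Proof.
move=> g1 g2 B mB; rewrite /pushforward.
rewrite (_ : _ @^-1` _ = mx_rect (fun i j => B i (lshift q2 j)) `*`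
   mx_rect (fun i j => B i (rshift q1 j))); last first.
  apply/seteqP; split => [[X Y] /= BXY|[X Y] [/= BX BY] i j].
    split => i j; first by have := BXY i (lshift q2 j); rewrite row_mxEl.
    by have := BXY i (rshift q1 j); rewrite row_mxEr.
  by case: (split_ordP j) => k ->; rewrite ?row_mxEl ?row_mxEr.
rewrite product_measure1E; [|exact: measurable_mx_rect..].
apply: (eq_trans (f_equal2 *%E (g1 _ _) (g2 _ _))) => //.
rewrite -big_split/=; apply: eq_bigr => i _.
by rewrite big_split_ord.
Qed.

Lemma is_gauss_col_mx p1 p2 q (m1 : probability 'M[R]_(p1, q) R)
    (m2 : probability 'M[R]_(p2, q) R) :
  is_gauss_mx m1 -> is_gauss_mx m2 ->
  is_gauss_mx (pushforward (m1 \x m2)%E (fun X => col_mx X.1 X.2)).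
Proof.
move=> g1 g2 B mB; rewrite /pushforward.
rewrite (_ : _ @^-1` _ = mx_rect (fun i j => B (lshift p2 i) j) `*`
   mx_rect (fun i j => B (rshift p1 i) j)); last first.
  apply/seteqP; split => [[X Y] /= BXY|[X Y] [/= BX BY] i j].
    split => i j; first by have := BXY (lshift p2 i) j; rewrite col_mxEu.
    by have := BXY (rshift p1 i) j; rewrite col_mxEd.
  by case: (split_ordP i) => k ->; rewrite ?col_mxEu ?col_mxEd.
rewrite product_measure1E; [|exact: measurable_mx_rect..].
apply: (eq_trans (f_equal2 *%E (g1 _ _) (g2 _ _))) => //.
by rewrite big_split_ord.
Qed.

(** Product measures glue scalar Gaussians into a row, then rows into a matrix, each time pushed
    forward by [row_mx] or [col_mx]. *)
Lemma gauss_mx_exists p q :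
  exists mu : probability 'M[R]_(p, q) R, is_gauss_mx mu.
Proof.
have push d (T : measurableType d) (mu : probability T R) p' q'
    (f : T -> 'M[R]_(p', q')) : measurable_fun setT f ->
    is_gauss_mx (pushforward mu f) ->
    exists nu : probability 'M[R]_(p', q') R, is_gauss_mx nu.
  move=> mf gf.
  pose F : {mfun T >-> 'M[R]_(p', q')} := HB.pack f (isMeasurableFun.Build _ _ _ _ f mf).
  by exists (distribution mu F).
have scal : exists mu : probability 'M[R]_(1, 1) R, is_gauss_mx mu.
  apply: (push _ _ normal1 _ _ (fun x => const_mx x)).
    by apply: measurable_mxP => i j; under eq_fun do rewrite mxE; exact: measurable_id.
  move=> B mB; rewrite /pushforward !big_ord1; congr (normal1 _).
  apply/seteqP; split => [x /= /(_ 0 0)|x /= Bx i j]; rewrite mxE//.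
  by rewrite !ord1.
(* A matrix type without entries has a single point, and the empty product is 1: the Dirac mass is
   the Gaussian law there. *)
have dir p' q' : (p' * q' = 0)%N -> exists mu : probability 'M[R]_(p', q') R, is_gauss_mx mu.
  move=> pq0; exists (\d_ (0 : 'M[R]_(p', q'))) => B mB.
  have noij (i : 'I_p') (j : 'I_q') : False.
    by have := leq_mul (leq_ltn_trans (leq0n i) (ltn_ord i))
                       (leq_ltn_trans (leq0n j) (ltn_ord j)); rewrite pq0.
  rewrite (_ : mx_rect B = setT).
    rewrite probability_setT; apply/esym; apply: big1 => i _; apply: big1 => j _.
    by case: (noij i j).
  by apply/seteqP; split => // X _ i j; case: (noij i j).
have row n : exists mu : probability 'M[R]_(1, n) R, is_gauss_mx mu.
  elim: n => [|n [m2 g2]]; first by apply: dir; rewrite muln0.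
  have [m1 g1] := scal.
  apply: (push _ _ (m1 \x m2)%E 1%N (1 + n)%N (fun X => row_mx X.1 X.2)).
    exact: measurable_row_mx.
  exact: is_gauss_row_mx.
elim: p => [|p [m2 g2]]; first exact: dir.
have [m1 g1] := row q.
apply: (push _ _ (m1 \x m2)%E (1 + p)%N q (fun X => col_mx X.1 X.2)).
  exact: measurable_col_mx.
exact: is_gauss_col_mx.
Qed.

Definition gauss p q : probability 'M[R]_(p, q) R :=
  projT1 (cid (gauss_mx_exists p q)).

Lemma gaussE p q B : (forall i j, measurable (B i j)) ->
  gauss p q (mx_rect B) = (\prod_(i < p) \prod_(j < q) normal1 (B i j))%E.
Proof. exact: (projT2 (cid (gauss_mx_exists p q))). Qed.

(** Transfer principle: every random matrix with independent standard normal entries, be it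
    assembled from blocks or transposed, computes the same integrals. *)
Lemma gauss_integral d (T : measurableType d) (mu : probability T R) p q
    (g : T -> 'M[R]_(p, q)) (f : 'M[R]_(p, q) -> \bar R) :
  measurable_fun setT g -> is_gauss_mx (pushforward mu g) ->
  measurable_fun setT f -> (forall X, 0 <= f X)%E ->
  (\int[gauss p q]_X f X = \int[mu]_t f (g t))%E.
Proof.
move=> mg gg mf f0.
pose G : {mfun T >-> 'M[R]_(p, q)} := HB.pack g (isMeasurableFun.Build _ _ _ _ g mg).
rewrite -(ge0_integral_distribution G)//.
apply: eq_measure_integral => A mA _.
by apply: mx_measure_unique => // B mB; rewrite gaussE// -gg.
Qed.

End gaussian_matrix.

(** * Densities and affine substitutions on the real line *)

Section real_integrals.
Context {R : realType}.
Local Notation leb := (@lebesgue_measure R).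
Local Open Scope ereal_scope.
Import HBNNSimple.

(** Monotone convergence along simple approximations of [f]; on an indicator the formula is the
    hypothesis on [nu]. *)
Lemma ge0_integral_density d (T : measurableType d)
    (mu nu : {measure set T -> \bar R}) (g : T -> R) (f : T -> \bar R) :
  measurable_fun setT g -> (forall x, (0 <= g x)%R) ->
  (forall A, measurable A -> nu A = \int[mu]_(x in A) (g x)%:E) ->
  measurable_fun setT f -> (forall x, 0 <= f x) ->
  \int[nu]_x f x = \int[mu]_x (f x * (g x)%:E).
Proof.
move=> mg g0 nuE mf f0.
pose f_ := nnsfun_approx measurableT mf.
have cvgf x : (f_ n x)%:E @[n --> \oo] --> f x by apply: cvg_nnsfun_approx.
have ndf x : {homo (fun n => (f_ n x)%:E) : n m / (n <= m)%N >-> n <= m}.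
  by move=> m n mn; rewrite lee_fin; exact/lefP/nd_nnsfun_approx.
transitivity (limn (fun n => \int[nu]_x (f_ n x)%:E)).
  rewrite -monotone_convergence//.
  - by apply: eq_integral => x _; apply/esym/cvg_lim.
  - by move=> n; exact/measurable_EFinP.
  - by move=> n x _; rewrite lee_fin.
transitivity (limn (fun n => \int[mu]_x ((f_ n x)%:E * (g x)%:E))); last first.
  rewrite -monotone_convergence//.
  - apply: eq_integral => x _; apply/cvg_lim => //.
    by apply: cvgeZr => //; exact: cvgf.
  - move=> n; apply: emeasurable_funM; exact/measurable_EFinP.
  - by move=> n x _; rewrite mule_ge0// lee_fin.
  - by move=> x _ m n mn; rewrite lee_pmul// ?lee_fin//; exact: (ndf x).
congr (limn _); apply/funext => n.
transitivity (\sum_(k \in range (f_ n))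
    \int[nu]_x (k * \1_(f_ n @^-1` [set k]) x)%:E).
  under eq_integral do rewrite fimfunE -fsumEFin//.
  rewrite ge0_integral_fsum//; last 2 first.
  - by move=> y; exact/measurable_EFinP/measurable_funM.
  - by move=> y x _; rewrite nnfun_muleindic_ge0.
transitivity (\sum_(k \in range (f_ n))
    \int[mu]_x ((k * \1_(f_ n @^-1` [set k]) x)%:E * (g x)%:E)); last first.
  rewrite -ge0_integral_fsum//.
  - apply: eq_integral => x _; rewrite [in RHS]fimfunE -fsumEFin// ge0_mule_fsuml//.
    by move=> k; rewrite nnfun_muleindic_ge0.
  - move=> y; apply: emeasurable_funM; last exact/measurable_EFinP.
    by exact/measurable_EFinP/measurable_funM.
  - by move=> y x _; rewrite mule_ge0 ?lee_fin// -lee_fin EFinM nnfun_muleindic_ge0.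
apply: eq_fsbigr => r; rewrite inE => -[x _ fx].
have r0 : (0 <= r)%R by rewrite -fx.
have mr : measurable (f_ n @^-1` [set r]) by [].
rewrite integralZl_indic_nnsfun// integral_indic// setIT nuE//.
under [RHS]eq_integral do rewrite EFinM -muleA.
rewrite ge0_integralZl//; first last.
- by move=> y _; rewrite mule_ge0// lee_fin.
- by apply: emeasurable_funM; exact/measurable_EFinP.
congr (_ * _); rewrite integral_mkcond; apply: eq_integral => y _.
rewrite patchE indicE.
by case: ifP => _; rewrite ?mul1e ?mul0e.
Qed.

Lemma integral_lebesgueN (f : R -> \bar R) : measurable_fun setT f ->
  (forall x, 0 <= f x) -> \int[leb]_x f x = \int[leb]_x f (- x)%R.
Proof.
move=> mf f0.
transitivity (\int[pushforward leb (-%R : _ -> measurableTypeR R)]_x f x).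
  by apply: eq_measure_integral => A mA _; apply/esym/lebesgue_measureN.
by rewrite ge0_integral_pushforward// preimage_setT.
Qed.

(** Lebesgue measure is [a] times its own image under the affine map, by uniqueness from half-open
    intervals. *)
Lemma integral_lebesgue_affine (a b : R) (f : R -> \bar R) : (0 < a)%R ->
  measurable_fun setT f -> (forall x, 0 <= f x) ->
  \int[leb]_x f x = a%:E * \int[leb]_x f (a * x + b)%R.
Proof.
move=> a0 mf f0; pose F : measurableTypeR R -> measurableTypeR R := fun x : R => (a * x + b)%R.
have mF : measurable_fun setT F.
  suff : measurable_fun setT (F : R -> R) by [].
  by apply: measurable_funD => //; exact: measurable_funM.
have an : (0 <= a)%R by exact: ltW.
have E := ge0_integral_pushforward mF leb measurableT mf (in1W f0).
transitivity (a%:E * \int[leb]_(x in F @^-1` setT) (f \o F) x); last first.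
  by rewrite preimage_setT.
rewrite -E -[a%:E]/((NngNum an)%:num%:E) -ge0_integral_mscale//.
apply: eq_measure_integral => A mA _.
apply: lebesgue_measure_unique => // _ [[x y] _ <-].
transitivity (a%:E * leb (F @^-1` `]x, y]%classic)); last by [].
rewrite (_ : F @^-1` _ = `]((x - b) / a)%R, ((y - b) / a)%R]%classic); last first.
  apply/seteqP; split => z /=; rewrite !in_itv/= /F => /andP[].
    by move=> xz zy; rewrite ltr_pdivrMr// ler_pdivlMr// ltrBlDr lerBrDr mulrC xz.
  by rewrite ltr_pdivrMr// ler_pdivlMr// ltrBlDr lerBrDr [(z * a)%R]mulrC => -> ->.
rewrite !lebesgue_measure_itv/= !lte_fin ltr_pM2r ?invr_gt0// ltrD2r.
case: ifP => _; last by rewrite mule0.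
rewrite -!EFinB -EFinM; congr EFin; field; exact: lt0r_neq0.
Qed.

Lemma phiE (x : R) : normal_pdf 0 1 x = phi x.
Proof.
rewrite normal_pdfE ?oner_eq0// /phi /normal_peak /normal_fun expr1n mul1r subr0.
by rewrite mulr2n.
Qed.

Lemma phi_gt0 (x : R) : (0 < phi x)%R.
Proof. by rewrite /phi mulr_gt0 ?expR_gt0// invr_gt0 sqrtr_gt0 mulrn_wgt0 ?pi_gt0. Qed.

Lemma phi_ge0 (x : R) : (0 <= phi x)%R.
Proof. exact/ltW/phi_gt0. Qed.

Lemma measurable_phi : measurable_fun setT (@phi R).
Proof.
have -> : phi = normal_pdf 0 1 :> (R -> R) by apply/funext => x; rewrite phiE.
exact: measurable_normal_pdf.
Qed.

Lemma integral_normal (f : R -> \bar R) : measurable_fun setT f ->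
  (forall x, 0 <= f x) ->
  \int[normal_prob 0 1]_x f x = \int[leb]_x (f x * (phi x)%:E).
Proof.
move=> mf f0; apply: ge0_integral_density => //; first exact: measurable_phi.
  exact: phi_ge0.
by move=> A mA; rewrite /normal_prob; apply: eq_integral => x _; rewrite phiE.
Qed.

End real_integrals.

(** * Measurability of matrix operations *)

Section matrix_measurability.
Context {R : realType} d (T : measurableType d).

Lemma measurable_mulmx p q r (f : T -> 'M[R]_(p, q)) (g : T -> 'M[R]_(q, r)) :
  measurable_fun setT f -> measurable_fun setT g ->
  measurable_fun setT (fun t => f t *m g t).
Proof.
move=> mf mg; apply: measurable_mxP => i j; under eq_fun do rewrite mxE.
by apply: measurable_sum => k; apply: measurable_funM; apply: measurable_entry_comp.
Qed.

Lemma measurable_addmx p q (f g : T -> 'M[R]_(p, q)) :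
  measurable_fun setT f -> measurable_fun setT g ->
  measurable_fun setT (fun t => f t + g t).
Proof.
move=> mf mg; apply: measurable_mxP => i j; under eq_fun do rewrite mxE.
by apply: measurable_funD; apply: measurable_entry_comp.
Qed.

Lemma measurable_scalemx p q (f : T -> R) (g : T -> 'M[R]_(p, q)) :
  measurable_fun setT f -> measurable_fun setT g ->
  measurable_fun setT (fun t => f t *: g t).
Proof.
move=> mf mg; apply: measurable_mxP => i j; under eq_fun do rewrite mxE.
by apply: measurable_funM => //; apply: measurable_entry_comp.
Qed.

Lemma measurable_trmx p q (f : T -> 'M[R]_(p, q)) :
  measurable_fun setT f -> measurable_fun setT (fun t => (f t)^T).
Proof.
move=> mf; apply: measurable_mxP => i j; under eq_fun do rewrite mxE.
exact: measurable_entry_comp.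
Qed.

Lemma measurable_const_mx p q (f : T -> R) :
  measurable_fun setT f -> measurable_fun setT (fun t => const_mx (f t) : 'M[R]_(p, q)).
Proof. by move=> mf; apply: measurable_mxP => i j; under eq_fun do rewrite mxE. Qed.

Lemma measurable_det p (f : T -> 'M[R]_p) :
  measurable_fun setT f -> measurable_fun setT (fun t => \det (f t)).
Proof.
move=> mf; apply: measurable_sum => s; apply: measurable_funM => //.
by apply: measurable_prod => i _; apply: measurable_entry_comp.
Qed.

Lemma measurable_adjugate p (f : T -> 'M[R]_p) :
  measurable_fun setT f -> measurable_fun setT (fun t => \adj (f t)).
Proof.
move=> mf; apply: measurable_mxP => i j; under eq_fun do rewrite mxE.
apply: measurable_funM => //; apply: measurable_det.
by apply: measurable_mxP => k l; under eq_fun do rewrite !mxE; exact: measurable_entry_comp.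
Qed.

Lemma measurable_row_mx_comp p q r (f : T -> 'M[R]_(p, q)) (g : T -> 'M[R]_(p, r)) :
  measurable_fun setT f -> measurable_fun setT g ->
  measurable_fun setT (fun t => row_mx (f t) (g t)).
Proof.
move=> mf mg.
exact: (measurableT_comp (@measurable_row_mx R p q r) (measurable_fun_pair mf mg)).
Qed.

Lemma measurable_col_mx_comp p q r (f : T -> 'M[R]_(p, r)) (g : T -> 'M[R]_(q, r)) :
  measurable_fun setT f -> measurable_fun setT g ->
  measurable_fun setT (fun t => col_mx (f t) (g t)).
Proof.
move=> mf mg.
exact: (measurableT_comp (@measurable_col_mx R p q r) (measurable_fun_pair mf mg)).
Qed.

End matrix_measurability.

(** * Fubini formulas for Gaussian blocks and plane rotations *)

Section gauss_calculus.
Context {R : realType}.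
Local Notation leb := (@lebesgue_measure R).
Local Notation normal1 := (@normal_prob R 0 1).
Local Open Scope ereal_scope.

Lemma gauss_row_mx p q1 q2 (f : 'M[R]_(p, q1 + q2) -> \bar R) :
  measurable_fun setT f -> (forall X, 0 <= f X) ->
  \int[gauss p (q1 + q2)]_X f X =
  \int[gauss p q1]_X \int[gauss p q2]_Y f (row_mx X Y).
Proof.
move=> mf f0.
rewrite (gauss_integral (mu := gauss p q1 \x gauss p q2) (@measurable_row_mx R p q1 q2))//.
- rewrite fubini_tonelli1//=.
  exact: (measurableT_comp mf (@measurable_row_mx R p q1 q2)).
- by apply: is_gauss_row_mx => B mB; rewrite gaussE.
Qed.

Lemma gauss_col_mx p1 p2 q (f : 'M[R]_(p1 + p2, q) -> \bar R) :
  measurable_fun setT f -> (forall X, 0 <= f X) ->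
  \int[gauss (p1 + p2) q]_X f X =
  \int[gauss p1 q]_X \int[gauss p2 q]_Y f (col_mx X Y).
Proof.
move=> mf f0.
rewrite (gauss_integral (mu := gauss p1 q \x gauss p2 q) (@measurable_col_mx R p1 p2 q))//.
- rewrite fubini_tonelli1//=.
  exact: (measurableT_comp mf (@measurable_col_mx R p1 p2 q)).
- by apply: is_gauss_col_mx => B mB; rewrite gaussE.
Qed.

Lemma gauss_trmx p q (f : 'M[R]_(p, q) -> \bar R) :
  measurable_fun setT f -> (forall X, 0 <= f X) ->
  \int[gauss p q]_X f X = \int[gauss q p]_X f X^T.
Proof.
move=> mf f0; rewrite (gauss_integral (mu := gauss q p) (g := trmx))//.
  exact/measurable_trmx/measurable_id.
move=> B mB; rewrite exchange_big/= -gaussE//; congr (gauss _ _ _).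
by apply/seteqP; split => X /= BX i j; have := BX j i; rewrite mxE.
Qed.

Lemma gauss_const_mx (f : 'M[R]_(1, 1) -> \bar R) :
  measurable_fun setT f -> (forall X, 0 <= f X) ->
  \int[gauss 1 1]_X f X = \int[normal1]_x f (const_mx x).
Proof.
move=> mf f0; rewrite (gauss_integral (mu := normal1) (g := const_mx))//.
  exact/measurable_const_mx/measurable_id.
move=> B mB; rewrite !big_ord1; congr (normal1 _).
apply/seteqP; split => [x /= /(_ ord0 ord0)|x /= Bx i j]; rewrite mxE//.
by rewrite !ord1.
Qed.

Lemma gauss_exchange p q p' q' (f : 'M[R]_(p, q) * 'M[R]_(p', q') -> \bar R) :
  measurable_fun setT f -> (forall X, 0 <= f X) ->
  \int[gauss p q]_X \int[gauss p' q']_Y f (X, Y) =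
  \int[gauss p' q']_Y \int[gauss p q]_X f (X, Y).
Proof. by move=> mf f0; rewrite fubini_tonelli. Qed.

Lemma normal1N (f : R -> \bar R) : measurable_fun setT f -> (forall x, 0 <= f x) ->
  \int[normal1]_x f x = \int[normal1]_x f (- x)%R.
Proof.
move=> mf f0; rewrite !integral_normal//; last by apply: measurableT_comp.
have mfphi : measurable_fun setT (fun x : R => f x * (phi x)%:E).
  by apply: emeasurable_funM => //; apply/measurable_EFinP; exact: measurable_phi.
have fphi0 x : 0 <= f x * (phi x)%:E by rewrite mule_ge0 ?lee_fin ?phi_ge0.
rewrite (integral_lebesgueN mfphi fphi0).
by apply: eq_integral => x _; rewrite /phi sqrrN.
Qed.

Lemma normal1_prod (F : R * R -> \bar R) :
  measurable_fun setT F -> (forall z, 0 <= F z) ->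
  \int[normal1]_x \int[normal1]_y F (x, y) =
  \int[leb]_x \int[leb]_y (F (x, y) * (phi x * phi y)%:E).
Proof.
move=> mF F0; rewrite integral_normal.
- apply: eq_integral => x _; rewrite integral_normal//.
    rewrite -ge0_integralZr//.
    + by apply: eq_integral => y _; rewrite -muleA -EFinM [(phi y * _)%R]mulrC.
    + apply: emeasurable_funM; first exact: measurable_fun_pair2.
      by apply/measurable_EFinP; exact: measurable_phi.
    + by move=> y _; rewrite mule_ge0 ?lee_fin ?phi_ge0.
    + by rewrite lee_fin phi_ge0.
  exact: measurable_fun_pair2.
- exact: (@measurable_fun_fubini_tonelli_F _ _ _ _ _ normal1 F).
- by move=> x; apply: integral_ge0.
Qed.

(** A planar change of variables is done by two affine ones. For fixed [x], the variable
    [u = c x + s y] replaces [y]; for fixed [u], the variable [v] with [x = c u - s v] replaces [x].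
    Both sides become [s^-1] times the double integral of [G (u, x)]; dividing by [s] is the reason
    for [0 < s]. *)
Lemma normal1_rotation (c s : R) (F : R * R -> \bar R) :
  (0 < s)%R -> (c ^+ 2 + s ^+ 2 = 1)%R ->
  measurable_fun setT F -> (forall z, 0 <= F z) ->
  \int[normal1]_x \int[normal1]_y F (x, y) =
  \int[normal1]_x \int[normal1]_y F (c * x + s * y, c * y - s * x)%R.
Proof.
move=> s0 cs1 mF F0.
have sn0 : s != 0%R by exact: lt0r_neq0.
pose G (z : R * R) := F (z.1, (c * z.1 - z.2) / s)%R *
  (phi z.2 * phi ((z.1 - c * z.2) / s))%:E.
have mphi_comp d (T : measurableType d) (g : T -> R) : measurable_fun setT g ->
    measurable_fun setT (fun t => phi (g t)).
  by move=> mg; apply: measurableT_comp => //; exact: measurable_phi.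
have G0 z : 0 <= G z by rewrite mule_ge0 ?lee_fin ?mulr_ge0 ?phi_ge0.
have mfst : measurable_fun setT (fun z : R * R => z.1) by exact: measurable_fst.
have msnd : measurable_fun setT (fun z : R * R => z.2) by exact: measurable_snd.
have mG : measurable_fun setT G.
  apply: emeasurable_funM.
    apply: (measurableT_comp mF); apply: measurable_fun_pair => //.
    apply: measurable_funM => //; apply: measurable_funB => //.
    exact: measurable_funM.
  apply/measurable_EFinP/measurable_funM; apply: mphi_comp => //.
  by apply: measurable_funM => //; apply: measurable_funB => //; exact: measurable_funM.
transitivity (\int[leb]_u (s^-1%:E * \int[leb]_x G (u, x))); last first.
  transitivity (\int[leb]_u \int[leb]_x (s^-1%:E * G (u, x))).
    apply: eq_integral => u _; rewrite ge0_integralZl//.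
    - exact: measurable_fun_pair2.
    - by rewrite lee_fin invr_ge0 ltW.
  rewrite (@fubini_tonelli _ _ _ _ _ leb leb (fun z => s^-1%:E * G z)); last 2 first.
  - exact: emeasurable_funM.
  - by move=> z; rewrite mule_ge0// lee_fin invr_ge0 ltW.
  rewrite [RHS](_ : _ = \int[leb]_x \int[leb]_y
      (F (c * x + s * y, c * y - s * x)%R * (phi x * phi y)%:E)); last first.
    apply: (normal1_prod (F := fun z => F (c * z.1 + s * z.2, c * z.2 - s * z.1)%R)) => //.
    apply: (measurableT_comp mF); apply: measurable_fun_pair => //=.
      by apply: measurable_funD; exact: measurable_funM.
    by apply: measurable_funB; exact: measurable_funM.
  apply: eq_integral => x _.
  rewrite [RHS](integral_lebesgue_affine (a := s^-1) (- (c * x / s))%R) ?invr_gt0//.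
  - have mGx : measurable_fun setT (fun u : R => G (u, x)) by exact: measurable_fun_pair1.
    have s1 : 0 <= (s^-1)%:E by rewrite lee_fin invr_ge0 ltW.
    rewrite (ge0_integralZl leb measurableT mGx (fun u _ => G0 (u, x)) s1).
    apply: (congr1 (fun z => _ * z)); apply: eq_integral => u _; rewrite /G/=.
    congr (F (_, _) * (_ * phi _)%:E).
    + by field.
    + transitivity ((c * u - (c ^+ 2 + s ^+ 2) * x) / s)%R; last by field.
      by rewrite cs1 mul1r.
    + by field.
  - apply: emeasurable_funM.
      apply: (measurableT_comp mF); apply: measurable_fun_pair => //=.
        by apply: measurable_funD => //; exact: measurable_funM.
      by apply: measurable_funB => //; exact: measurable_funM.
    apply/measurable_EFinP; apply: measurable_funM => //; exact: measurable_phi.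
  - by move=> y; rewrite mule_ge0 ?lee_fin ?mulr_ge0 ?phi_ge0.
rewrite normal1_prod//; apply: eq_integral => u _.
have mGu : measurable_fun setT (fun x : R => G (u, x)).
  by apply: (measurableT_comp mG); apply: measurable_fun_pair.
rewrite (integral_lebesgueN mGu (fun x => G0 (u, x))).
have mGuN : measurable_fun setT (fun x : R => G (u, - x)%R).
  by apply: (measurableT_comp mG); apply: measurable_fun_pair.
rewrite (integral_lebesgue_affine (- (c * u))%R s0 mGuN (fun x => G0 (u, - x)%R)).
rewrite muleA -EFinM mulVf// mul1e; apply: eq_integral => v _; rewrite /G/=.
congr (F (_, _) * _%:E); first by field.
rewrite /phi mulrACA [in RHS]mulrACA -!expRD; congr (_ * expR _)%R.
rewrite -!mulrDl -!opprD; congr (- _ / _)%R.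
transitivity ((c ^+ 2 + s ^+ 2) * (u ^+ 2 + v ^+ 2))%R; first by rewrite cs1 mul1r.
(* [s ^+ 2] is spelled [(c ^+ 2 + s ^+ 2) - c ^+ 2]: the identity then holds for all [c], [s], and
   rewriting with [cs1] gives the argument of the second density. *)
transitivity ((c * u - s * v) ^+ 2 + (c * v + ((c ^+ 2 + s ^+ 2) - c ^+ 2) * u / s) ^+ 2)%R; first by field.
by rewrite cs1; congr (_ + _)%R; [ring|congr (_ ^+ 2)%R; field].
Qed.
End gauss_calculus.

(** * Rotation invariance *)

Section rotations.
Context {R : realType}.
Local Notation normal1 := (@normal_prob R 0 1).

Definition vnorm n (v : 'rV[R]_n) : R := Num.sqrt ((v *m v^T) 0 0).

Lemma sqr_norm_ge0 n (v : 'rV[R]_n) : 0 <= (v *m v^T) 0 0.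
Proof. by rewrite mxE sumr_ge0// => i _; rewrite mxE -expr2 sqr_ge0. Qed.

Lemma sqr_norm_eq0 n (v : 'rV[R]_n) : ((v *m v^T) 0 0 == 0) = (v == 0).
Proof.
apply/eqP/eqP => [|->]; last by rewrite mul0mx mxE.
rewrite mxE => v0; apply/rowP => i.
have v_ge0 j : true -> 0 <= v 0 j * v^T j 0 by rewrite mxE -expr2 sqr_ge0.
have /eqP := psumr_eq0P v_ge0 v0 (erefl : xpredT i).
by rewrite !mxE -expr2 sqrf_eq0 => /eqP.
Qed.

Lemma vnorm_sqr n (v : 'rV[R]_n) : vnorm v ^+ 2 = (v *m v^T) 0 0.
Proof. by rewrite sqr_sqrtr// sqr_norm_ge0. Qed.

Lemma vnorm_ge0 n (v : 'rV[R]_n) : 0 <= vnorm v.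
Proof. exact: sqrtr_ge0. Qed.

Lemma vnorm_eq0 n (v : 'rV[R]_n) : (vnorm v == 0) = (v == 0).
Proof. by rewrite -sqr_norm_eq0 -vnorm_sqr sqrf_eq0. Qed.

Lemma vnorm_row_mx n (x : R) (v : 'rV[R]_n) :
  vnorm (row_mx (const_mx x : 'rV_1) v) = Num.sqrt (x ^+ 2 + vnorm v ^+ 2).
Proof.
congr Num.sqrt; rewrite vnorm_sqr tr_row_mx mul_row_col mxE; congr (_ + _).
by rewrite mxE big_ord1 !mxE expr2.
Qed.

Lemma vnormZ n (c : R) (v : 'rV[R]_n) : vnorm (c *: v) = `|c| * vnorm v.
Proof.
rewrite /vnorm -sqrtr_sqr -sqrtrM ?sqr_ge0//; congr Num.sqrt.
by rewrite linearZ/= -scalemxAr -scalemxAl !mxE mulrA expr2.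
Qed.

Lemma vnorm_orth n (O : 'M[R]_n) (v : 'rV[R]_n) :
  O *m O^T = 1%:M -> vnorm (v *m O) = vnorm v.
Proof.
by move=> O1; rewrite /vnorm trmx_mul mulmxA -(mulmxA v) O1 mulmx1.
Qed.

(* Only the orthogonal matrices needed below are shown to preserve [gauss]: products of
   plane rotations, which suffice to align any vector with the first axis. *)
Definition gauss_invariant n (O : 'M[R]_n) :=
  O *m O^T = 1%:M /\
  forall f : 'M[R]_(1, n) -> \bar R, measurable_fun setT f ->
    (forall X, 0 <= f X)%E ->
    (\int[gauss 1 n]_X f (X *m O) = \int[gauss 1 n]_X f X)%E.

Lemma measurable_mulmx_comp p q r (f : 'M[R]_(p, r) -> \bar R) (O : 'M[R]_(q, r)) :
  measurable_fun setT f -> measurable_fun setT (fun X => f (X *m O)).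
Proof.
move=> mf; apply: (measurableT_comp mf); apply: measurable_mulmx => //.
Qed.

Lemma gauss_invariant1 n : gauss_invariant (1%:M : 'M[R]_n).
Proof.
split=> [|f mf f0]; first by rewrite trmx1 mulmx1.
by apply: eq_integral => X _; rewrite mulmx1.
Qed.

Lemma gauss_invariantM n (O1 O2 : 'M[R]_n) :
  gauss_invariant O1 -> gauss_invariant O2 -> gauss_invariant (O1 *m O2).
Proof.
move=> [oo1 g1] [oo2 g2]; split=> [|f mf f0].
  by rewrite trmx_mul mulmxA -(mulmxA O1) oo2 mulmx1.
transitivity (\int[gauss 1 n]_X f (X *m O1 *m O2))%E.
  by apply: eq_integral => X _; rewrite mulmxA.
rewrite -(g2 f)// (g1 (fun X => f (X *m O2)))//.
exact: measurable_mulmx_comp.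
Qed.

Lemma gauss_invariantV n (O : 'M[R]_n) :
  gauss_invariant O -> gauss_invariant O^T.
Proof.
move=> [oO gO]; split=> [|f mf f0]; first by rewrite trmxK; exact: mulmx1C.
rewrite -(gO (fun X => f (X *m O^T)))//; last exact: measurable_mulmx_comp.
by apply: eq_integral => X _; rewrite -mulmxA oO mulmx1.
Qed.

Lemma gauss_invariant_block m n (O1 : 'M[R]_m) (O2 : 'M[R]_n) :
  gauss_invariant O1 -> gauss_invariant O2 ->
  gauss_invariant (block_mx O1 0 0 O2).
Proof.
move=> [oo1 g1] [oo2 g2]; split=> [|f mf f0].
  rewrite tr_block_mx mulmx_block !trmx0 !mulmx0 !mul0mx !addr0 !add0r oo1 oo2.
  by rewrite -scalar_mx_block.
have mfO : measurable_fun setT (fun X => f (X *m block_mx O1 0 0 O2)).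
  exact: measurable_mulmx_comp.
rewrite (gauss_row_mx mfO (fun X => f0 _)) (gauss_row_mx mf f0).
have mr (O : 'M[R]_n) : measurable_fun setT (fun X : 'M[R]_(1, m) * 'M[R]_(1, n) => f (row_mx X.1 (X.2 *m O))).
  apply: (measurableT_comp mf); apply: measurable_row_mx_comp => //.
  by apply: measurable_mulmx.
transitivity (\int[gauss 1 m]_X \int[gauss 1 n]_Y f (row_mx (X *m O1) Y))%E.
  apply: eq_integral => X _.
  rewrite -(g2 (fun Y => f (row_mx (X *m O1) Y)))//.
    by apply: eq_integral => Y _; rewrite mul_row_block !mulmx0 addr0 add0r.
  by apply: (measurableT_comp mf); apply: measurable_row_mx_comp.
apply: (g1 (fun X => \int[gauss 1 n]_Y f (row_mx X Y))%E).
  apply: (@measurable_fun_fubini_tonelli_F _ _ _ _ _ (gauss 1 n) (fun X => f (row_mx X.1 X.2))) => //.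
  by apply: (measurableT_comp mf); apply: measurable_row_mx_comp.
by move=> X; apply: integral_ge0.
Qed.

Lemma gauss_invariantN1 : gauss_invariant (- 1%:M : 'M[R]_1).
Proof.
split=> [|f mf f0]; first by rewrite linearN/= trmx1 mulNmx mulmxN mulmx1 opprK.
rewrite !gauss_const_mx//; last exact: measurable_mulmx_comp.
rewrite [RHS]normal1N//; last first.
  by apply: (measurableT_comp mf); exact: measurable_const_mx.
apply: eq_integral => x _; rewrite mulmxN mulmx1; congr f.
by apply/matrixP => i j; rewrite !mxE.
Qed.

Lemma gauss_invariant_rotation (c s : R) : 0 < s -> c ^+ 2 + s ^+ 2 = 1 ->
  gauss_invariant (block_mx c%:M (- s%:M) s%:M c%:M : 'M[R]_(1 + 1)).
Proof.
move=> s0 cs1; split=> [|f mf f0].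
  rewrite tr_block_mx mulmx_block linearN/= !tr_scalar_mx !mulmxN !mulNmx opprK.
  rewrite -!scalar_mxM -!(rmorphN (@scalar_mx R 1)) -!(rmorphD (@scalar_mx R 1)) scalar_mx_block -!expr2.
  rewrite [s ^+ 2 + _]addrC cs1 [c * s]mulrC !addrN.
  by rewrite !(rmorph0 (@scalar_mx R 1)).
have mg (g : 'M[R]_(1, 1 + 1) -> \bar R) : measurable_fun setT g -> (forall X, 0 <= g X)%E ->
   (\int[gauss 1 (1 + 1)]_X g X = \int[normal1]_x \int[normal1]_y
     g (row_mx (const_mx x : 'M[R]_(1, 1)) (const_mx y : 'M[R]_(1, 1))))%E.
  move=> mg g0; rewrite gauss_row_mx// gauss_const_mx//.
  - apply: eq_integral => x _; rewrite gauss_const_mx//.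
    by apply: (measurableT_comp mg); apply: measurable_row_mx_comp.
  - apply: (@measurable_fun_fubini_tonelli_F _ _ _ _ _ (gauss 1 1) (fun X => g (row_mx X.1 X.2))) => //.
    by apply: (measurableT_comp mg); apply: measurable_row_mx_comp.
  - by move=> X; apply: integral_ge0.
have mfG := measurable_mulmx_comp (block_mx c%:M (- s%:M) s%:M c%:M : 'M[R]_(1 + 1)) mf.
rewrite (mg _ mfG (fun X => f0 _)) (mg _ mf f0).
have mfz : measurable_fun setT
    (fun z : R * R => f (row_mx (const_mx z.1 : 'M[R]_(1, 1)) (const_mx z.2 : 'M[R]_(1, 1)))).
  by apply: (measurableT_comp mf); apply: measurable_row_mx_comp; exact: measurable_const_mx.
rewrite [RHS](normal1_rotation s0 cs1 mfz (fun z => f0 _)).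
apply: eq_integral => x _; apply: eq_integral => y _; congr f.
rewrite mul_row_block; congr row_mx; apply/matrixP => i j;
  by rewrite !mxE !big_ord1 !mxE !ord1 eqxx !mulr1n /=; ring.
Qed.

(** By induction the tail of [v] is aligned with its own first axis; at most two nonzero coordinates
    remain and one plane rotation merges them. If the tail vanishes, a reflection may be needed to
    fix the sign. *)
Lemma gauss_invariant_align n (v : 'rV[R]_(1 + n)) :
  exists2 O, gauss_invariant O & v *m O = row_mx (const_mx (vnorm v)) 0.
Proof.
elim: n v => [v|n IH v].
  have vE : v = row_mx (const_mx (v 0 0)) 0.
    apply/rowP => i; case: (split_ordP i) => j ->.
      by rewrite row_mxEl mxE; congr (v _ _); apply/val_inj; rewrite /= ord1.
    by case: j.
  have [v0|v0] := leP 0 (v 0 0).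
    exists 1%:M; first exact: gauss_invariant1.
    rewrite mulmx1 {2}vE vnorm_row_mx [X in _ + X ^+ 2](_ : _ = 0); last first.
      by apply/eqP; rewrite vnorm_eq0.
    by rewrite expr0n addr0 sqrtr_sqr ger0_norm.
  exists (- 1%:M); first exact: gauss_invariantN1.
  rewrite mulmxN mulmx1 {2}vE vnorm_row_mx [X in _ + X ^+ 2](_ : _ = 0); last first.
    by apply/eqP; rewrite vnorm_eq0.
  rewrite expr0n addr0 sqrtr_sqr ltr0_norm// {1}vE opp_row_mx oppr0; congr row_mx.
  by apply/matrixP => i j; rewrite !mxE.
pose x := lsubmx v 0 0.
have vE : v = row_mx (const_mx x : 'M[R]_1) (rsubmx v).
  by rewrite -[LHS]hsubmxK; congr row_mx; apply/matrixP => i j; rewrite [RHS]mxE !ord1.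
have [Q Qi Qv] := IH (rsubmx v).
pose r := vnorm (rsubmx v).
have vr : vnorm v = Num.sqrt (x ^+ 2 + r ^+ 2) by rewrite {1}vE vnorm_row_mx.
have B1i := gauss_invariant_block (gauss_invariant1 1) Qi.
have B1v : v *m block_mx 1%:M 0 0 Q =
    row_mx (const_mx x : 'M[R]_1) (row_mx (const_mx r : 'M[R]_1) (0 : 'M[R]_(1, n))).
  by rewrite {1}vE mul_row_block !mulmx0 addr0 add0r mulmx1 Qv.
have [r0|r0] := eqVneq r 0.
  have B1v' : v *m block_mx 1%:M 0 0 Q = row_mx (const_mx x : 'M[R]_1) (0 : 'M[R]_(1, 1 + n)).
    by rewrite B1v r0; congr row_mx; rewrite -[RHS]hsubmxK !linear0.
  rewrite r0 expr0n addr0 sqrtr_sqr in vr.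
  have [x0|x0] := leP 0 x.
    by exists (block_mx 1%:M 0 0 Q); rewrite // vr ger0_norm.
  exists (block_mx 1%:M 0 0 Q *m block_mx (- 1%:M) 0 0 1%:M).
    apply: gauss_invariantM => //; apply: gauss_invariant_block.
      exact: gauss_invariantN1.
    exact: gauss_invariant1.
  rewrite mulmxA B1v' mul_row_block !mulmx0 !mul0mx !addr0 mulmxN mulmx1 vr ltr0_norm//.
  by congr row_mx; apply/matrixP => i j; rewrite !mxE.
have rp : 0 < r by rewrite lt_neqAle eq_sym r0 vnorm_ge0.
have vp : 0 < vnorm v.
  by rewrite vr sqrtr_gt0 ltr_wpDl ?sqr_ge0// exprn_gt0.
pose c := x / vnorm v; pose s := r / vnorm v.
have cs1 : c ^+ 2 + s ^+ 2 = 1.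
  have d0 : 0 < x ^+ 2 + r ^+ 2 by rewrite ltr_wpDl ?sqr_ge0// exprn_gt0.
  by rewrite /c /s !expr_div_n -mulrDl vr (sqr_sqrtr (ltW d0)) divff// gt_eqF.
have s0 : 0 < s by rewrite divr_gt0.
have B2i := gauss_invariant_block (gauss_invariant_rotation s0 cs1) (gauss_invariant1 n).
pose O2 : 'M[R]_(1 + (1 + n)) :=
  (block_mx (block_mx c%:M (- s%:M) s%:M c%:M) 0 0 1%:M : 'M[R]_((1 + 1) + n)).
have O2i : gauss_invariant O2 by exact: B2i.
exists (block_mx 1%:M 0 0 Q *m O2); first exact: gauss_invariantM.
(* The two associations of the dimension are convertible, so the cast of [row_mxA] is the
   identity. *)
have rA (a b : 'M[R]_1) (w : 'M[R]_(1, n)) :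
    row_mx a (row_mx b w) = (row_mx (row_mx a b) w : 'M[R]_(1, (1 + 1) + n)).
  by rewrite row_mxA (_ : esym _ = erefl) ?castmx_id//; exact: eq_irrelevance.
rewrite mulmxA B1v rA.
rewrite [LHS](mul_row_block (row_mx (const_mx x : 'M[R]_1) (const_mx r : 'M[R]_1))
  (0 : 'M[R]_(1, n)) (block_mx c%:M (- s%:M) s%:M c%:M) 0 0 1%:M).
rewrite !mulmx0 mul0mx add0r addr0 mul_row_block.
have -> : (0 : 'M[R]_(1, 1 + n)) = row_mx (0 : 'M[R]_1) (0 : 'M[R]_(1, n)).
  by rewrite -[LHS]hsubmxK !linear0.
have xE : x = c * vnorm v by rewrite /c divfK// gt_eqF.
have rE : r = s * vnorm v by rewrite /s divfK// gt_eqF.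
have -> : const_mx x *m c%:M + const_mx r *m s%:M = const_mx (vnorm v) :> 'M[R]_1.
  apply/matrixP => i j.
  by rewrite !mxE !big_ord1 !mxE !ord1 eqxx !mulr1n xE rE -[RHS]mul1r -cs1; ring.
have -> : const_mx x *m - s%:M + const_mx r *m c%:M = 0 :> 'M[R]_1.
  apply/matrixP => i j.
  by rewrite !mxE !big_ord1 !mxE !ord1 eqxx !mulr1n xE rE; ring.
by rewrite [RHS]rA.
Qed.
End rotations.

(** * Linear images, hyperplanes and rank of Gaussian matrices *)

Section gauss_laws.
Context {R : realType}.
Local Notation normal1 := (@normal_prob R 0 1).
Local Open Scope ereal_scope.

Lemma gauss_cst p q (x : \bar R) : \int[gauss p q]_(X in [set: 'M[R]_(p, q)]) x = x.
Proof.
rewrite integral_cst// [X in _ * X](_ : _ = 1) ?mule1//.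
exact: (@probability_setT _ _ _ (gauss p q)).
Qed.

Lemma gauss_indic p q (A : set 'M[R]_(p, q)) : measurable A ->
  gauss p q A = \int[gauss p q]_X (\1_A X)%:E.
Proof. by move=> mA; rewrite integral_indic// setIT. Qed.

Lemma gauss_mulmxr p n (O : 'M[R]_n) (f : 'M[R]_(p, n) -> \bar R) :
  gauss_invariant O -> measurable_fun setT f -> (forall X, 0 <= f X) ->
  \int[gauss p n]_X f (X *m O) = \int[gauss p n]_X f X.
Proof.
move=> [_ gO]; elim: p f => [|p IH] f mf f0.
  by apply: eq_integral => X _; congr f; apply/matrixP => -[].
rewrite -[p.+1]/(1 + p)%N in f mf f0 *.
have mfO : measurable_fun setT (fun X => f (X *m O)) by exact: measurable_mulmx_comp.
rewrite (gauss_col_mx mfO (fun X => f0 _)) (gauss_col_mx mf f0).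
transitivity (\int[gauss 1 n]_X \int[gauss p n]_Y f (col_mx (X *m O) Y)).
  apply: eq_integral => X _.
  rewrite -(IH (fun Y => f (col_mx (X *m O) Y)))//.
    by apply: eq_integral => Y _; rewrite mul_col_mx.
  by apply: (measurableT_comp mf); apply: measurable_col_mx_comp.
apply: (gO (fun X => \int[gauss p n]_Y f (col_mx X Y))).
  apply: (@measurable_fun_fubini_tonelli_F _ _ _ _ _ (gauss p n) (fun X => f (col_mx X.1 X.2))) => //.
  by apply: (measurableT_comp mf); apply: measurable_col_mx_comp.
by move=> X; apply: integral_ge0.
Qed.

Lemma gauss_mulmxl p n (O : 'M[R]_p) (f : 'M[R]_(p, n) -> \bar R) :
  gauss_invariant O -> measurable_fun setT f -> (forall X, 0 <= f X) ->
  \int[gauss p n]_X f (O *m X) = \int[gauss p n]_X f X.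
Proof.
move=> gO mf f0.
have mfO : measurable_fun setT (fun X : 'M[R]_(p, n) => f (O *m X)).
  by apply: (measurableT_comp mf); apply: measurable_mulmx.
rewrite gauss_trmx// [RHS]gauss_trmx//.
rewrite -[RHS](gauss_mulmxr (gauss_invariantV gO))//.
  by apply: eq_integral => X _; rewrite trmx_mul trmxK.
by apply: (measurableT_comp mf); apply: measurable_trmx.
Qed.

(** Rotating the rows so that [t] lies on the first axis leaves [vnorm t] times the first row. *)
Lemma gauss_lincomb p q (t : 'rV[R]_p) (f : 'M[R]_(1, q) -> \bar R) :
  measurable_fun setT f -> (forall X, 0 <= f X) ->
  \int[gauss p q]_X f (t *m X) = \int[gauss 1 q]_x f (vnorm t *: x).
Proof.
case: p t => [|p] t mf f0.
  have -> : vnorm t = 0%R by apply/eqP; rewrite vnorm_eq0; apply/eqP/rowP => -[].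
  transitivity (f 0%R); last first.
    by rewrite -[LHS](gauss_cst 1 q); apply: eq_integral => x _; rewrite scale0r.
  rewrite -[RHS](gauss_cst 0 q); apply: eq_integral => x _; congr f.
  by apply/rowP => i; rewrite !mxE big_ord0.
rewrite -[p.+1]/(1 + p)%N in t *.
have [Q Qi tQ] := gauss_invariant_align t.
have mft : measurable_fun setT (fun X => f (t *m X)).
  by apply: (measurableT_comp mf); apply: measurable_mulmx.
rewrite -(gauss_mulmxl Qi)// gauss_col_mx//; last first.
  by apply: (measurableT_comp mft); apply: measurable_mulmx.
apply: eq_integral => X _.
rewrite -[RHS](gauss_cst p q); apply: eq_integral => Y _; congr f.
rewrite mulmxA tQ mul_row_col mul0mx addr0.
by apply/matrixP => i j; rewrite !mxE big_ord1 !mxE !ord1.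
Qed.

Lemma gauss_dot q (u : 'rV[R]_q) (f : R -> \bar R) :
  measurable_fun setT f -> (forall x, 0 <= f x) ->
  \int[gauss 1 q]_x f ((x *m u^T) 0 0)%R = \int[normal1]_z f (vnorm u * z)%R.
Proof.
move=> mf f0.
have mf00 : measurable_fun setT (fun X : 'M[R]_(1, 1) => f (X 0 0)%R).
  by apply: (measurableT_comp mf).
rewrite gauss_trmx//; last first.
  by apply: (measurableT_comp mf00); apply: measurable_mulmx.
transitivity (\int[gauss q 1]_X f ((u *m X) 0 0)%R).
  by apply: eq_integral => X _; rewrite -trmx_mul mxE.
rewrite (gauss_lincomb u mf00)// gauss_const_mx//; last first.
  by apply: (measurableT_comp mf00); apply: measurable_scalemx.
by apply: eq_integral => z _; rewrite !mxE.
Qed.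

Lemma measurable_dot q (u : 'rV[R]_q) :
  measurable_fun setT (fun x : 'rV[R]_q => (x *m u^T) 0 0)%R.
Proof.
apply: (measurable_entry_comp (f := fun x : 'rV[R]_q => x *m u^T)).
by apply: measurable_mulmx.
Qed.

Lemma measurable_hyperplane q (u : 'rV[R]_q) :
  measurable [set x : 'rV[R]_q | (x *m u^T) 0 0 = 0]%R.
Proof.
rewrite -[X in measurable X]setTI.
exact: (measurable_dot u measurableT (measurable_set1 0%R)).
Qed.

Lemma normal1_set1 x : normal1 [set x] = 0.
Proof.
have /null_content_dominatesP := @normal_prob_dominates R 0 1.
by apply; [exact: measurable_set1|exact: lebesgue_measure_set1].
Qed.

Lemma normal1_gt0 : normal1 [set x | 0 < x]%R = (2^-1)%:E.
Proof.
have mpos : measurable [set x : R | 0 < x]%R.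
  by have -> : [set x : R | 0 < x]%R = `]0%R, +oo[%classic by rewrite set_itvE.
have mneg : measurable [set x : R | x < 0]%R.
  by have -> : [set x : R | x < 0]%R = `]-oo, 0%R[%classic by rewrite set_itvE.
have split1 : normal1 [set x | 0 < x]%R + normal1 [set x | x < 0]%R = 1.
  rewrite -measureU//; last first.
    apply/seteqP; split => // x /= -[x0 x0'].
    by have := lt_trans x0 x0'; rewrite ltxx.
  rewrite -[RHS](@probability_setT _ _ _ normal1).
  rewrite (_ : setT = ([set x | 0 < x]%R `|` [set x | x < 0]%R) `|` [set 0%R]).
    rewrite [RHS]measureU//; first by rewrite [X in _ = _ + X]normal1_set1 adde0.
    - exact: measurableU.
    - by apply/seteqP; split => // x /= -[[] + x0]; rewrite x0 ltxx.
  apply/seteqP; split => // x _ /=.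
  by have [x0|x0|x0] := ltgtP 0%R x; [left; left|left; right|right].
have sym : normal1 [set x | x < 0]%R = normal1 [set x | 0 < x]%R.
  transitivity (\int[normal1]_x (\1_[set x : R | x < 0]%R x)%:E).
    by rewrite integral_indic// setIT.
  rewrite normal1N//; last by apply/measurable_EFinP; apply: measurable_indic.
  transitivity (\int[normal1]_x (\1_[set x : R | 0 < x]%R x)%:E); last first.
    by rewrite integral_indic// setIT.
  apply: eq_integral => x _; rewrite !indicE; congr ((nat_of_bool _)%:R)%:E.
  by apply/idP/idP; rewrite !in_setE/= oppr_lt0.
have fin : normal1 [set x | 0 < x]%R \is a fin_num by exact: fin_num_measure.
move: split1; rewrite sym -(fineK fin) -EFinD => -[h].
by congr EFin; lra.
Qed.

Lemma gauss_hyperplane q (u : 'rV[R]_q) : u != 0%R ->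
  gauss 1 q [set x | ((x *m u^T) 0 0 = 0)%R] = 0.
Proof.
move=> u0.
rewrite gauss_indic; last exact: measurable_hyperplane.
transitivity (\int[gauss 1 q]_x (\1_[set 0%R] ((x *m u^T) 0 0)%R)%:E); first by [].
rewrite (gauss_dot u (f := fun x => (\1_[set 0%R] x)%:E))//; last first.
  by apply/measurable_EFinP; apply: measurable_indic.
transitivity (\int[normal1]_z (\1_[set 0%R] z)%:E); last first.
  by rewrite integral_indic// setIT; exact: normal1_set1.
apply: eq_integral => z _; rewrite !indicE; congr ((nat_of_bool _)%:R)%:E.
apply/idP/idP; rewrite !in_setE/=; last by move=> ->; rewrite mulr0.
move=> /eqP; by rewrite mulf_eq0 vnorm_eq0 (negbTE u0) => /eqP.
Qed.

Lemma gauss_halfspace q (u : 'rV[R]_q) : u != 0%R ->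
  gauss 1 q [set x | 0 < (x *m u^T) 0 0]%R = (2^-1)%:E.
Proof.
move=> u0.
have mpos : measurable [set x : R | 0 < x]%R.
  by have -> : [set x : R | 0 < x]%R = `]0%R, +oo[%classic by rewrite set_itvE.
have mu : measurable_fun setT (fun x : 'rV[R]_q => (x *m u^T) 0 0)%R.
  exact: measurable_dot.
have mS : measurable [set x : 'rV[R]_q | 0 < (x *m u^T) 0 0]%R.
  by rewrite -[X in measurable X]setTI; exact: (mu _ _ mpos).
rewrite gauss_indic//.
transitivity (\int[gauss 1 q]_x (\1_[set x : R | 0 < x]%R ((x *m u^T) 0 0)%R)%:E); first by [].
rewrite (gauss_dot u (f := fun x => (\1_[set x : R | 0 < x]%R x)%:E))//; last first.
  by apply/measurable_EFinP; apply: measurable_indic.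
transitivity (\int[normal1]_z (\1_[set x : R | 0 < x]%R z)%:E); last first.
  by rewrite integral_indic// setIT; exact: normal1_gt0.
have u_gt0 : (0 < vnorm u)%R by rewrite lt_neqAle eq_sym vnorm_eq0 u0 vnorm_ge0.
apply: eq_integral => z _; rewrite !indicE; congr ((nat_of_bool _)%:R)%:E.
by apply/idP/idP; rewrite !in_setE/= pmulr_rgt0//.
Qed.

Lemma det_gram_eq0 p q (X : 'M[R]_(p, q)) : \det (X *m X^T) = 0%R ->
  exists2 t : 'rV[R]_p, t != 0%R & t *m X = 0%R.
Proof.
move=> /eqP/det0P[t t0 tX]; exists t => //.
apply/eqP; rewrite -sqr_norm_eq0 trmx_mul mulmxA -(mulmxA t) tX mul0mx mxE.
by [].
Qed.

Lemma measurable_singular p q : measurable [set X : 'M[R]_(p, q) | \det (X *m X^T) = 0%R].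
Proof.
have mG : measurable_fun setT (fun X : 'M[R]_(p, q) => \det (X *m X^T)).
  by apply: measurable_det; apply: measurable_mulmx => //; apply: measurable_trmx.
rewrite -[X in measurable X]setTI.
exact: (mG measurableT _ (measurable_set1 0%R)).
Qed.

(** Induction on the rows. If the other [p] rows are independent, some [u] is orthogonal to all of
    them because [p < q], and a dependent new row must lie in the null hyperplane orthogonal to
    [u]. *)
Lemma gauss_full_rank p q : (p <= q)%N ->
  gauss p q [set X : 'M[R]_(p, q) | \det (X *m X^T) = 0%R] = 0.
Proof.
elim: p => [|p IH] pq.
  rewrite (_ : [set _ | _] = set0) ?measure0//.
  by apply/seteqP; split => // X /=; rewrite det_mx00 => /eqP; rewrite oner_eq0.
have /IH {}IH := ltnW pq.
rewrite gauss_indic; last exact: measurable_singular.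
pose f r (X : 'M[R]_(r, q)) : \bar R := (\1_[set X : 'M[R]_(r, q) | \det (X *m X^T) = 0%R] X)%:E.
have mf r : measurable_fun setT (f r).
  by apply/measurable_EFinP; apply: measurable_indic; exact: measurable_singular.
have f0 r X : 0 <= f r X by rewrite lee_fin.
have mfc : measurable_fun setT (fun X : 'M[R]_(1, q) * 'M[R]_(p, q) => f (1 + p)%N (col_mx X.1 X.2)).
  exact: (measurableT_comp (mf (1 + p)%N) (@measurable_col_mx R 1 p q)).
transitivity (\int[gauss (1 + p) q]_X f (1 + p)%N X); first by [].
rewrite (gauss_col_mx (mf _) (f0 _)).
rewrite (gauss_exchange mfc (fun _ => f0 _ _)).
apply/eqP; rewrite eq_le; apply/andP; split; last by do 2 (apply: integral_ge0 => ? _).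
rewrite -[leRHS]IH gauss_indic; last exact: measurable_singular.
apply: (@le_trans _ _ (\int[gauss p q]_X f p X)); last by [].
apply: ge0_le_integral => //.
- by move=> X _; apply: integral_ge0.
- by apply: (@measurable_fun_fubini_tonelli_G _ _ _ _ _ (gauss 1 q) (fun X => f (1 + p)%N (col_mx X.1 X.2))).
- exact: mf.
move=> A _; have [A0|A0] := eqVneq (\det (A *m A^T)) 0%R.
  have -> : f p A = 1 by rewrite /f indicE mem_set.
  rewrite -[leRHS](gauss_cst 1 q).
  apply: ge0_le_integral => //.
  - exact: (measurable_fun_pair1 A mfc).
  - by move=> X _; rewrite lee_fin indicE lern1; case: (_ \in _).
have -> : f p A = 0 by rewrite /f indicE memNset//=; apply/eqP.
have [u u0 Au] : exists2 u : 'rV[R]_q, u != 0%R & A *m u^T = 0%R.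
  have /rowV0Pn[u uA u0] : kermx A^T != 0%R.
    rewrite kermx_eq0 /row_free neq_ltn; apply/orP; left.
    by rewrite (leq_ltn_trans (rank_leq_col _)).
  by exists u => //; move/sub_kermxP : uA => uA; rewrite -[LHS]trmxK trmx_mul trmxK uA trmx0.
rewrite -(gauss_hyperplane u0) gauss_indic; last exact: measurable_hyperplane.
apply: ge0_le_integral => //.
- exact: (measurable_fun_pair1 A mfc).
- by apply/measurable_EFinP; apply: measurable_indic; exact: measurable_hyperplane.
move=> a _; rewrite lee_fin !indicE ler_nat.
have [|//] := boolP (col_mx a A \in _); rewrite in_setE/= => /det_gram_eq0[t t0].
rewrite -[t]hsubmxK mul_row_col => ta.
have t00 : lsubmx t 0%R 0%R != 0%R.
  apply: contraNneq A0 => l0.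
  have ltE : lsubmx t = 0%R by apply/matrixP => i j; rewrite !ord1 l0 mxE.
  move: ta; rewrite ltE mul0mx add0r => tA.
  apply/det0P; exists (rsubmx t); last by rewrite mulmxA tA mul0mx.
  by apply: contraNneq t0 => r0; rewrite -[t]hsubmxK ltE r0 row_mx0.
rewrite (_ : a \in _) ?lt0b// in_setE/=.
have : lsubmx t *m a *m u^T = 0%R.
  by apply/eqP; rewrite -[_ *m u^T]addr0 -{1}(mulmx0 _ (rsubmx t)) -Au mulmxA -mulmxDl ta mul0mx.
rewrite -mulmxA => /matrixP/(_ 0%R 0%R); rewrite !mxE big_ord1 => /eqP.
by rewrite mulf_eq0 (negbTE t00) => /eqP; rewrite !mxE.
Qed.
End gauss_laws.

(** * Scaling and shifting Gaussian vectors *)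

Section gauss_change_of_variables.
Context {R : realType}.
Local Notation leb := (@lebesgue_measure R).
Local Notation normal1 := (@normal_prob R 0 1).
Local Open Scope ereal_scope.

Lemma gauss_integral_row1 n (f : 'M[R]_(1, 1 + n) -> \bar R) :
  measurable_fun setT f -> (forall X, 0 <= f X) ->
  \int[gauss 1 (1 + n)]_X f X =
  \int[normal1]_x \int[gauss 1 n]_Y f (row_mx (const_mx x) Y).
Proof.
move=> mf f0.
have mfr : measurable_fun setT (fun X : 'M[R]_(1, 1) * 'M[R]_(1, n) => f (row_mx X.1 X.2)).
  exact: (measurableT_comp mf (@measurable_row_mx R 1 1 n)).
rewrite gauss_row_mx// gauss_const_mx//.
  apply: (@measurable_fun_fubini_tonelli_F _ _ _ _ _ (gauss 1 n) (fun X => f (row_mx X.1 X.2))) => //.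
by move=> X; apply: integral_ge0.
Qed.

(** Weighted one dimensional substitutions tensorize by Fubini, so scaling and shifting in dimension
    [n] require no Jacobian. *)
Lemma gauss_rowwise n (g w : 'I_n -> R -> R) :
  (forall i, measurable_fun setT (g i)) -> (forall i, measurable_fun setT (w i)) ->
  (forall i x, (0 <= w i x)%R) ->
  (forall i (f : R -> \bar R), measurable_fun setT f -> (forall x, 0 <= f x) ->
     \int[normal1]_x f x = \int[normal1]_x (f (g i x) * (w i x)%:E)) ->
  forall f : 'rV[R]_n -> \bar R, measurable_fun setT f -> (forall x, 0 <= f x) ->
  \int[gauss 1 n]_x f x =
  \int[gauss 1 n]_x (f (\row_j g j (x 0%R j)) * (\prod_j w j (x 0%R j))%R%:E).
Proof.
elim: n g w => [|n IH] g w mg mw w0 gw f mf f0.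
  apply: eq_integral => x _; rewrite big_ord0 mule1; congr f.
  by apply/rowP => -[].
rewrite -[n.+1]/(1 + n)%N in g w mg mw w0 gw f mf f0 *.
have mrow p q d (T : measurableType d) (h : 'I_q -> R -> R) (k : T -> 'M[R]_(p, q)) (i : 'I_p) :
    (forall i, measurable_fun setT (h i)) -> measurable_fun setT k ->
    measurable_fun setT (fun t => \row_j h j (k t i j)).
  move=> mh mk; apply: measurable_mxP => i' j; under eq_fun do rewrite mxE.
  by apply: measurableT_comp => //; apply: measurable_entry_comp.
have mprod q d (T : measurableType d) (h : 'I_q -> R -> R) (k : T -> 'rV[R]_q) :
    (forall i, measurable_fun setT (h i)) -> measurable_fun setT k ->
    measurable_fun setT (fun t => \prod_j h j (k t 0 j))%R.
  move=> mh mk; apply: measurable_prod => i _.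
  by apply: measurableT_comp => //; apply: measurable_entry_comp.
have prod0 q (h : 'I_q -> R -> R) (y : 'I_q -> R) : (forall i x, (0 <= h i x)%R) ->
    (0 <= \prod_j h j (y j))%R by move=> h0; apply: prodr_ge0.
pose gl := g (lshift n 0%R); pose wl := w (lshift n 0%R).
pose gr j := g (rshift 1 j); pose wr j := w (rshift 1 j).
rewrite !gauss_integral_row1//; last 2 first.
- apply: emeasurable_funM; first by apply: (measurableT_comp mf); exact: mrow.
  by apply/measurable_EFinP; exact: mprod.
- by move=> x; rewrite mule_ge0 ?lee_fin ?prod0.
pose F (z : R * 'rV[R]_n) := f (row_mx (const_mx z.1) (\row_j gr j (z.2 0 j)))%R *
   (\prod_j wr j (z.2 0 j))%R%:E.
have mF : measurable_fun setT F.
  apply: emeasurable_funM.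
    apply: (measurableT_comp mf); apply: measurable_row_mx_comp.
      exact: measurable_const_mx.
    by apply: mrow => // i; exact: mg.
  by apply/measurable_EFinP; apply: mprod => // i; exact: mw.
have F0 z : 0 <= F z by rewrite mule_ge0 ?lee_fin ?prod0// => i x; exact: w0.
transitivity (\int[normal1]_x \int[gauss 1 n]_Y F (x, Y)).
  apply: eq_integral => x _.
  apply: (IH gr wr (fun=> mg _) (fun=> mw _) (fun=> w0 _) (fun=> gw _)
    (fun Y => f (row_mx (const_mx x) Y))) => //.
  by apply: (measurableT_comp mf); apply: measurable_row_mx_comp.
rewrite (gw (lshift n 0%R) (fun x => \int[gauss 1 n]_Y F (x, Y)))//; last 2 first.
- exact: (@measurable_fun_fubini_tonelli_F _ _ _ _ _ (gauss 1 n) F).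
- by move=> x; apply: integral_ge0.
apply: eq_integral => x _.
rewrite -ge0_integralZr//; last 2 first.
- exact: (measurable_fun_pair2 _ mF).
- by rewrite lee_fin w0.
apply: eq_integral => Y _; rewrite /F/= -muleA -EFinM; congr (f _ * _%:E).
  apply/rowP => j; case: (split_ordP j) => k ->.
    by rewrite row_mxEl [RHS]mxE row_mxEl !mxE ord1.
  by rewrite row_mxEr [RHS]mxE row_mxEr !mxE.
rewrite big_split_ord big_ord1 mulrC; congr (_ * _)%R.
  by rewrite row_mxEl mxE.
by apply: eq_bigr => j _; rewrite row_mxEr.
Qed.

Lemma gauss_prod n (h : 'I_n -> R -> R) :
  (forall i, measurable_fun setT (h i)) -> (forall i x, (0 <= h i x)%R) ->
  \int[gauss 1 n]_x (\prod_j h j (x 0 j))%R%:E =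
  \prod_j \int[normal1]_x (h j x)%:E.
Proof.
elim: n h => [|n IH] h mh h0.
  rewrite big_ord0 -[RHS](gauss_cst 1 0); apply: eq_integral => x _.
  by rewrite big_ord0.
rewrite -[n.+1]/(1 + n)%N in h mh h0 *.
have mprod q (k : 'I_q -> R -> R) : (forall i, measurable_fun setT (k i)) ->
    measurable_fun setT (fun x : 'rV[R]_q => \prod_j k j (x 0 j))%R.
  move=> mk; apply: measurable_prod => i _.
  by apply: measurableT_comp => //; apply: measurable_entry_comp.
rewrite gauss_integral_row1//; last 2 first.
- by apply/measurable_EFinP; exact: mprod.
- by move=> x; rewrite lee_fin prodr_ge0.
rewrite big_split_ord big_ord1 -IH//.
have m1 : measurable_fun setT (fun x => (h (lshift n ord0) x)%:E) by apply/measurable_EFinP.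
have m2 : measurable_fun setT (fun x : 'rV[R]_n => (\prod_j h (rshift 1 j) (x 0%R j))%R%:E).
  by apply/measurable_EFinP; apply: (mprod _ (fun j => h (rshift 1 j))).
have p0 (x : 'rV[R]_n) : 0 <= (\prod_j h (rshift 1 j) (x 0%R j))%R%:E.
  by rewrite lee_fin prodr_ge0.
have h1 x : 0 <= (h (lshift n ord0) x)%:E by rewrite lee_fin.
transitivity ((\int[normal1]_x (h (lshift n ord0) x)%:E) *
  (\int[gauss 1 n]_x (\prod_j h (rshift 1 j) (x 0%R j))%R%:E)); last by [].
rewrite -(ge0_integralZr normal1 measurableT m1 (fun x _ => h1 x)); last first.
  by apply: integral_ge0.
apply: eq_integral => x _.
rewrite -(ge0_integralZl (gauss 1 n) measurableT m2 (fun x _ => p0 x) (h1 x)).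
apply: eq_integral => Y _; rewrite big_split_ord big_ord1 -EFinM row_mxEl mxE.
by congr (_ * _)%:E; apply: eq_bigr => j _; rewrite row_mxEr.
Qed.

Lemma normal1_scale (k : R) (f : R -> \bar R) : (0 < k)%R ->
  measurable_fun setT f -> (forall x, 0 <= f x) ->
  \int[normal1]_x f x =
  \int[normal1]_x (f (k * x)%R * (k * expR (- ((k ^+ 2 - 1) * x ^+ 2 / 2)))%:E).
Proof.
move=> k0 mf f0.
have mfk : measurable_fun setT (fun x => f (k * x)%R).
  by apply: (measurableT_comp mf); exact: measurable_funM.
have mw : measurable_fun setT (fun x : R => (k * expR (- ((k ^+ 2 - 1) * x ^+ 2 / 2)))%:E).
  apply/measurable_EFinP; apply: measurable_funM => //; apply: measurableT_comp => //.
  apply: measurableT_comp => //; apply: measurable_funM => //; exact: measurable_funM.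
have mfphi : measurable_fun setT (fun x : R => f x * (phi x)%:E).
  by apply: emeasurable_funM => //; apply/measurable_EFinP; exact: measurable_phi.
have fphi0 x : 0 <= f x * (phi x)%:E by rewrite mule_ge0 ?lee_fin ?phi_ge0.
rewrite (integral_normal mf f0) integral_normal; last 2 first.
- exact: emeasurable_funM.
- by move=> x; rewrite mule_ge0// lee_fin mulr_ge0 ?expR_ge0// ltW.
rewrite (integral_lebesgue_affine 0%R k0 mfphi fphi0).
have mfphik : measurable_fun setT (fun x : R => f (k * x + 0)%R * (phi (k * x + 0))%:E).
  by apply: (measurableT_comp mfphi); apply: measurable_funD => //; exact: measurable_funM.
have kE0 : 0 <= k%:E by rewrite lee_fin ltW.
rewrite -(ge0_integralZl leb measurableT mfphik (fun x _ => fphi0 _) kE0).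
apply: eq_integral => x _; rewrite addr0 muleCA -muleA; congr (_ * _).
rewrite -!EFinM; congr EFin; rewrite /phi mulrCA mulrA [in RHS]mulrCA -mulrA; congr (_ * _)%R.
rewrite -[RHS]mulrA -expRD; by congr (_ * expR _)%R; field.
Qed.

Lemma normal1_shift (y : R) (f : R -> \bar R) :
  measurable_fun setT f -> (forall x, 0 <= f x) ->
  \int[normal1]_x f (x + y)%R =
  \int[normal1]_x (f x * (expR (x * y - y ^+ 2 / 2))%:E).
Proof.
move=> mf f0.
have mw : measurable_fun setT (fun x : R => (expR (x * y - y ^+ 2 / 2))%:E).
  apply/measurable_EFinP; apply: measurableT_comp => //; apply: measurable_funB => //.
  exact: measurable_funM.
have mfw : measurable_fun setT (fun x : R => f x * (expR (x * y - y ^+ 2 / 2))%:E * (phi x)%:E).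
  apply: emeasurable_funM; first exact: emeasurable_funM.
  by apply/measurable_EFinP; exact: measurable_phi.
have fw0 x : 0 <= f x * (expR (x * y - y ^+ 2 / 2))%:E * (phi x)%:E.
  by rewrite !mule_ge0 ?lee_fin ?phi_ge0 ?expR_ge0.
rewrite integral_normal; last 2 first.
- by apply: (measurableT_comp mf); exact: measurable_funD.
- by [].
rewrite integral_normal; last 2 first.
- exact: emeasurable_funM.
- by move=> x; rewrite mule_ge0// lee_fin expR_ge0.
rewrite (integral_lebesgue_affine y ltr01 mfw fw0) mul1e.
apply: eq_integral => x _; rewrite mul1r -muleA -EFinM; congr (_ * _%:E).
by rewrite /phi mulrCA; congr (_ * _)%R; rewrite -expRD; congr expR; field.
Qed.

Definition sqn n (x : 'rV[R]_n) : R := ((x *m x^T) 0 0)%R.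

Lemma sqnE n (x : 'rV[R]_n) : sqn x = (\sum_j x 0 j ^+ 2)%R.
Proof. by rewrite /sqn mxE; apply: eq_bigr => j _; rewrite mxE expr2. Qed.

(** The Gaussian density at [k *: x], times [k ^+ n], divided by the density at [x]. *)
Definition gscale n (k : R) (x : 'rV[R]_n) : R :=
  (k ^+ n * expR (- ((k ^+ 2 - 1) * sqn x / 2)))%R.

Lemma gauss_scale n (k : R) (f : 'rV[R]_n -> \bar R) : (0 < k)%R ->
  measurable_fun setT f -> (forall x, 0 <= f x) ->
  \int[gauss 1 n]_x f x = \int[gauss 1 n]_x (f (k *: x)%R * (gscale k x)%:E).
Proof.
move=> k0 mf f0.
rewrite (@gauss_rowwise n (fun _ x => k * x)%R
  (fun _ x => k * expR (- ((k ^+ 2 - 1) * x ^+ 2 / 2)))%R)//.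
- apply: eq_integral => x _; congr (f _ * _%:E).
    by apply/rowP => j; rewrite !mxE.
  rewrite big_split/= prodr_const card_ord /gscale; congr (_ * _)%R.
  rewrite -expR_sum; congr expR; rewrite sumrN; congr (- _)%R.
  by rewrite -mulr_suml -mulr_sumr sqnE.
- by move=> _; exact: measurable_funM.
- move=> _; apply: measurable_funM => //; apply: measurableT_comp => //.
  apply: measurableT_comp => //; apply: measurable_funM => //; exact: measurable_funM.
- by move=> _ x; rewrite mulr_ge0 ?expR_ge0// ltW.
- by move=> _ h mh h0; exact: normal1_scale.
Qed.

(** The finite dimensional Cameron-Martin formula. *)
Lemma gauss_shift n (y : 'rV[R]_n) (f : 'rV[R]_n -> \bar R) :
  measurable_fun setT f -> (forall x, 0 <= f x) ->
  \int[gauss 1 n]_x f (x + y)%R =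
  \int[gauss 1 n]_x (f x * (expR ((x *m y^T) 0 0 - sqn y / 2))%R%:E).
Proof.
move=> mf f0.
have mexp (a b : R) : measurable_fun setT (fun x : R => expR (- ((x - a) * b + b ^+ 2 / 2)))%R.
  apply: measurableT_comp => //; apply: measurableT_comp => //.
  by apply: measurable_funD => //; apply: measurable_funM => //; apply: measurable_funB.
rewrite [RHS](@gauss_rowwise n (fun j x => x + y 0 j)%R
  (fun j x => expR (- ((x - 0) * y 0 j + y 0 j ^+ 2 / 2)))%R).
- apply: eq_integral => x _; rewrite -muleA -EFinM.
  have -> : (\row_j (x 0 j + y 0 j) = x + y)%R by apply/rowP => j; rewrite !mxE.
  rewrite -[LHS]mule1; congr (_ * _%:E).
  rewrite -expR_sum -expRD -[LHS]expR0; congr expR.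
  rewrite sqnE mxE (eq_bigr (fun j => x 0 j * y 0 j + y 0 j ^+ 2)%R); last first.
    by move=> j _; rewrite !mxE mulrDl expr2.
  rewrite sumrN !big_split/= -mulr_suml.
  rewrite [X in (- (X + _))%R](eq_bigr (fun j => x 0 j * y 0 j)%R); first by lra.
  by move=> j _; rewrite subr0.
- by move=> j; exact: measurable_funD.
- by move=> j; exact: mexp.
- by move=> j x; rewrite expR_ge0.
- move=> j h mh h0.
  have mhe : measurable_fun setT (fun x : R => h x * (expR (- ((x - y 0 j) * y 0 j + y 0 j ^+ 2 / 2)))%R%:E).
    by apply: emeasurable_funM => //; apply/measurable_EFinP.
  have he0 x : 0 <= h x * (expR (- ((x - y 0 j) * y 0 j + y 0 j ^+ 2 / 2)))%R%:E.
    by rewrite mule_ge0// lee_fin expR_ge0.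
  transitivity (\int[normal1]_x (h (x + y 0 j)%R * (expR (- (((x + y 0 j) - y 0 j) * y 0 j + y 0 j ^+ 2 / 2)))%R%:E)).
    rewrite (normal1_shift (y 0%R j) mhe he0); apply: eq_integral => x _.
    rewrite -muleA -EFinM -expRD -[LHS]mule1; congr (_ * _%:E).
    by rewrite -[LHS]expR0; congr expR; field.
  by apply: eq_integral => x _; rewrite addrK subr0.
- apply: emeasurable_funM => //; apply/measurable_EFinP; apply: measurableT_comp => //.
  by apply: measurable_funB => //; exact: measurable_dot.
- by move=> x; rewrite mule_ge0// lee_fin expR_ge0.
Qed.
End gauss_change_of_variables.

(** * Rotation invariant laws on open cones *)

Section gauss_radial.
Context {R : realType}.
Local Open Scope ereal_scope.

Section measurability.
Context d (T : measurableType d).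

Lemma measurable_invr (f : T -> R) : measurable_fun setT f ->
  measurable_fun setT (fun t => (f t)^-1%R).
Proof.
move=> mf.
(* The total inverse, with value 0 at 0, is expressed by a real power of the nonnegative square,
   which is measurable. *)
have -> : (fun t => (f t)^-1)%R = (fun t => f t * powR (f t ^+ 2) (-1))%R.
  apply/funext => t; rewrite powR_inv1 ?sqr_ge0//.
  have [->|t0] := eqVneq (f t) 0%R; first by rewrite invr0 mul0r.
  by rewrite expr2 invfM mulrA divff// mul1r.
apply: measurable_funM => //.
apply: (measurableT_comp (f := fun x : R => powR x (-1)%R)) => //.
exact: measurable_funX.
Qed.

Lemma measurable_sqn n (f : T -> 'rV[R]_n) : measurable_fun setT f ->
  measurable_fun setT (fun t => sqn (f t)).
Proof.
move=> mf; apply: (measurable_entry_comp (f := fun t => f t *m (f t)^T)).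
by apply: measurable_mulmx => //; apply: measurable_trmx.
Qed.

Lemma measurable_vnorm n (f : T -> 'rV[R]_n) : measurable_fun setT f ->
  measurable_fun setT (fun t => vnorm (f t)).
Proof.
move=> mf.
have -> : (fun t => vnorm (f t)) = (fun t => powR (sqn (f t)) (2^-1))%R.
  by apply/funext => t; rewrite powR12_sqrt// sqr_norm_ge0.
apply: (measurableT_comp (f := fun x : R => powR x (2^-1)%R)) => //.
exact: measurable_sqn.
Qed.

Lemma measurable_gscale n (k : T -> R) (f : T -> 'rV[R]_n) :
  measurable_fun setT k -> measurable_fun setT f ->
  measurable_fun setT (fun t => gscale (k t) (f t)).
Proof.
move=> mk mf; apply: measurable_funM; first exact: measurable_funX.
apply: measurableT_comp => //; apply: measurableT_comp => //.
apply: measurable_funM => //; apply: measurable_funM; last exact: measurable_sqn.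
by apply: measurable_funB => //; exact: measurable_funX.
Qed.

End measurability.

Lemma sqnE_vnorm n (x : 'rV[R]_n) : sqn x = (vnorm x ^+ 2)%R.
Proof. by rewrite vnorm_sqr. Qed.

(** In positive dimension the origin lies in a null hyperplane, so identities involving division by
    a norm need only hold away from it. *)
Lemma gauss_ae0 n (f g : 'rV[R]_n.+1 -> \bar R) :
  measurable_fun setT f -> measurable_fun setT g ->
  (forall x, 0 <= f x) -> (forall x, 0 <= g x) ->
  (forall x, x != 0%R -> f x = g x) ->
  \int[gauss 1 n.+1]_x f x = \int[gauss 1 n.+1]_x g x.
Proof.
move=> mf mg f0 g0 fg; apply: ge0_ae_eq_integral => //.
have u0 : (const_mx 1%R : 'rV[R]_n.+1) != 0%R.
  by apply/eqP => /rowP/(_ 0%R)/eqP; rewrite !mxE oner_eq0.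
exists [set x : 'rV[R]_n.+1 | (x *m (const_mx 1%R : 'rV[R]_n.+1)^T) 0 0 = 0]%R; split.
- exact: measurable_hyperplane.
- exact: gauss_hyperplane.
- move=> x /= nfg; have [->|x0] := eqVneq x 0%R; first by rewrite mul0mx mxE.
  by case: nfg => _; exact: fg.
Qed.

Lemma gscale_ge0 n (k : R) (x : 'rV[R]_n) : (0 <= k)%R -> 0 <= (gscale k x)%:E.
Proof. by move=> k0; rewrite lee_fin mulr_ge0 ?expR_ge0 ?exprn_ge0. Qed.

Lemma integral_gscale n (k : R) : (0 < k)%R -> \int[gauss 1 n]_x (gscale k x)%:E = 1.
Proof.
move=> k0; rewrite -[RHS](gauss_cst 1 n) [RHS](gauss_scale k0)//.
by apply: eq_integral => x _; rewrite mul1e.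
Qed.

(* For independent Gaussian x and y, the substitutions y -> |x| y, x -> x / |y|, y -> |x| y
   carry [1_F(x) Theta(x)] to [1_F(x) Theta(e / |y|) w(y)], where the variables are separated. *)
Lemma gauss_cone_radial n (F : set 'rV[R]_n.+1) (Theta : 'rV[R]_n.+1 -> \bar R) :
  measurable F -> (forall c x, (0 < c)%R -> F x -> F (c *: x)%R) ->
  measurable_fun setT Theta -> (forall x, 0 <= Theta x) ->
  (forall x y, vnorm x = vnorm y -> Theta x = Theta y) ->
  \int[gauss 1 n.+1]_x ((\1_F x)%:E * Theta x) =
  gauss 1 n.+1 F * \int[gauss 1 n.+1]_x Theta x.
Proof.
move=> mF cF mT T0 rT.
pose e : 'rV[R]_n.+1 := delta_mx 0%R 0%R.
have e1 : vnorm e = 1%R.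
  by rewrite /vnorm -[X in Num.sqrt X]/(sqn e) sqnE (bigD1 0%R)//= big1 ?addr0 ?mxE ?expr1n ?sqrtr1// => j j0; rewrite mxE (negbTE j0) andbF expr0n.
(* What remains of the three [gscale] factors once multiplied: all powers of [vnorm x] cancel. *)
pose w (y : 'rV[R]_n.+1) := (expR (sqn y / 2 - (sqn y)^-1 / 2) * (vnorm y)^-1 ^+ n.+1 ^+ 2)%R.
pose K := \int[gauss 1 n.+1]_y (Theta ((vnorm y)^-1 *: e)%R * (w y)%:E).
have w0 y : 0 <= (w y)%:E by rewrite lee_fin mulr_ge0 ?expR_ge0// sqr_ge0.
have mvn d (T : measurableType d) (f : T -> 'rV[R]_n.+1) : measurable_fun setT f ->
    measurable_fun setT (fun t => (vnorm (f t))^-1)%R.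
  by move=> mf; apply: measurable_invr; exact: measurable_vnorm.
have mw : measurable_fun setT (fun y => (w y)%:E).
  apply/measurable_EFinP; apply: measurable_funM.
    apply: measurableT_comp => //; apply: measurable_funB; apply: measurable_funM => //.
      exact: measurable_sqn.
    by apply: measurable_invr; exact: measurable_sqn.
  by apply: measurable_funX; apply: measurable_funX; exact: mvn.
have mTe : measurable_fun setT (fun y : 'rV[R]_n.+1 => Theta ((vnorm y)^-1 *: e)%R).
  by apply: (measurableT_comp mT); apply: measurable_scalemx => //; exact: mvn.
(* The constant [K] is the same for all cones; the whole space, itself a cone, identifies it with
   the integral of [Theta]. *)
suff key (G : set 'rV[R]_n.+1) : measurable G -> (forall c (x : 'rV[R]_n.+1), (0 < c)%R -> G x -> G (c *: x)%R) ->
    \int[gauss 1 n.+1]_x ((\1_G x)%:E * Theta x) = gauss 1 n.+1 G * K.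
  rewrite key//; congr (_ * _).
  have := key setT measurableT (fun _ _ _ _ => I).
  rewrite (@probability_setT _ _ _ (gauss 1 n.+1)) mul1e => <-.
  by apply: eq_integral => x _; rewrite indicE in_setT mul1e.
move=> mG cG.
have mi : measurable_fun setT (fun x => (\1_G x)%:E : \bar R).
  by apply/measurable_EFinP; exact: measurable_indic.
have mGT : measurable_fun setT (fun x => (\1_G x)%:E * Theta x) by exact: emeasurable_funM.
have GT0 x : 0 <= (\1_G x)%:E * Theta x by rewrite mule_ge0// lee_fin.
pose H (z : 'rV[R]_n.+1 * 'rV[R]_n.+1) :=
  (\1_G z.1)%:E * Theta z.1 * (gscale (vnorm z.1) z.2)%:E.
have H0 z : 0 <= H z by rewrite mule_ge0// gscale_ge0// vnorm_ge0.
have mH : measurable_fun setT H.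
  apply: emeasurable_funM; first exact: (measurableT_comp mGT).
  by apply/measurable_EFinP; apply: measurable_gscale => //; apply: measurable_vnorm.
pose H3 (z : 'rV[R]_n.+1 * 'rV[R]_n.+1) :=
  H ((vnorm z.2)^-1 *: z.1, z.2)%R * (gscale (vnorm z.2)^-1 z.1)%:E.
have H30 z : 0 <= H3 z by rewrite mule_ge0// gscale_ge0// invr_ge0 vnorm_ge0.
have mH3 : measurable_fun setT H3.
  apply: emeasurable_funM.
    apply: (measurableT_comp mH); apply: measurable_fun_pair => //.
    by apply: measurable_scalemx => //; exact: mvn.
  by apply/measurable_EFinP; apply: measurable_gscale => //; exact: mvn.
have pos (x : 'rV[R]_n.+1) : x != 0%R -> (0 < vnorm x)%R.
  by move=> x0; rewrite lt_neqAle eq_sym vnorm_eq0 x0 vnorm_ge0.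
have mint (f : 'rV[R]_n.+1 * 'rV[R]_n.+1 -> \bar R) : measurable_fun setT f -> (forall z, 0 <= f z) ->
    measurable_fun setT (fun x => \int[gauss 1 n.+1]_y f (x, y)).
  by move=> mf f0; exact: (@measurable_fun_fubini_tonelli_F _ _ _ _ _ (gauss 1 n.+1) f).
have mint2 (f : 'rV[R]_n.+1 * 'rV[R]_n.+1 -> \bar R) : measurable_fun setT f -> (forall z, 0 <= f z) ->
    measurable_fun setT (fun y => \int[gauss 1 n.+1]_x f (x, y)).
  by move=> mf f0; exact: (@measurable_fun_fubini_tonelli_G _ _ _ _ _ (gauss 1 n.+1) f).
have int0 (f : 'rV[R]_n.+1 -> \bar R) : (forall z, 0 <= f z) -> 0 <= \int[gauss 1 n.+1]_x f x.
  by move=> f0; apply: integral_ge0.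
transitivity (\int[gauss 1 n.+1]_x \int[gauss 1 n.+1]_y H (x, y)).
  apply: gauss_ae0 => //; first exact: mint.
    by move=> x; exact: int0.
  move=> x x0; rewrite /H/= ge0_integralZl//.
  - by rewrite integral_gscale ?mule1//; exact: pos.
  - by apply/measurable_EFinP; apply: measurable_gscale.
  - by move=> y _; rewrite gscale_ge0// vnorm_ge0.
rewrite gauss_exchange//.
transitivity (\int[gauss 1 n.+1]_y \int[gauss 1 n.+1]_x H3 (x, y)).
  apply: gauss_ae0; [exact: mint2|exact: mint2|by move=> y; exact: int0|by move=> y; exact: int0|].
  move=> y y0; have py : (0 < (vnorm y)^-1)%R by rewrite invr_gt0 pos.
  exact: (gauss_scale (f := fun x => H (x, y)) py (measurable_fun_pair1 y mH) (fun x => H0 (x, y))).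
rewrite -gauss_exchange//.
have K0 : 0 <= K by apply: int0 => y; rewrite mule_ge0.
have i0 (x : 'rV[R]_n.+1) : setT x -> 0 <= (\1_G x : R)%:E by rewrite lee_fin.
rewrite (gauss_indic mG) -(ge0_integralZr (gauss 1 n.+1) measurableT mi i0 K0).
apply: gauss_ae0.
- exact: mint.
- by apply: emeasurable_funM.
- by move=> x; exact: int0.
- by move=> x; rewrite mule_ge0// lee_fin.
move=> x x0; have px := pos _ x0.
rewrite (gauss_scale (f := fun y => H3 (x, y)) px)//; last exact: (measurable_fun_pair2 x mH3).
have mTw : measurable_fun setT (fun y => Theta ((vnorm y)^-1 *: e)%R * (w y)%:E).
  exact: emeasurable_funM.
have Tw0 (y : 'rV[R]_n.+1) : setT y -> 0 <= Theta ((vnorm y)^-1 *: e)%R * (w y)%:E.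
  by rewrite mule_ge0.
rewrite /K -(ge0_integralZl (gauss 1 n.+1) measurableT mTw Tw0 (i0 x I)).
apply: gauss_ae0.
- apply: emeasurable_funM.
    apply: (measurableT_comp (measurable_fun_pair2 x mH3)).
    by apply: measurable_scalemx.
  by apply/measurable_EFinP; apply: measurable_gscale.
- by apply: emeasurable_funM => //; exact: emeasurable_funM.
- by move=> y; rewrite mule_ge0// gscale_ge0// ltW.
- by move=> y; rewrite !mule_ge0// lee_fin.
move=> y y0; have py := pos _ y0.
rewrite /H3 /H/=.
have a0 : (0 < (vnorm (vnorm x *: y))^-1)%R.
  by rewrite invr_gt0 vnormZ gtr0_norm ?mulr_gt0.
have -> : Theta ((vnorm (vnorm x *: y))^-1 *: x)%R = Theta ((vnorm y)^-1 *: e)%R.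
  apply: rT; rewrite !vnormZ e1 mulr1 !gtr0_norm ?invr_gt0//; last by rewrite mulr_gt0.
  by rewrite invfM mulrAC mulVf ?mul1r// gt_eqF.
have -> : \1_G ((vnorm (vnorm x *: y))^-1 *: x)%R = \1_G x :> R.
  rewrite !indicE; congr ((nat_of_bool _)%:R); apply/idP/idP; rewrite !in_setE.
    move=> /(cG (vnorm (vnorm x *: y))); rewrite scalerA divff ?scale1r; first by apply; rewrite -invr_gt0.
    by rewrite -invr_eq0 gt_eqF.
  exact: cG.
rewrite -!muleA; congr (_ * (_ * _)); rewrite -!EFinM; congr EFin.
rewrite /gscale /w !sqnE_vnorm !vnormZ !gtr0_norm// ?invr_gt0 ?mulr_gt0//.
set a := vnorm x; set b := vnorm y.
have a0' : a != 0%R by rewrite gt_eqF.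
have b0' : b != 0%R by rewrite gt_eqF.
rewrite !mulrA.
have abE : ((a * b)^-1 * a = b^-1)%R by field; rewrite a0' b0'.
rewrite abE.
transitivity ((b^-1 * (a * b)^-1 * a) ^+ n.+1 *
  (expR (- ((b^-1 ^+ 2 - 1) * (a * b) ^+ 2 / 2)) *
   expR (- (((a * b)^-1 ^+ 2 - 1) * a ^+ 2 / 2)) *
   expR (- ((a ^+ 2 - 1) * b ^+ 2 / 2))))%R.
  rewrite !exprMn.
  have -> (k : R) : (k * a * b * a * b / 2 = k * (a ^+ 2 * b ^+ 2) / 2)%R by ring.
  have e2 (k c : R) : (k * c * c / 2 = k * c ^+ 2 / 2)%R by ring.
  rewrite !e2; ring.
rewrite -(mulrA b^-1%R) abE -expr2.
rewrite [LHS]mulrC -!expRD -[RHS]mulrA -exprMn -expr2; congr (expR _ * _)%R.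
by field; rewrite a0' b0'.
Qed.
End gauss_radial.

Section invariant_cone.
Context {R : realType}.
Local Open Scope ereal_scope.

(* Adding the Gaussian noise [g / k.+1] to the invariant law makes it absolutely continuous
   with radial density with respect to the Gaussian one, so that cones get their Gaussian
   measure; openness of the cone allows to let [k] tend to infinity. *)
Lemma invariant_open_cone n (nu : probability 'rV[R]_n.+1 R) (F : set 'rV[R]_n.+1) :
  (forall O (f : 'rV[R]_n.+1 -> \bar R), gauss_invariant O -> measurable_fun setT f ->
     (forall x, 0 <= f x) -> \int[nu]_x f (x *m O) = \int[nu]_x f x) ->
  measurable F -> (forall c x, (0 < c)%R -> F x -> F (c *: x)%R) ->
  (forall x y, F x -> \forall k \near \oo, F (x + k.+1%:R^-1 *: y)%R) ->
  nu F <= gauss 1 n.+1 F.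
Proof.
move=> inv mF cF oF.
have mi : measurable_fun setT (fun x => (\1_F x : R)%:E).
  by apply/measurable_EFinP; exact: measurable_indic.
have i0 x : 0 <= (\1_F x : R)%:E by rewrite lee_fin.
pose f k (z : 'rV[R]_n.+1 * 'rV[R]_n.+1) := (\1_F (z.1 + k.+1%:R^-1 *: z.2)%R : R)%:E.
have mf k : measurable_fun setT (f k).
  apply: (measurableT_comp mi); apply: measurable_addmx => //.
  exact: measurable_scalemx.
have f0 k z : 0 <= f k z by exact: i0.
have intf k : \int[nu]_x \int[gauss 1 n.+1]_y f k (x, y) = gauss 1 n.+1 F.
  (* The density of [y + k.+1 x] relative to that of [y]. As [F] is a cone, the perturbed point
     [x + y / k.+1] may be multiplied by [k.+1] inside the indicator. *)
  pose h' (x y : 'rV[R]_n.+1) := (expR ((y *m (k.+1%:R *: x)^T) 0 0 - sqn (k.+1%:R *: x) / 2))%R%:E.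
  pose h (z : 'rV[R]_n.+1 * 'rV[R]_n.+1) := h' z.1 z.2.
  have h0 z : 0 <= h z by rewrite lee_fin expR_ge0.
  have mk : measurable_fun setT (fun z : 'rV[R]_n.+1 * 'rV[R]_n.+1 => k.+1%:R *: z.1)%R.
    exact: measurable_scalemx.
  have mh : measurable_fun setT h.
    apply/measurable_EFinP; apply: measurableT_comp => //; apply: measurable_funB.
      apply: (measurable_entry_comp (f := fun z : 'rV[R]_n.+1 * 'rV[R]_n.+1 => z.2 *m (k.+1%:R *: z.1)^T)%R).
      by apply: measurable_mulmx => //; exact: measurable_trmx.
    by apply: measurable_funM => //; exact: measurable_sqn.
  pose Theta y := \int[nu]_x h (x, y).
  have mTheta : measurable_fun setT Theta.
    exact: (@measurable_fun_fubini_tonelli_G _ _ _ _ _ nu h).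
  have Theta0 y : 0 <= Theta y by apply: integral_ge0.
  have inth x : \int[gauss 1 n.+1]_y h (x, y) = 1.
    rewrite -[RHS](gauss_cst 1 n.+1) (gauss_shift (k.+1%:R *: x)%R (f := fun=> 1))//.
    by apply: eq_integral => y _; rewrite mul1e.
  transitivity (\int[nu]_x \int[gauss 1 n.+1]_y ((\1_F y : R)%:E * h (x, y))).
    apply: eq_integral => x _.
    rewrite -(gauss_shift (k.+1%:R *: x)%R mi i0).
    apply: eq_integral => y _; rewrite /f/=; congr EFin.
    have k0 : (0 < k.+1%:R :> R)%R by rewrite ltr0n.
    rewrite !indicE; congr ((nat_of_bool _)%:R); apply/idP/idP; rewrite !in_setE.
      by move=> /(cF _ _ k0); rewrite scalerDr scalerA divff ?scale1r 1?addrC// gt_eqF.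
    have k0' : (0 < k.+1%:R^-1 :> R)%R by rewrite invr_gt0.
    by move=> /(cF _ _ k0'); rewrite scalerDr scalerA mulVf ?scale1r 1?addrC// gt_eqF.
  rewrite (@fubini_tonelli _ _ _ _ _ nu (gauss 1 n.+1) (fun z => (\1_F z.2 : R)%:E * h z))//=; last 2 first.
  - by apply: emeasurable_funM => //; exact: (measurableT_comp mi).
  - by move=> z; rewrite mule_ge0.
  transitivity (\int[gauss 1 n.+1]_y ((\1_F y : R)%:E * Theta y)).
    apply: eq_integral => y _.
    exact: (ge0_integralZl nu measurableT (measurable_fun_pair1 y mh) (fun x _ => h0 (x, y)) (i0 y)).
  have radO y O : gauss_invariant O -> Theta (y *m O) = Theta y.
    move=> Oi; transitivity (\int[nu]_x h (x *m O, y *m O)%R).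
      exact/esym/(inv O (fun x => h (x, y *m O)%R) Oi (measurable_fun_pair1 _ mh)).
    apply: eq_integral => x _.
    suff : h' (x *m O) (y *m O) = h' x y by [].
    rewrite /h' scalemxAl trmx_mul mulmxA -(mulmxA y) (proj1 Oi) mulmx1.
    by rewrite !sqnE_vnorm (vnorm_orth _ (proj1 Oi)).
  have rad y y' : vnorm y = vnorm y' -> Theta y = Theta y'.
    move=> yy'.
    have [Q Qi yQ] := gauss_invariant_align (y : 'rV[R]_(1 + n)).
    have [Q' Qi' yQ'] := gauss_invariant_align (y' : 'rV[R]_(1 + n)).
    by rewrite -(radO y Q Qi) -(radO y' Q' Qi') yQ yQ' yy'.
  rewrite (gauss_cone_radial mF cF mTheta Theta0 rad).
  rewrite /Theta -(@fubini_tonelli _ _ _ _ _ nu (gauss 1 n.+1) h mh h0).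
  under eq_integral do rewrite inth.
  rewrite integral_cst// [X in _ * (1 * X)](_ : _ = 1) ?mule1//.
  exact: (@probability_setT _ _ _ nu).
(* Keeping only the [x] already in [F] gives a lower bound of [f k] that converges pointwise by
   openness; on the boundary of [F] the functions [f k] need not tend to the indicator. *)
pose g k (z : 'rV[R]_n.+1 * 'rV[R]_n.+1) := (\1_F z.1 : R)%:E * f k z.
have mi1 : measurable_fun setT (fun z : 'rV[R]_n.+1 * 'rV[R]_n.+1 => (\1_F z.1 : R)%:E).
  exact: (measurableT_comp mi).
have mg k : measurable_fun setT (g k) by exact: emeasurable_funM.
have g0 k z : 0 <= g k z by rewrite mule_ge0.
have i1 x : (\1_F x : R)%:E <= 1 by rewrite lee_fin indicE lern1 leq_b1.
have gf k z : g k z <= f k z by rewrite -[leRHS]mul1e lee_pmul.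
have cvgg z : setT z -> g k z @[k --> \oo] --> (\1_F z.1 : R)%:E.
  move=> _; case: z => x y /=; have [xF|xF] := boolP (x \in F); last first.
    rewrite /g/= indicE (negbTE xF); under eq_fun do rewrite mul0e.
    exact: cvg_cst.
  apply: cvg_near_cst; move: xF; rewrite in_setE => xF.
  have := oF x y xF; apply: filterS => k Fk.
  by rewrite /g /f/= !indicE !mem_set// mul1e.
have int1 : (nu \x gauss 1 n.+1).-integrable setT (EFin \o cst 1%R).
  apply/integrableP; split; first by apply/measurable_EFinP; exact: measurable_cst.
  rewrite (eq_integral (fun=> 1)) => [|z _]; last by rewrite /= normr1.
  rewrite integral_cst// mul1e.
  have -> : [set: 'rV[R]_n.+1 * 'rV[R]_n.+1] = setT `*` setT by rewrite setXTT.
  rewrite [X in X < _](product_measure1E nu (gauss 1 n.+1) measurableT measurableT).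
  rewrite (@le_lt_trans _ _ (1 * 1)) ?mule1 ?ltry// -[leRHS]mule1.
  by apply: lee_pmul => //; exact: probability_le1.
have gb k z : setT z -> `|g k z| <= (EFin \o cst 1%R) z.
  by move=> _; rewrite gee0_abs// (le_trans (gf k z))// i1.
have fin1 (z : 'rV[R]_n.+1 * 'rV[R]_n.+1) : setT z -> (EFin \o cst (1%R : R)) z \is a fin_num by [].
have H := dominated_cvg measurableT mg cvgg fin1 int1 gb.
have <- : \int[nu \x gauss 1 n.+1]_z (\1_F z.1 : R)%:E = nu F.
  rewrite (@fubini_tonelli1 _ _ _ _ _ nu (gauss 1 n.+1) _ mi1 (fun z => i0 z.1)).
  transitivity (\int[nu]_x (\1_F x : R)%:E); last by rewrite integral_indic// setIT.
  by apply: eq_integral => x _; exact: (gauss_cst 1 n.+1 (\1_F x : R)%:E).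
rewrite -(cvg_lim (@ereal_hausdorff R) H).
apply: lime_le; first by apply/cvg_ex; eexists; exact: H.
apply: nearW => k.
rewrite -(intf k) -(@fubini_tonelli1 _ _ _ _ _ nu (gauss 1 n.+1) _ (mf k) (f0 k)).
by apply: ge0_le_integral => // z _; exact: gf.
Qed.
End invariant_cone.

(** * Polyhedral cones *)

Section moreau.
Context {R : realType}.

Definition dot n (u v : 'rV[R]_n) : R := (u *m v^T) 0 0.

Lemma dotC n (u v : 'rV[R]_n) : dot u v = dot v u.
Proof. by rewrite /dot !mxE; apply: eq_bigr => i _; rewrite !mxE mulrC. Qed.

Lemma dotDl n (u v w : 'rV[R]_n) : dot (u + v) w = dot u w + dot v w.
Proof. by rewrite /dot mulmxDl mxE. Qed.

Lemma dotDr n (u v w : 'rV[R]_n) : dot w (u + v) = dot w u + dot w v.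
Proof. by rewrite !(dotC w) dotDl. Qed.

Lemma dotZl n c (u v : 'rV[R]_n) : dot (c *: u) v = c * dot u v.
Proof. by rewrite /dot -scalemxAl mxE. Qed.

Lemma dotZr n c (u v : 'rV[R]_n) : dot u (c *: v) = c * dot u v.
Proof. by rewrite !(dotC u) dotZl. Qed.

Lemma dotNl n (u v : 'rV[R]_n) : dot (- u) v = - dot u v.
Proof. by rewrite -scaleN1r dotZl mulN1r. Qed.

Lemma dotNr n (u v : 'rV[R]_n) : dot u (- v) = - dot u v.
Proof. by rewrite !(dotC u) dotNl. Qed.

Lemma dotBl n (u v w : 'rV[R]_n) : dot (u - v) w = dot u w - dot v w.
Proof. by rewrite dotDl dotNl. Qed.

Lemma dotBr n (u v w : 'rV[R]_n) : dot w (u - v) = dot w u - dot w v.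
Proof. by rewrite dotDr dotNr. Qed.

Lemma dot0l n (v : 'rV[R]_n) : dot 0 v = 0.
Proof. by rewrite /dot mul0mx mxE. Qed.

Lemma dot0r n (v : 'rV[R]_n) : dot v 0 = 0.
Proof. by rewrite dotC dot0l. Qed.

Lemma dot_ge0 n (v : 'rV[R]_n) : 0 <= dot v v.
Proof. exact: sqr_norm_ge0. Qed.

Lemma dot_eq0 n (v : 'rV[R]_n) : (dot v v == 0) = (v == 0).
Proof. exact: sqr_norm_eq0. Qed.

Lemma dot_mulmx m n (t : 'rV[R]_m) (A : 'M[R]_(m, n)) (f : 'rV[R]_n) :
  A *m f^T = 0 -> dot (t *m A) f = 0.
Proof. by move=> Af; rewrite /dot -mulmxA Af mulmx0 mxE. Qed.

(** The convex cone generated by [s], with one multiplier peeled off at a time so that proofs go by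
    induction on the generators. *)
Fixpoint conic n (s : seq 'rV[R]_n) (w : 'rV[R]_n) : Prop :=
  if s is g :: s' then exists2 b, 0 <= b & conic s' (w - b *: g) else w = 0.

Lemma conic_cat n (s t : seq 'rV[R]_n) w : conic (s ++ t) w ->
  exists u, conic s u /\ conic t (w - u).
Proof.
elim: s w => [|g s IH] w /=; first by exists 0; rewrite subr0.
move=> [b b0 /IH[u [su tu]]]; exists (u + b *: g); split.
  by exists b; rewrite ?addrK.
by rewrite opprD addrCA addrC addrAC -addrA [- u + _]addrC addrA.
Qed.

Lemma conic_dot n (s : seq 'rV[R]_n) w f : conic s w ->
  (forall g, g \in s -> dot f g <= 0) -> dot f w <= 0.
Proof.
elim: s w => [|g s IH] w /=; first by move=> -> _; rewrite dot0r.
move=> [b b0 /IH H] sf.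
have : dot f (w - b *: g) <= 0 by apply: H => g' g's; apply: sf; rewrite in_cons g's orbT.
rewrite dotBr dotZr subr_le0 => /le_trans; apply.
by rewrite mulr_ge0_le0// sf// mem_head.
Qed.

(** Complementary slackness: every term of [dot f w] is nonpositive and the total is 0, so a
    generator not orthogonal to [f] has multiplier 0. *)
Lemma conic_tight n (s : seq 'rV[R]_n) w f : conic s w ->
  (forall g, g \in s -> dot f g <= 0) -> dot f w = 0 ->
  conic [seq g <- s | dot f g == 0] w.
Proof.
elim: s w => [|g s IH] w //= [b b0 sw] sf fw.
have sf' g' : g' \in s -> dot f g' <= 0 by move=> g's; apply: sf; rewrite in_cons g's orbT.
have fg : dot f g <= 0 by apply: sf; exact: mem_head.
have := conic_dot sw sf'; rewrite dotBr dotZr fw sub0r oppr_le0 => bfg.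
have bfg0 : b * dot f g = 0 by apply/eqP; rewrite eq_le bfg mulr_ge0_le0.
have {}IH : conic [seq g' <- s | dot f g' == 0] (w - b *: g).
  by apply: IH => //; rewrite dotBr dotZr fw bfg0 subr0.
case: ifP => [_|/negbT fg0] /=; first by exists b.
by move/eqP: bfg0; rewrite mulf_eq0 (negbTE fg0) orbF => /eqP b00; rewrite b00 scale0r subr0 in IH.
Qed.

Lemma conic_scale n (s : seq 'rV[R]_n) c w : 0 <= c -> conic s w -> conic s (c *: w).
Proof.
move=> c0; elim: s w => [|g s IH] w /=; first by move=> ->; rewrite scaler0.
move=> [b b0 /IH H]; exists (c * b); first by rewrite mulr_ge0.
by rewrite -scalerA -scalerBr.
Qed.

Lemma conic0 n (s : seq 'rV[R]_n) : conic s 0.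
Proof. by elim: s => //= g s IH; exists 0; rewrite // scale0r subr0. Qed.

Lemma conic_span n m (s : seq 'rV[R]_n) (p : 'M[R]_(n, m)) w : conic s w ->
  (forall g, g \in s -> g *m p = 0) -> w *m p = 0.
Proof.
elim: s w => [|g s IH] w /=; first by move=> -> _; rewrite mul0mx.
move=> [b _ /IH H] sp.
have sp' g' : g' \in s -> g' *m p = 0 by move=> g's; apply: sp; rewrite in_cons g's orbT.
by have := H sp'; rewrite mulmxBl -scalemxAl (sp g (mem_head _ _)) scaler0 subr0.
Qed.

Definition perp n (g h : 'rV[R]_n) := h - (dot h g / dot g g) *: g.

Lemma dot_perp n (g h : 'rV[R]_n) : g != 0 -> dot (perp g h) g = 0.
Proof. by rewrite -dot_eq0 => g0; rewrite dotBl dotZl divfK// subrr. Qed.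

(** Leaving the hyperplane of [g] costs a multiple of [g] of uncontrolled sign; [moreauP] recovers
    the sign by another argument. *)
Lemma conic_perp n (s : seq 'rV[R]_n) g w : conic (map (perp g) s) w ->
  exists2 b, conic s (w - b *: g) & True.
Proof.
elim: s w => [|g' s IH] w /=; first by move=> ->; exists 0; rewrite // scale0r subr0.
move=> [b b0 /IH[c sc _]]; exists (c - b * (dot g' g / dot g g)) => //.
exists b => //; congr (conic s _): sc.
by rewrite /perp; set t := _ / _; apply/rowP => i; rewrite !mxE; ring.
Qed.

(* Metric projection onto the cone [dot _ g <= 0, g \in s], adding the constraints one by one:
   if the projection for [s] violates [g], the projection lies in the hyperplane of [g]. *)
Fixpoint moreau n k (s : seq 'rV[R]_n) (h : 'rV[R]_n) : 'rV[R]_n :=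
  match k, s with
  | k'.+1, g :: s' =>
    let f := moreau k' s' h in
    if dot f g <= 0 then f else moreau k' (map (perp g) s') (perp g h)
  | _, _ => h
  end.

(** Moreau decomposition of [h]: the projection [f] and an orthogonal remainder in the polar cone.
    These optimality conditions determine [f]. *)
Definition moreau_spec n (s : seq 'rV[R]_n) (h f : 'rV[R]_n) :=
  [/\ conic s (h - f), (forall g, g \in s -> dot f g <= 0) & dot f (h - f) = 0].

(** Firm nonexpansiveness of the projection: each remainder is in the polar cone and so pairs
    nonpositively with the other projection. *)
Lemma moreau_spec_monotone n (s : seq 'rV[R]_n) h h' f f' :
  moreau_spec s h f -> moreau_spec s h' f' ->
  dot (f - f') (f - f') <= dot (h - h') (f - f').
Proof.
move=> [c1 s1 o1] [c2 s2 o2].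
have d1 := conic_dot c1 s2; have d2 := conic_dot c2 s1.
rewrite -subr_ge0 -dotBl.
have -> : h - h' - (f - f') = (h - f) - (h' - f').
  by apply/rowP => i; rewrite !mxE; ring.
rewrite dotBl !dotBr ![dot (_ - _) _]dotC o1 o2.
by move: d1 d2; lra.
Qed.

Lemma moreau_spec_unique n (s : seq 'rV[R]_n) h f f' :
  moreau_spec s h f -> moreau_spec s h f' -> f = f'.
Proof.
move=> H H'; have := moreau_spec_monotone H H'.
rewrite subrr dot0l => d; apply/eqP; rewrite -subr_eq0 -dot_eq0.
by rewrite eq_le d dot_ge0.
Qed.

(** [k] is fuel, as the second recursive call is on [map (perp g) s]. In that branch the projection
    [f2] found in the hyperplane of [g] satisfies all conditions except possibly the sign of the
    multiplier [c] of [g]. *)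
Lemma moreauP n k (s : seq 'rV[R]_n) (h : 'rV[R]_n) : (size s <= k)%N ->
  moreau_spec s h (moreau k s h).
Proof.
elim: k s h => [|k IH] [|g s] h //=; try by move=> _; split => //=; rewrite subrr ?dot0r.
rewrite ltnS => sk; have [c1 s1 o1] := IH s h sk.
set f := moreau k s h in c1 s1 o1 *.
case: ifPn => [fg|]; first split => //=.
- by exists 0; rewrite // scale0r subr0.
- by move=> g'; rewrite in_cons => /predU1P[->//|]; exact: s1.
rewrite -ltNge => fg.
have g0 : g != 0 by apply: contraTneq fg => ->; rewrite dot0r ltxx.
have smk : (size (map (perp g) s) <= k)%N by rewrite size_map.
have [c2 s2 o2] := IH _ (perp g h) smk.
set f2 := moreau k _ _ in c2 s2 o2 *.
have fg2 : dot f2 g = 0.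
  have : (perp g h - f2) *m g^T = 0.
    apply: conic_span c2 _ => _ /mapP[g' _ ->].
    by apply/matrixP => i j; rewrite !ord1 [RHS]mxE; exact: dot_perp.
  move/matrixP/(_ 0 0); rewrite [RHS]mxE -/(dot _ _) dotBl dot_perp// => /eqP.
  by rewrite sub0r oppr_eq0 => /eqP.
have s2' g' : g' \in s -> dot f2 g' <= 0.
  move=> g's; have := s2 (perp g g') (map_f _ g's).
  by rewrite dotBr dotZr fg2 mulr0 subr0.
have [b cb _] := conic_perp c2.
pose c := b + dot h g / dot g g.
have cE : h - f2 - c *: g = perp g h - f2 - b *: g.
  by rewrite /c /perp; set t := _ / _; apply/rowP => i; rewrite !mxE; ring.
have o2' : dot f2 (h - f2) = 0.
  by move: o2; rewrite /perp !dotBr dotZr fg2 mulr0 subr0.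
suff c0 : 0 <= c.
  split => //=; first by exists c; rewrite // cE.
  by move=> g'; rewrite in_cons => /predU1P[->|]; [rewrite fg2|exact: s2'].
(* If [c < 0], then [f2] is the projection of [h - c g] for the constraints [s] alone, and comparing
   with [f] bounds a squared norm by [c * dot g f], negative since [f] violates [g]. *)
rewrite leNgt; apply/negP => c0.
have H2 : moreau_spec s (h - c *: g) f2.
  split => //; first by rewrite addrAC cE.
  by rewrite addrAC dotBr dotZr fg2 mulr0 subr0.
have := moreau_spec_monotone H2 (And3 c1 s1 o1).
have -> : dot (h - c *: g - h) (f2 - f) = c * dot g f.
  by rewrite addrAC subrr sub0r dotNl dotZl dotBr [dot g f2]dotC fg2 sub0r mulrN opprK.
move=> le1.
have := le_trans (dot_ge0 _) le1.
by rewrite nmulr_rge0// leNgt [dot g f]dotC fg.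
Qed.

Lemma moreauE n (s : seq 'rV[R]_n) h f : moreau_spec s h f -> moreau (size s) s h = f.
Proof. by apply: moreau_spec_unique; exact: moreauP. Qed.

(** A vector lies in the generated cone exactly when its projection on the polar cone vanishes;
    measurability of [conic] follows from that of [moreau]. *)
Lemma conic_moreau n (s : seq 'rV[R]_n) w : conic s w <-> moreau (size s) s w = 0.
Proof.
split=> [sw|w0]; last by have [] := moreauP w (leqnn (size s)); rewrite w0 subr0.
apply: moreauE; split => //; rewrite ?subr0 ?dot0l//.
by move=> g _; rewrite dot0l.
Qed.

End moreau.

(** * Faces and normal cones of a polyhedral cone *)

Section polyhedral_cone.
Context {R : realType}.

Lemma conicD n (s : seq 'rV[R]_n) u v : conic s u -> conic s v -> conic s (u + v).
Proof.
elim: s u v => [|g s IH] u v /=; first by move=> -> ->; rewrite addr0.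
move=> [b b0 su] [c c0 sv]; exists (b + c); first exact: addr_ge0.
by rewrite scalerDl opprD addrACA; exact: IH.
Qed.

Lemma conic_mem n (s : seq 'rV[R]_n) g b : 0 <= b -> g \in s -> conic s (b *: g).
Proof.
move=> b0; elim: s => //= g' s IH; rewrite in_cons => /predU1P[->|/IH sg].
  by exists b; rewrite // subrr; exact: conic0.
by exists 0; rewrite // scale0r subr0.
Qed.

Lemma sub_conic n (s t : seq 'rV[R]_n) w : {subset s <= t} -> conic s w -> conic t w.
Proof.
elim: s w => [|g s IH] w /= st; first by move=> ->; exact: conic0.
move=> [b b0 sw]; rewrite -(subrK (b *: g) w); apply: conicD.
  by apply: IH sw => g' g's; apply: st; rewrite in_cons g's orbT.
by apply: conic_mem => //; apply: st; exact: mem_head.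
Qed.

Lemma conic_rowspace n m (s : seq 'rV[R]_n) (A : 'M[R]_(m, n)) w : conic s w ->
  (forall g, g \in s -> exists l, g = l *m A) -> exists l, w = l *m A.
Proof.
elim: s w => [|g s IH] w /=; first by move=> -> _; exists 0; rewrite mul0mx.
move=> [b _ sw] sA.
have [l1 e1] : exists l, w - b *: g = l *m A.
  by apply: IH => // g' g's; apply: sA; rewrite in_cons g's orbT.
have [l2 e2] := sA g (mem_head _ _).
by exists (l1 + b *: l2); rewrite mulmxDl -e1 -scalemxAl -e2 subrK.
Qed.

Section faces.
Variables (n q : nat) (nrm : 'I_q -> 'rV[R]_n).

Definition in_cone (v : 'rV[R]_n) := forall i, dot v (nrm i) <= 0.

(** Strict inequalities off [J] make the faces disjoint and open in their spans, so that
    perturbations inside the span stay in the face. *)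
Definition face (J : {set 'I_q}) : set 'rV[R]_n :=
  [set v | forall i, if i \in J then dot v (nrm i) = 0 else dot v (nrm i) < 0].

Definition normals (J : {set 'I_q}) := [seq nrm i | i <- enum J].

Definition normal_cone (J : {set 'I_q}) : set 'rV[R]_n := [set w | conic (normals J) w].

Definition cone_proj (h : 'rV[R]_n) :=
  let s := [seq nrm i | i <- enum 'I_q] in moreau (size s) s h.

Lemma face_cone J v : face J v -> in_cone v.
Proof. by move=> Jv i; have := Jv i; case: ifP => _; [move->|move/ltW]. Qed.

Lemma face_active v : in_cone v -> face [set i | dot v (nrm i) == 0]%SET v.
Proof.
move=> Cv i; rewrite inE; case: ifPn => [/eqP//|v0].
by rewrite lt_neqAle v0 Cv.
Qed.

Lemma face_disjoint J J' v : face J v -> face J' v -> J = J'.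
Proof.
move=> Jv J'v; apply/setP => i; move: (Jv i) (J'v i).
case: (i \in J); case: (i \in J') => //; first by move=> ->; rewrite ltxx.
by move=> + v0; rewrite v0 ltxx.
Qed.

Lemma normal_face_dot0 J f w : face J f -> normal_cone J w -> dot f w = 0.
Proof.
move=> Jf; rewrite /normal_cone/= => Jw.
have : w *m f^T = 0.
  apply: conic_span Jw _ => g /mapP[i]; rewrite mem_enum => iJ ->.
  apply/matrixP => i' j'; rewrite !ord1 [RHS]mxE -/(dot _ _) dotC.
  by have := Jf i; rewrite iJ.
by move/matrixP/(_ 0 0); rewrite [RHS]mxE -/(dot _ _) dotC.
Qed.

Lemma normal_cone_polar J v w : in_cone v -> normal_cone J w -> dot v w <= 0.
Proof. by move=> Cv Jw; apply: conic_dot Jw _ => g /mapP[i _ ->]. Qed.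

(** [f + w] is its own Moreau decomposition. The projection thus recovers the face, which makes the
    sums of a face and its normal cone disjoint. *)
Lemma cone_proj_face J f w : face J f -> normal_cone J w -> cone_proj (f + w) = f.
Proof.
move=> Jf Jw; apply: moreauE; split; rewrite ?(addrC f) ?addrK.
- by apply: sub_conic Jw => g /mapP[i _ ->]; apply: map_f; rewrite mem_enum.
- by move=> g /mapP[i _ ->]; exact: (face_cone Jf).
- exact: normal_face_dot0 Jf Jw.
Qed.

(** The intersection with the kernel is again polyhedral: the rows of [A] are added with both signs.
    In the Moreau decomposition of [h] their multipliers form [l], and complementary slackness puts
    the rest in the normal cone of the active set. *)
Lemma kernel_kkt m (A : 'M[R]_(m, n)) (h x : 'rV[R]_n) :
  in_cone x -> A *m x^T = 0 -> 0 < dot h x ->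
  exists J l f w, [/\ h + l *m A = f + w, face J f, normal_cone J w, A *m f^T = 0 & f != 0].
Proof.
move=> Cx Ax hx.
pose s := [seq nrm i | i <- enum 'I_q].
pose t := [seq row i A | i <- enum 'I_m] ++ [seq - row i A | i <- enum 'I_m].
pose f := moreau (size (s ++ t)) (s ++ t) h.
have [cf sf fo] : moreau_spec (s ++ t) h f by exact: moreauP.
have [u [su tu]] := conic_cat cf.
have [l hl] : exists l, h - f - u = l *m A.
  apply: conic_rowspace tu _ => g; rewrite mem_cat => /orP[] /mapP[i _ ->].
    by exists (delta_mx 0 i); rewrite -rowE.
  by exists (- delta_mx 0 i); rewrite mulNmx -rowE.
have Cf : in_cone f.
  by move=> i; apply: sf; rewrite mem_cat map_f// mem_enum.
have Af : A *m f^T = 0.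
  apply/matrixP => i j; rewrite ord1 [RHS]mxE.
  have -> : (A *m f^T) i 0 = dot f (row i A).
    by rewrite dotC /dot -row_mul [RHS]mxE.
  apply/eqP; rewrite eq_le sf/=; last by rewrite !mem_cat (map_f (fun i => row i A)) ?orbT// mem_enum.
  rewrite -oppr_le0 -dotNr sf// !mem_cat (map_f (fun i => - row i A)) ?orbT//.
  by rewrite mem_enum.
have fu : dot f u = 0.
  by move: fo; rewrite -(subrK u (h - f)) hl dotDr dotC dot_mulmx// add0r.
pose J := [set i | dot f (nrm i) == 0]%SET.
have Ju : normal_cone J u.
  rewrite /normal_cone/= /normals.
  have -> : [seq nrm i | i <- enum J] = [seq g <- s | dot f g == 0].
    rewrite filter_map; congr map; rewrite [in RHS]enumT.
    by apply: eq_filter => i; rewrite /= inE.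
  by apply: conic_tight => // g gs; apply: sf; rewrite mem_cat gs.
exists J, (- l), f, u; split=> //.
- by rewrite mulNmx -hl; apply/rowP => i; rewrite !mxE; ring.
- exact: face_active.
(* With [f = 0] the vector [h] would be [u] plus a combination of rows of [A]; the rows vanish on
   [x] and [u] pairs nonpositively with it, contradicting [0 < dot h x]. *)
apply/eqP => f0; move: hx.
rewrite -(subr0 h) -f0 -(subrK u (h - f)) hl dotDl dot_mulmx// add0r ltNge dotC.
by rewrite (normal_cone_polar Cx Ju).
Qed.

End faces.

Section measurable_moreau.

Lemma measurable_fun_dot d (T : measurableType d) n (f : T -> 'rV[R]_n) (g : 'rV[R]_n) :
  measurable_fun setT f -> measurable_fun setT (fun t => dot (f t) g).
Proof. exact: (measurableT_comp (measurable_dot g)). Qed.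

Lemma measurable_moreau n k (s : seq 'rV[R]_n) : measurable_fun setT (moreau k s).
Proof.
elim: k s => [|k IH] [|g s] /=; try exact: measurable_id.
apply: measurable_fun_ifT.
- apply: measurable_fun_ler => //; exact: measurable_fun_dot.
- exact: IH.
- apply: (measurableT_comp (IH _)); apply: measurable_addmx => //.
  rewrite (_ : (fun _ => _) = (fun h => (- (dot h g / dot g g)) *: g)).
    apply: measurable_scalemx => //; apply: measurableT_comp => //.
    by apply: measurable_funM => //; exact: measurable_fun_dot.
  by apply/funext => h; rewrite scaleNr.
Qed.

Lemma measurable_vanish d (T : measurableType d) p q (f : T -> 'M[R]_(p, q)) :
  measurable_fun setT f -> measurable [set t | f t = 0].
Proof.
move=> mf; rewrite -[X in measurable X]setTI.
have m0 : measurable [set 0 : 'M[R]_(p, q)].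
  rewrite (_ : [set _] = mx_rect (fun _ _ => [set 0])); first exact: measurable_mx_rect.
  apply/seteqP; split => [X /= -> i j|X /= X0]; first by rewrite mxE.
  by apply/matrixP => i j; rewrite X0 mxE.
exact: (mf measurableT _ m0).
Qed.

Lemma measurable_conic n (s : seq 'rV[R]_n) : measurable [set w | conic s w].
Proof.
rewrite (_ : [set _ | _] = [set w | moreau (size s) s w = 0]).
  exact: measurable_vanish (measurable_moreau _ _).
by apply/seteqP; split => w /=; rewrite conic_moreau.
Qed.

Lemma measurable_face n q (nrm : 'I_q -> 'rV[R]_n) J : measurable (face nrm J).
Proof.
rewrite (_ : face nrm J = \bigcap_(i in [set: 'I_q])
   [set v | if i \in J then dot v (nrm i) = 0 else dot v (nrm i) < 0]).
  apply: fin_bigcap_measurable => [|i _]; first exact: finite_finset.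
  have md : measurable_fun setT (fun v => dot v (nrm i)) by exact: measurable_dot.
  have mneg : measurable [set x : R | x < 0].
    by have -> : [set x : R | x < 0] = `]-oo, 0[%classic by rewrite set_itvE.
  have m0 : measurable [set v | dot v (nrm i) = 0].
    rewrite -[X in measurable X]setTI; exact: (md measurableT _ (measurable_set1 0)).
  have m1 : measurable [set v | dot v (nrm i) < 0].
    rewrite -[X in measurable X]setTI; exact: (md measurableT _ mneg).
  by case: (i \in J).
by apply/seteqP; split => v /= Jv i; [move=> _|]; apply: Jv.
Qed.

End measurable_moreau.

(** The span of [s] is rotated onto the first [r] axes, its orthogonal complement onto the others.
    By induction on the dimension: a nonzero generator goes to the first axis, then the remaining
    coordinates of all generators are treated. *)
Lemma span_align l (s : seq 'rV[R]_l) : exists r (O : 'M[R]_l),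
  [/\ gauss_invariant O, (r <= l)%N,
    forall v, (forall g, g \in s -> dot v g = 0) <->
              (forall j : 'I_l, (j < r)%N -> (v *m O) 0 j = 0) &
    forall g (j : 'I_l), g \in s -> (r <= j)%N -> (g *m O) 0 j = 0].
Proof.
elim: l s => [|l IH] s.
  exists 0%N, 1%:M; split => //; first exact: gauss_invariant1.
  - by move=> v; split => // _ g _; rewrite /dot mxE big_ord0.
  - by move=> g [].
have [s0|/allPn[g gs g0]] := boolP (all (fun g => g == 0) s).
  exists 0%N, 1%:M; split => //; first exact: gauss_invariant1.
  - by move=> v; split => // _ g /(allP s0)/eqP ->; rewrite dot0r.
  - by move=> g j /(allP s0)/eqP ->; rewrite mul0mx mxE.
rewrite -[l.+1]/(1 + l)%N in s g gs g0 *.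
have [Q Qi gQ] := gauss_invariant_align g.
have [r [P [Pi rl P1 P2]]] := IH [seq rsubmx (g' *m Q) | g' <- s].
pose D : 'M[R]_(1 + l) := block_mx 1%:M 0 0 P.
have Di : gauss_invariant D by apply: gauss_invariant_block => //; exact: gauss_invariant1.
have vD (v : 'rV[R]_(1 + l)) : v *m (Q *m D) = row_mx (lsubmx (v *m Q)) (rsubmx (v *m Q) *m P).
  by rewrite mulmxA -{1}(hsubmxK (v *m Q)) mul_row_block !mulmx0 mulmx1 addr0 add0r.
have dotQ (v w : 'rV[R]_(1 + l)) : dot v w = dot (v *m Q) (w *m Q).
  by rewrite /dot trmx_mul mulmxA -(mulmxA v) (proj1 Qi) mulmx1.
have dotQ2 (v w : 'rV[R]_(1 + l)) : dot v w =
    lsubmx (v *m Q) 0 0 * lsubmx (w *m Q) 0 0 + dot (rsubmx (v *m Q)) (rsubmx (w *m Q)).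
  rewrite dotQ -{1}(hsubmxK (v *m Q)) -{1}(hsubmxK (w *m Q)) /dot tr_row_mx mul_row_col mxE.
  by congr (_ + _); rewrite mxE big_ord1 !mxE.
exists (1 + r)%N, (Q *m D); split=> //.
- exact: gauss_invariantM.
- move=> v; split=> [vs j|vs g' g's].
    have v0 : lsubmx (v *m Q) 0 0 = 0.
      have gl : lsubmx (g *m Q) 0 0 = vnorm g by rewrite gQ row_mxKl mxE.
      have gr : rsubmx (g *m Q) = 0 by rewrite gQ row_mxKr.
      have /eqP := vs g gs; rewrite dotQ2 gl gr dot0r addr0 mulf_eq0.
      by rewrite vnorm_eq0 (negbTE g0) orbF => /eqP.
    rewrite vD; case: (split_ordP j) => k -> jr.
      by rewrite row_mxEl !ord1.
    rewrite row_mxEr; move: k jr; apply/P1 => g'0 /mapP[g' g's ->].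
    by have := vs g' g's; rewrite dotQ2 v0 mul0r add0r.
  have v0 : lsubmx (v *m Q) 0 0 = 0.
    by have := vs (lshift l 0) isT; rewrite vD row_mxEl.
  rewrite dotQ2 v0 mul0r add0r.
  have /P1 : forall j : 'I_l, (j < r)%N -> (rsubmx (v *m Q) *m P) 0 j = 0.
    by move=> j jr; have := vs (rshift 1 j) jr; rewrite vD row_mxEr.
  by apply; apply/mapP; exists g'.
- move=> g' j g's; rewrite vD; case: (split_ordP j) => k -> rk.
  by move: rk; rewrite /= ord1.
  by rewrite row_mxEr P2//; apply/mapP; exists g'.
Qed.

End polyhedral_cone.

(** * Kernels of Gaussian matrices meeting a cone *)

Section kernel_projection.
Context {R : realType}.

Lemma measurable_usubmx d (T : measurableType d) p1 p2 q (f : T -> 'M[R]_(p1 + p2, q)) :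
  measurable_fun setT f -> measurable_fun setT (fun t => usubmx (f t)).
Proof.
by move=> mf; apply: measurable_mxP => i j; under eq_fun do rewrite mxE; exact: measurable_entry_comp.
Qed.

Lemma measurable_dsubmx d (T : measurableType d) p1 p2 q (f : T -> 'M[R]_(p1 + p2, q)) :
  measurable_fun setT f -> measurable_fun setT (fun t => dsubmx (f t)).
Proof.
by move=> mf; apply: measurable_mxP => i j; under eq_fun do rewrite mxE; exact: measurable_entry_comp.
Qed.

Variables (m l : nat).
Implicit Types X : 'M[R]_(1 + m, l).

Definition gram X := dsubmx X *m (dsubmx X)^T.

(** Solution of the normal equations for the multiplier of the projection. Writing the inverse Gram
    matrix as adjugate over determinant makes it measurable everywhere, with value 0 in the singular
    case. *)
Definition klam X : 'rV[R]_m :=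
  - (usubmx X *m (dsubmx X)^T) *m ((\det (gram X))^-1 *: \adj (gram X)).

(* The orthogonal projection of the first row of [X] onto the kernel of the other rows,
   when these are linearly independent. *)
Definition kproj X : 'rV[R]_l := usubmx X + klam X *m dsubmx X.

Lemma klam_mulmx X (O : 'M[R]_l) : O *m O^T = 1%:M -> klam (X *m O) = klam X.
Proof.
move=> OO; rewrite /klam /gram -!mul_usub_mx -!mul_dsub_mx trmx_mul.
by rewrite !mulmxA -(mulmxA (usubmx X)) -(mulmxA (dsubmx X)) OO !mulmx1.
Qed.

Lemma kproj_mulmx X (O : 'M[R]_l) : O *m O^T = 1%:M -> kproj (X *m O) = kproj X *m O.
Proof.
by move=> OO; rewrite /kproj klam_mulmx// -mul_usub_mx -mul_dsub_mx mulmxDl mulmxA.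
Qed.

Lemma kproj_unique X (t : 'rV[R]_m) : \det (gram X) != 0 ->
  dsubmx X *m (usubmx X + t *m dsubmx X)^T = 0 -> t = klam X.
Proof.
move=> G0 /(congr1 trmx); rewrite trmx_mul trmxK trmx0 mulmxDl -mulmxA -/(gram X) => /eqP.
rewrite addr_eq0 => /eqP hA.
rewrite /klam hA opprK -scalemxAr -mulmxA mul_mx_adj mul_mx_scalar scalerA mulVf//.
by rewrite scale1r.
Qed.

Lemma measurable_gram : measurable_fun setT gram.
Proof.
by apply: measurable_mulmx; [|apply: measurable_trmx]; apply: measurable_dsubmx.
Qed.

Lemma measurable_klam : measurable_fun setT klam.
Proof.
apply: measurable_mulmx.
  rewrite (_ : (fun _ => _) = (fun X => (-1) *: (usubmx X *m (dsubmx X)^T))); last first.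
    by apply/funext => X; rewrite scaleN1r.
  apply: measurable_scalemx => //; apply: measurable_mulmx; first exact: measurable_usubmx.
  by apply: measurable_trmx; apply: measurable_dsubmx.
apply: measurable_scalemx; last exact: (measurable_adjugate measurable_gram).
by apply: measurable_invr; exact: (measurable_det measurable_gram).
Qed.

Lemma measurable_kproj : measurable_fun setT kproj.
Proof.
apply: measurable_addmx; first exact: measurable_usubmx.
by apply: measurable_mulmx; [exact: measurable_klam|exact: measurable_dsubmx].
Qed.

End kernel_projection.

Section kernel_projection_law.
Context {R : realType}.

(** [kproj] commutes with rotations of the columns, which preserve the Gaussian law; the law of the
    projection is therefore invariant and [invariant_open_cone] applies. *)
Lemma gauss_kproj m l (F : set 'rV[R]_l) : (0 < l)%N -> measurable F ->
  (forall c x, 0 < c -> F x -> F (c *: x)) ->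
  (forall x y, F x -> \forall k \near \oo, F (x + k.+1%:R^-1 *: y)) ->
  (gauss (1 + m) l [set X | F (kproj X)] <= gauss 1 l F)%E.
Proof.
case: l F => // l F _ mF cF oF.
pose K : {mfun 'M[R]_(1 + m, l.+1) >-> 'rV[R]_l.+1} :=
  HB.pack (@kproj R m l.+1) (isMeasurableFun.Build _ _ _ _ _ (@measurable_kproj R m l.+1)).
apply: (@invariant_open_cone R l (distribution (gauss (1 + m) l.+1) K) F) => // O f Oi mf f0.
have mfO : measurable_fun setT (fun x => f (x *m O)) by exact: measurable_mulmx_comp.
rewrite (ge0_integral_distribution K mfO (fun x => f0 _)) (ge0_integral_distribution K mf f0).
have mfK : measurable_fun setT (fun X : 'M[R]_(1 + m, l.+1) => f (kproj X)).
  exact: (measurableT_comp mf (@measurable_kproj R m l.+1)).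
rewrite -[RHS](gauss_mulmxr Oi mfK (fun X => f0 _)).
by apply: eq_integral => X _; rewrite kproj_mulmx//; exact: (proj1 Oi).
Qed.

Lemma gauss_gram_eq0 m l : (m <= l)%N ->
  gauss (1 + m) l [set X : 'M[R]_(1 + m, l) | \det (gram X) = 0] = 0%E.
Proof.
move=> ml.
have mS : measurable [set X : 'M[R]_(1 + m, l) | \det (gram X) = 0].
  rewrite -[X in measurable X]setTI.
  exact: (measurable_det (@measurable_gram R m l) measurableT (measurable_set1 0)).
rewrite gauss_indic// gauss_col_mx//; last by apply/measurable_EFinP; exact: measurable_indic.
transitivity (\int[gauss 1 l]_(x in [set: 'rV[R]_l]) (0 : \bar R))%E; last by rewrite gauss_cst.
apply: eq_integral => h _.
rewrite -(gauss_full_rank ml) gauss_indic; last exact: measurable_singular.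
apply: eq_integral => A _; rewrite !indicE; congr ((nat_of_bool _)%:R)%:E.
by apply/idP/idP; rewrite !in_setE/= /gram col_mxKd.
Qed.

Lemma gauss_gramT_eq0 m l : (l <= m)%N ->
  gauss (1 + m) l [set X : 'M[R]_(1 + m, l) | \det ((dsubmx X)^T *m dsubmx X) = 0] = 0%E.
Proof.
move=> ml.
have mG : measurable_fun setT (fun X : 'M[R]_(1 + m, l) => \det ((dsubmx X)^T *m dsubmx X)).
  apply: measurable_det; apply: measurable_mulmx; last exact: measurable_dsubmx.
  by apply: measurable_trmx; apply: measurable_dsubmx.
have mS : measurable [set X : 'M[R]_(1 + m, l) | \det ((dsubmx X)^T *m dsubmx X) = 0].
  by rewrite -[X in measurable X]setTI; exact: (mG measurableT _ (measurable_set1 0)).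
rewrite gauss_indic// gauss_col_mx//; last by apply/measurable_EFinP; exact: measurable_indic.
transitivity (\int[gauss 1 l]_(x in [set: 'rV[R]_l]) (0 : \bar R))%E; last by rewrite gauss_cst.
apply: eq_integral => h _.
rewrite -(gauss_full_rank ml) gauss_indic; last exact: measurable_singular.
rewrite [RHS]gauss_trmx//; last first.
  by apply/measurable_EFinP; apply: measurable_indic; exact: measurable_singular.
apply: eq_integral => A _; rewrite !indicE; congr ((nat_of_bool _)%:R)%:E.
by apply/idP/idP; rewrite !in_setE/= col_mxKd trmxK.
Qed.

End kernel_projection_law.

(** * Contribution of a single face *)

Section face_bound.
Context {R : realType}.
Local Open Scope ereal_scope.

Lemma measurable_lsubmx d (T : measurableType d) p q1 q2 (f : T -> 'M[R]_(p, q1 + q2)) :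
  measurable_fun setT f -> measurable_fun setT (fun t => lsubmx (f t)).
Proof.
by move=> mf; apply: measurable_mxP => i j; under eq_fun do rewrite mxE; exact: measurable_entry_comp.
Qed.

Lemma measurable_rsubmx d (T : measurableType d) p q1 q2 (f : T -> 'M[R]_(p, q1 + q2)) :
  measurable_fun setT f -> measurable_fun setT (fun t => rsubmx (f t)).
Proof.
by move=> mf; apply: measurable_mxP => i j; under eq_fun do rewrite mxE; exact: measurable_entry_comp.
Qed.

Lemma near_lt0 (a b : R) : (a < 0)%R -> \forall k \near \oo, (a + k.+1%:R^-1 * b < 0)%R.
Proof.
move=> a0; have e0 : (0 < - a / (`|b| + 1))%R.
  by rewrite divr_gt0 ?oppr_gt0// ltr_wpDl.
have := near_infty_natSinv_lt (PosNum e0); apply: filterS => k /= kb.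
have b1 : (0 < `|b| + 1)%R by rewrite ltr_wpDl.
have k0 : (0 < k.+1%:R^-1 :> R)%R by rewrite invr_gt0 ltr0n.
move: kb; rewrite ltr_pdivlMr// => kb.
rewrite addrC -ltrBrDr sub0r (le_lt_trans _ kb)// ler_pM2l//.
by rewrite (le_trans (ler_norm b))// lerDl.
Qed.

(** The indicator of a cone is unchanged by scaling, so only the density factor remains. *)
Lemma gauss_cone_scale n (F : set 'rV[R]_n) (k : R) : (0 < k)%R -> measurable F ->
  (forall c x, (0 < c)%R -> F x -> F (c *: x)%R) ->
  gauss 1 n F = (k ^+ n)%:E *
    \int[gauss 1 n]_x ((\1_F x : R)%:E * (expR ((1 - k ^+ 2) / 2 * sqn x))%:E).
Proof.
move=> k0 mF cF.
have mi : measurable_fun setT (fun x => (\1_F x : R)%:E).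
  by apply/measurable_EFinP; exact: measurable_indic.
rewrite gauss_indic// (gauss_scale k0 mi) => [|x]; last by rewrite lee_fin.
have me : measurable_fun setT (fun x : 'rV[R]_n => (expR ((1 - k ^+ 2) / 2 * sqn x))%:E).
  apply/measurable_EFinP; apply: measurableT_comp => //; apply: measurable_funM => //.
  exact: measurable_sqn.
have mie := emeasurable_funM mi me.
have ie0 (x : 'rV[R]_n) : setT x -> 0 <= (\1_F x : R)%:E * (expR ((1 - k ^+ 2) / 2 * sqn x))%:E.
  by move=> _; rewrite mule_ge0 ?lee_fin ?expR_ge0.
have kn0 : 0 <= (k ^+ n)%:E by rewrite lee_fin exprn_ge0// ltW.
rewrite -(ge0_integralZl (gauss 1 n) measurableT mie ie0 kn0).
apply: eq_integral => x _; rewrite muleCA; congr (_ * _).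
  congr EFin; rewrite !indicE; congr ((nat_of_bool _)%:R); apply/idP/idP; rewrite !in_setE.
    have ki0 : (0 < k^-1)%R by rewrite invr_gt0.
    by move=> /(cF _ _ ki0); rewrite scalerA mulVf ?scale1r// gt_eqF.
  exact: cF.
rewrite -EFinM; congr EFin; rewrite /gscale; congr (_ * expR _)%R; lra.
Qed.

(* Rotating the span of the normals in [J] onto the first [r] axes, [f] only involves the last
   [l] coordinates and [w] only the first [r]: the event says that a Gaussian vector lies in
   the normal cone and that an independent vector projected on a random kernel lies in a face,
   the latter having a rotation invariant law. The Gaussian change of scale by [k] in the
   [l > m] last coordinates produces the exponential weight and the factor [k ^+ m]. *)
Lemma face_bound n q m (nrm : 'I_q -> 'rV[R]_n) (J : {set 'I_q}) (k : R)
    (psi : 'rV[R]_n -> R) : (0 < k)%R -> (k < 1)%R -> measurable_fun setT psi ->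
  (forall f w, face nrm J f -> normal_cone nrm J w -> sqn f <= psi (f + w))%R ->
  exists U : set 'M[R]_(1 + m, n),
  [/\ measurable U,
    (forall X l f w, (usubmx X + l *m dsubmx X = f + w)%R -> face nrm J f ->
        normal_cone nrm J w -> (dsubmx X *m f^T = 0)%R -> f != 0%R -> U X),
    ((n <= m)%N -> gauss (1 + m) n U = 0) &
    gauss (1 + m) n U <= (k ^+ m)%:E *
      \int[gauss 1 n]_h ((\1_(face nrm J) (cone_proj nrm h) : R)%:E *
         (expR ((1 - k ^+ 2) / 2 * psi h))%:E)].
Proof.
move=> k0 k1 mpsi psif.
have [r [Q [Qi rn P1 P2]]] := span_align (normals nrm J).
have [l nE] : exists l, n = (r + l)%N by exists (n - r)%N; rewrite subnKC.
subst n.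
have QQ : Q *m Q^T = 1%:M := proj1 Qi.
have QQ' : Q^T *m Q = 1%:M by apply: mulmx1C.
have mi1 : measurable_fun setT (fun h => (\1_(face nrm J) (cone_proj nrm h) : R)%:E).
  have mif : measurable_fun setT (fun v => (\1_(face nrm J) v : R)%:E).
    by apply/measurable_EFinP; apply: measurable_indic; exact: measurable_face.
  exact: (measurableT_comp mif (measurable_moreau _ _)).
have mie : measurable_fun setT (fun h => (\1_(face nrm J) (cone_proj nrm h) : R)%:E *
         (expR ((1 - k ^+ 2) / 2 * psi h))%:E).
  apply: emeasurable_funM => //; apply/measurable_EFinP; apply: measurableT_comp => //.
  exact: measurable_funM.
have ie0 (h : 'rV[R]_(r + l)) : 0 <= (\1_(face nrm J) (cone_proj nrm h) : R)%:E *
         (expR ((1 - k ^+ 2) / 2 * psi h))%:E.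
  by rewrite mule_ge0 ?lee_fin ?expR_ge0.
have faceO f : face nrm J f -> f *m Q = row_mx 0 (rsubmx (f *m Q)).
  move=> Jf; rewrite -{1}(hsubmxK (f *m Q)); congr row_mx.
  apply/rowP => j; rewrite [RHS]mxE mxE; apply: (iffLR (P1 f)) => //=.
  by move=> g /mapP[i]; rewrite mem_enum => iJ ->; have := Jf i; rewrite iJ.
have ncO w : normal_cone nrm J w -> w *m Q = row_mx (lsubmx (w *m Q)) 0.
  move=> Jw; rewrite -{1}(hsubmxK (w *m Q)); congr row_mx; rewrite -mulmx_rsub.
  apply: conic_span Jw _ => g gJ; apply/rowP => j; rewrite mulmx_rsub [RHS]mxE mxE.
  by apply: P2 => //=; exact: leq_addr.
have rhs0 : 0 <= (k ^+ m)%:E *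
      \int[gauss 1 (r + l)]_h ((\1_(face nrm J) (cone_proj nrm h) : R)%:E *
         (expR ((1 - k ^+ 2) / 2 * psi h))%:E).
  by apply: mule_ge0; [rewrite lee_fin exprn_ge0// ltW|apply: integral_ge0].
have mY p : measurable_fun setT (fun X : 'M[R]_(p, r + l) => X *m Q) by apply: measurable_mulmx.
have dr p (Y : 'M[R]_(1 + m, p + l)) : dsubmx (rsubmx Y) = rsubmx (dsubmx Y).
  by apply/matrixP => i j; rewrite !mxE.
have kerQ (A : 'M[R]_(m, r + l)) (f : 'rV[R]_(r + l)) y : f *m Q = row_mx 0 y ->
    A *m f^T = rsubmx (A *m Q) *m y^T.
  move=> fQ; rewrite -{1}(mulmx1 A) -QQ mulmxA -mulmxA -trmx_mul fQ tr_row_mx.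
  by rewrite -{1}(hsubmxK (A *m Q)) mul_row_col trmx0 mulmx0 add0r.
(* The face lies in a space of dimension [l]. For [l <= m] the kernel almost surely meets this space
   only in 0, and [U] is the null event where it does not. *)
have [lm|ml] := leqP l m.
  pose S := [set X : 'M[R]_(1 + m, l) | \det ((dsubmx X)^T *m dsubmx X) = 0%R].
  have mS : measurable S.
    rewrite -[X in measurable X]setTI.
    have mG : measurable_fun setT (fun X : 'M[R]_(1 + m, l) => \det ((dsubmx X)^T *m dsubmx X)).
      apply: measurable_det; apply: measurable_mulmx; last exact: measurable_dsubmx.
      by apply: measurable_trmx; apply: measurable_dsubmx.
    exact: (mG measurableT _ (measurable_set1 0%R)).
  pose U := [set X : 'M[R]_(1 + m, r + l) | S (rsubmx (X *m Q))].
  have mU : measurable U.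
    rewrite -[X in measurable X]setTI.
    exact: (measurable_rsubmx (mY _) measurableT mS).
  have U0 : gauss (1 + m) (r + l) U = 0.
    have miS p : measurable_fun setT (fun X : 'M[R]_(1 + m, p + l) => (\1_S (rsubmx X) : R)%:E).
      have miS' : measurable_fun setT (fun v => (\1_S v : R)%:E).
        by apply/measurable_EFinP; exact: measurable_indic.
      by apply: (measurableT_comp miS'); exact: measurable_rsubmx.
    rewrite gauss_indic//.
    transitivity (\int[gauss (1 + m) (r + l)]_X (\1_S (rsubmx (X *m Q)) : R)%:E); first by [].
    rewrite (gauss_mulmxr Qi (miS r)) => [|X]; last by rewrite lee_fin.
    rewrite gauss_row_mx => [|//|X]; last by rewrite lee_fin.
    transitivity (\int[gauss (1 + m) r]_(x in [set: 'M[R]_(1 + m, r)]) (0 : \bar R)); last by rewrite gauss_cst.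
    apply: eq_integral => X2 _; rewrite -(gauss_gramT_eq0 lm) gauss_indic//.
    by apply: eq_integral => X1 _; rewrite row_mxKr.
  exists U; split => //; last by rewrite U0.
  move=> X t f w _ Jf _ Af f0; rewrite /U/= /S/=.
  have yE := faceO _ Jf; set y := rsubmx (f *m Q) in yE.
  have y0 : y != 0%R.
    apply: contraNneq f0 => y0.
    by rewrite -(mulmx1 f) -QQ mulmxA yE y0 row_mx0 mul0mx.
  apply/eqP/det0P; exists y => //; rewrite mulmxA.
  suff -> : y *m (dsubmx (rsubmx (X *m Q)))^T = 0%R by rewrite mul0mx.
  apply: trmx_inj; rewrite trmx_mul trmxK trmx0 dr -mul_dsub_mx.
  by rewrite -(kerQ _ _ _ yE).
have rm : (m < r + l)%N by rewrite (leq_trans ml) ?leq_addl.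
pose F' := [set y : 'rV[R]_l | face nrm J (row_mx 0 y *m Q^T)].
pose N' := [set x : 'rV[R]_r | normal_cone nrm J (row_mx x 0 *m Q^T)].
have mF : measurable F'.
  rewrite -[X in measurable X]setTI.
  have mg : measurable_fun setT (fun y : 'rV[R]_l => row_mx (0 : 'rV[R]_r) y *m Q^T).
    by apply: measurable_mulmx => //; exact: measurable_row_mx_comp.
  exact: (mg measurableT _ (measurable_face nrm J)).
have mN : measurable N'.
  rewrite -[X in measurable X]setTI.
  have mg : measurable_fun setT (fun y : 'rV[R]_r => row_mx y (0 : 'rV[R]_l) *m Q^T).
    by apply: measurable_mulmx => //; exact: measurable_row_mx_comp.
  exact: (mg measurableT _ (measurable_conic (normals nrm J))).
have cF c y : (0 < c)%R -> F' y -> F' (c *: y)%R.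
  move=> c0 Fy i; have := Fy i.
  have -> : row_mx (0 : 'rV[R]_r) (c *: y)%R = (c *: row_mx 0 y)%R by rewrite scale_row_mx scaler0.
  rewrite -scalemxAl dotZl; case: ifP => _; first by move=> ->; rewrite mulr0.
  by rewrite pmulr_rlt0.
have cN c y : (0 < c)%R -> N' y -> N' (c *: y)%R.
  move=> c0; rewrite /N'/= /normal_cone/= => Ny.
  have -> : row_mx (c *: y)%R (0 : 'rV[R]_l) = (c *: row_mx y 0)%R by rewrite scale_row_mx scaler0.
  by rewrite -scalemxAl; apply: conic_scale => //; exact: ltW.
have oF x y : F' x -> \forall k \near \oo, F' (x + k.+1%:R^-1 *: y)%R.
  move=> Fx; apply: filter_forall => i.
  have e (c : R) : (dot (row_mx (0 : 'rV[R]_r) (x + c *: y) *m Q^T) (nrm i) =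
      dot (row_mx (0 : 'rV[R]_r) x *m Q^T) (nrm i) + c * dot (row_mx (0 : 'rV[R]_r) y *m Q^T) (nrm i))%R.
    rewrite -dotZl -dotDl scalemxAl -mulmxDl scale_row_mx add_row_mx.
    by rewrite scaler0 addr0.
  have := Fx i; case: ifP => iJ xi; last first.
    by under eq_near do rewrite e; exact: near_lt0.
  apply: nearW => j; rewrite e xi add0r.
  have -> : dot (row_mx (0 : 'rV[R]_r) y *m Q^T) (nrm i) = 0%R; last by rewrite mulr0.
  apply: (iffRL (P1 _)); last by apply: map_f; rewrite mem_enum.
  move=> i' i'r; rewrite -mulmxA QQ' mulmx1.
  have -> : i' = lshift l (Ordinal i'r) by exact/val_inj.
  by rewrite row_mxEl mxE.
pose S1 := [set X : 'M[R]_(1 + m, l) | \det (gram X) = 0%R].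
pose S2 := [set X : 'M[R]_(1 + m, l) | F' (kproj X)].
(* The first [r] coordinates of [h + l A] when the multiplier is the one determined by the last
   coordinates. *)
pose comb (X1 : 'M[R]_(1 + m, l)) (X2 : 'M[R]_(1 + m, r)) := row_mx 1%:M (klam X1) *m X2.
pose V1 := [set X : 'M[R]_(1 + m, r + l) | S1 (rsubmx X)].
pose V2 := [set X : 'M[R]_(1 + m, r + l) |
  S2 (rsubmx X) /\ N' (comb (rsubmx X) (lsubmx X))].
have mS1 : measurable S1.
  rewrite -[X in measurable X]setTI.
  exact: (measurable_det (@measurable_gram R m l) measurableT (measurable_set1 0%R)).
have mS2 : measurable S2.
  rewrite -[X in measurable X]setTI.
  exact: (@measurable_kproj R m l measurableT _ mF).
have mcomb : measurable_fun setT
    (fun Z : 'M[R]_(1 + m, r) * 'M[R]_(1 + m, l) => comb Z.2 Z.1).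
  apply: measurable_mulmx => //; apply: measurable_row_mx_comp => //.
  exact: (measurableT_comp (@measurable_klam R m l)).
have mrs : measurable_fun setT (fun X : 'M[R]_(1 + m, r + l) => rsubmx X).
  exact: measurable_rsubmx.
have mls : measurable_fun setT (fun X : 'M[R]_(1 + m, r + l) => lsubmx X).
  exact: measurable_lsubmx.
have mV1 : measurable V1.
  by rewrite -[X in measurable X]setTI; exact: (mrs measurableT _ mS1).
have mV2 : measurable V2.
  apply: measurableI.
    by rewrite -[X in measurable X]setTI; exact: (mrs measurableT _ mS2).
  rewrite -[X in measurable X]setTI.
  exact: (measurableT_comp mcomb (measurable_fun_pair mls mrs) measurableT mN).
pose U := [set X : 'M[R]_(1 + m, r + l) | (V1 `|` V2) (X *m Q)].
have mV : measurable (V1 `|` V2) by exact: measurableU.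
have mU : measurable U.
  by rewrite -[X in measurable X]setTI; exact: (mY _ measurableT _ mV).
have intind (W : set 'M[R]_(1 + m, r + l)) : measurable W -> gauss (1 + m) (r + l) W =
    \int[gauss (1 + m) r]_X2 \int[gauss (1 + m) l]_X1 (\1_W (row_mx X2 X1) : R)%:E.
  move=> mW; rewrite gauss_indic// gauss_row_mx => [//||X]; last by rewrite lee_fin.
  by apply/measurable_EFinP; exact: measurable_indic.
have V10 : gauss (1 + m) (r + l) V1 = 0.
  rewrite intind//.
  transitivity (\int[gauss (1 + m) r]_(x in [set: 'M[R]_(1 + m, r)]) (0 : \bar R)); last by rewrite gauss_cst.
  apply: eq_integral => X2 _; rewrite -(gauss_gram_eq0 (ltnW ml)) gauss_indic//.
  apply: eq_integral => X1 _; rewrite !indicE; congr ((nat_of_bool _)%:R)%:E.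
  by apply/idP/idP; rewrite !in_setE/V1/= row_mxKr.
have mindic p p' (W : set 'M[R]_(p, p')) : measurable W ->
    measurable_fun setT (fun X => (\1_W X : R)%:E).
  by move=> mW; apply/measurable_EFinP; exact: measurable_indic.
(* [S2] depends on the last columns only. Given these, [comb] is a Gaussian row times a positive
   norm, which the cone [N'] ignores: hence the product. *)
have V2E : gauss (1 + m) (r + l) V2 = gauss (1 + m) l S2 * gauss 1 r N'.
  rewrite intind//.
  pose G (Z : 'M[R]_(1 + m, r) * 'M[R]_(1 + m, l)) : \bar R :=
    (\1_S2 Z.2 : R)%:E * (\1_N' (comb Z.2 Z.1) : R)%:E.
  have mG : measurable_fun setT G.
    apply: emeasurable_funM; first exact: (measurableT_comp (mindic _ _ _ mS2)).
    exact: (measurableT_comp (mindic _ _ _ mN) mcomb).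
  have G0 Z : 0 <= G Z by rewrite mule_ge0 ?lee_fin.
  transitivity (\int[gauss (1 + m) r]_X2 \int[gauss (1 + m) l]_X1 G (X2, X1)).
    apply: eq_integral => X2 _; apply: eq_integral => X1 _.
    rewrite /G/= !indicE -EFinM -natrM mulnb; congr ((nat_of_bool _)%:R)%:E.
    apply/idP/idP => [|/andP[]]; rewrite !in_setE/V2/= row_mxKr row_mxKl.
      by move=> [s2 n2]; rewrite !mem_set.
    by [].
  rewrite (gauss_exchange mG G0) gauss_indic//.
  rewrite -(ge0_integralZr (gauss (1 + m) l) measurableT (mindic _ _ _ mS2)) => [|X _|]; last 2 first.
  - by rewrite lee_fin.
  - exact: measure_ge0.
  apply: eq_integral => X1 _.
  have mc1 : measurable_fun setT (fun X2 => (\1_N' (comb X1 X2) : R)%:E).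
    exact: (measurableT_comp (mindic _ _ _ mN) (measurable_fun_pair1 X1 mcomb)).
  have i20 : 0 <= (\1_S2 X1 : R)%:E by rewrite lee_fin.
  have iN0 (X2 : 'M[R]_(1 + m, r)) : setT X2 -> 0 <= (\1_N' (comb X1 X2) : R)%:E by rewrite lee_fin.
  rewrite (ge0_integralZl (gauss (1 + m) r) measurableT mc1 iN0 i20); congr (_ * _).
  rewrite (gauss_lincomb (row_mx 1%:M (klam X1)) (mindic _ _ _ mN)) => [|x]; last by rewrite lee_fin.
  have rho0 : (0 < vnorm (row_mx (1%:M : 'M[R]_1) (klam X1)))%R.
    rewrite lt_neqAle vnorm_ge0 andbT eq_sym vnorm_eq0; apply/eqP => /rowP/(_ (lshift m 0%R)).
    by rewrite row_mxEl !mxE eqxx => /eqP; rewrite oner_eq0.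
  rewrite gauss_indic//; apply: eq_integral => x _; rewrite !indicE.
  congr ((nat_of_bool _)%:R)%:E; apply/idP/idP; rewrite !in_setE; last exact: cN.
  have rhoi : (0 < (vnorm (row_mx (1%:M : 'M[R]_1) (klam X1)))^-1)%R by rewrite invr_gt0.
  by move=> /(cN _ _ rhoi); rewrite scalerA mulVf ?scale1r// gt_eqF.
exists U; split => //.
- move=> X t f w hE Jf Jw Af f0; rewrite /U/=.
  have yE := faceO _ Jf; have xE := ncO _ Jw.
  set y := rsubmx (f *m Q) in yE; set x := lsubmx (w *m Q) in xE.
  have fE : row_mx 0 y *m Q^T = f by rewrite -yE -mulmxA QQ mulmx1.
  have wE : row_mx x 0 *m Q^T = w by rewrite -xE -mulmxA QQ mulmx1.
  set Y := X *m Q.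
  have hY : (usubmx Y + t *m dsubmx Y)%R = row_mx x y.
    rewrite -mul_usub_mx -mul_dsub_mx mulmxA -mulmxDl hE mulmxDl yE xE add_row_mx.
    by rewrite add0r addr0.
  have hl : row_mx 1%:M t *m lsubmx Y = x.
    rewrite -(row_mxKl x y) -hY -(vsubmxK (lsubmx Y)) mul_row_col mul1mx.
    by apply/rowP => i; rewrite !mxE; congr (_ + _)%R; apply: eq_bigr => j _; rewrite !mxE.
  have hr : (usubmx (rsubmx Y) + t *m dsubmx (rsubmx Y))%R = y.
    rewrite -(row_mxKr x y) -hY.
    by apply/rowP => i; rewrite !mxE; congr (_ + _)%R; apply: eq_bigr => j _; rewrite !mxE.
  (* The null event [V1] is part of [U] because the multiplier [t] is identified with [klam] only
     when the Gram determinant is nonzero. *)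
  have [G0|G0] := eqVneq (\det (gram (rsubmx Y))) 0%R; [by left|right].
  have tE : t = klam (rsubmx Y).
    apply: kproj_unique => //; rewrite hr dr -mul_dsub_mx.
    by rewrite -(kerQ _ _ _ yE).
  split; first by rewrite /S2/= /F'/= /kproj -tE hr fE.
  by rewrite /N'/= /comb -tE hl wE.
- by move=> nm; have := leq_trans rm nm; rewrite ltnn.
have UE : gauss (1 + m) (r + l) U = gauss (1 + m) (r + l) (V1 `|` V2).
  rewrite (gauss_indic mU) (gauss_indic mV).
  exact: (gauss_mulmxr Qi (mindic _ _ _ mV) (fun X => _)).
have VU : gauss (1 + m) (r + l) (V1 `|` V2) <=
    gauss (1 + m) (r + l) V1 + gauss (1 + m) (r + l) V2 by exact: measureU2.
rewrite UE; apply: (le_trans VU); rewrite V10 add0e V2E.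
have S2F : gauss (1 + m) l S2 <= gauss 1 l F'.
  by apply: gauss_kproj => //; exact: leq_ltn_trans ml.
apply: (@le_trans _ _ (gauss 1 l F' * gauss 1 r N')); first exact: lee_wpmul2r.
rewrite (gauss_cone_scale k0 mF cF).
have me : measurable_fun setT (fun x : 'rV[R]_l => (expR ((1 - k ^+ 2) / 2 * sqn x))%:E).
  apply/measurable_EFinP; apply: measurableT_comp => //; apply: measurable_funM => //.
  exact: measurable_sqn.
have mFe := emeasurable_funM (mindic _ _ _ mF) me.
have Fe0 (x : 'rV[R]_l) : 0 <= (\1_F' x : R)%:E * (expR ((1 - k ^+ 2) / 2 * sqn x))%:E.
  by rewrite mule_ge0 ?lee_fin ?expR_ge0.
set I1 := \int[gauss 1 l]_x _.
have I10 : 0 <= I1 by exact: integral_ge0.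
rewrite -muleA; apply: lee_pmul.
- by rewrite lee_fin exprn_ge0// ltW.
- by rewrite mule_ge0.
- by rewrite lee_fin; apply: ler_wiXn2l; [exact: ltW|exact: ltW|exact: ltnW].
rewrite -(gauss_mulmxr (gauss_invariantV Qi) mie ie0).
have mieQ : measurable_fun setT (fun h : 'rV[R]_(r + l) =>
    (\1_(face nrm J) (cone_proj nrm (h *m Q^T)) : R)%:E * (expR ((1 - k ^+ 2) / 2 * psi (h *m Q^T)))%:E).
  exact: measurable_mulmx_comp mie.
rewrite (gauss_row_mx mieQ (fun h => ie0 _)) muleC gauss_indic//.
rewrite -(ge0_integralZr (gauss 1 r) measurableT (mindic _ _ _ mN)) => [|x _|//]; last by rewrite lee_fin.
have mieQ2 : measurable_fun setT (fun Z : 'rV[R]_r * 'rV[R]_l =>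
    (\1_(face nrm J) (cone_proj nrm (row_mx Z.1 Z.2 *m Q^T)) : R)%:E *
      (expR ((1 - k ^+ 2) / 2 * psi (row_mx Z.1 Z.2 *m Q^T)))%:E).
  exact: (measurableT_comp mieQ (@measurable_row_mx R 1 r l)).
apply: ge0_le_integral => //.
- by move=> x _; rewrite mule_ge0 ?lee_fin.
- by apply: emeasurable_funM => //; exact: mindic.
- exact: (@measurable_fun_fubini_tonelli_F _ _ _ _ _ (gauss 1 l) _ mieQ2 (fun Z => ie0 (row_mx Z.1 Z.2 *m Q^T))).
move=> x _.
have iN0 : 0 <= (\1_N' x : R)%:E by rewrite lee_fin.
rewrite /I1 -(ge0_integralZl (gauss 1 l) measurableT mFe (fun y _ => Fe0 y) iN0).
apply: ge0_le_integral => //.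
- by apply: emeasurable_funM.
- exact: (measurable_fun_pair2 x mieQ2).
move=> y _; have [xN|xN] := boolP (x \in N'); last first.
  by rewrite [\1_N' x]indicE (negbTE xN) mul0e; exact: ie0.
have [yF|yF] := boolP (y \in F'); last first.
  by rewrite [\1_F' y]indicE (negbTE yF) mul0e mule0; exact: ie0.
move: xN yF; rewrite !in_setE => Nx Fy.
have hE : row_mx x y *m Q^T = (row_mx 0 y *m Q^T + row_mx x 0 *m Q^T)%R.
  by rewrite -mulmxDl add_row_mx add0r addr0.
rewrite hE (cone_proj_face Fy Nx) !indicE !mem_set// !mul1e lee_fin ler_expR.
apply: ler_wpM2l; last first.
  apply: le_trans (psif _ _ Fy Nx).
  rewrite !sqnE_vnorm vnorm_orth; last by rewrite trmxK.
  by rewrite !vnorm_sqr tr_row_mx mul_row_col mul0mx add0r.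
by rewrite divr_ge0// subr_ge0 expr_le1// ltW.
Qed.
End face_bound.

(** * Summing over the faces and removing the auxiliary row *)

Section cone_kernel.
Context {R : realType}.
Local Open Scope ereal_scope.

Lemma measurable_indicE d (T : measurableType d) (A : set T) : measurable A ->
  measurable_fun setT (fun x => (\1_A x : R)%:E).
Proof. by move=> mA; apply/measurable_EFinP; exact: measurable_indic. Qed.

(** The sum over the active sets costs no factor: [cone_proj nrm h] lies in at most one face, so the
    indicators add up to at most 1. *)
Lemma faces_bound n q m (nrm : 'I_q -> 'rV[R]_n) (k : R) (psi : 'rV[R]_n -> R) :
  (0 < k)%R -> (k < 1)%R -> measurable_fun setT psi ->
  (forall f h, in_cone nrm f -> dot f (h - f) = 0 -> sqn f <= psi h)%R ->
  exists U : set 'M[R]_(1 + m, n),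
  [/\ measurable U,
    (forall h A x, in_cone nrm x -> (A *m x^T = 0)%R -> (0 < dot h x)%R -> U (col_mx h A)),
    ((n <= m)%N -> gauss (1 + m) n U = 0) &
    gauss (1 + m) n U <= (k ^+ m)%:E *
      \int[gauss 1 n]_h (expR ((1 - k ^+ 2) / 2 * psi h))%:E].
Proof.
move=> k0 k1 mpsi psif.
have fb (J : {set 'I_q}) : exists U : set 'M[R]_(1 + m, n),
  [/\ measurable U,
    (forall X l f w, (usubmx X + l *m dsubmx X = f + w)%R -> face nrm J f ->
        normal_cone nrm J w -> (dsubmx X *m f^T = 0)%R -> f != 0%R -> U X),
    ((n <= m)%N -> gauss (1 + m) n U = 0) &
    gauss (1 + m) n U <= (k ^+ m)%:E *
      \int[gauss 1 n]_h ((\1_(face nrm J) (cone_proj nrm h) : R)%:E *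
         (expR ((1 - k ^+ 2) / 2 * psi h))%:E)].
  apply: face_bound => // f w Jf Jw; apply: psif; first exact: face_cone Jf.
  by rewrite addrC addKr; exact: normal_face_dot0 Jf Jw.
have [V VP] := choice fb.
pose U := \bigcup_(J in [set: {set 'I_q}]) V J.
have mV J : measurable (V J) by have [] := VP J.
have mU : measurable U by apply: fin_bigcup_measurable => // ; exact: finite_finset.
have gU : gauss (1 + m) n U <= \sum_(J : {set 'I_q}) gauss (1 + m) n (V J).
  rewrite gauss_indic//.
  under eq_bigr do rewrite gauss_indic//.
  rewrite -ge0_integral_sum//; last first.
    by move=> J _; exact: measurable_indicE.
  apply: ge0_le_integral => //.
  - exact: measurable_indicE.
  - by apply: emeasurable_sum => J; exact: measurable_indicE.
  move=> X _; have [XU|XU] := boolP (X \in U); last first.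
    by rewrite indicE (negbTE XU); apply: sume_ge0.
  rewrite indicE XU; move: XU; rewrite in_setE => -[J _ XJ].
  by rewrite (bigD1 J)//= indicE mem_set//= leeDl// sume_ge0.
exists U; split=> //.
- move=> h A x Cx Ax hx.
  have [J [l [f [w [hE Jf Jw Af f0]]]]] := kernel_kkt Cx Ax hx.
  exists J => //; have [_ H _ _] := VP J.
  by apply: (H _ l f w); rewrite ?col_mxKu ?col_mxKd.
- move=> nm; apply/eqP; rewrite eq_le measure_ge0 andbT (le_trans gU)//.
  by rewrite big1// => J _; have [_ _ H _] := VP J; exact: H.
have me : measurable_fun setT (fun h => (expR ((1 - k ^+ 2) / 2 * psi h))%:E).
  by apply/measurable_EFinP; apply: measurableT_comp => //; exact: measurable_funM.
have mp J : measurable_fun setT (fun h => (\1_(face nrm J) (cone_proj nrm h) : R)%:E).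
  exact: (measurableT_comp (measurable_indicE (measurable_face nrm J)) (measurable_moreau _ _)).
have km0 : 0 <= (k ^+ m)%:E by rewrite lee_fin exprn_ge0// ltW.
apply: (le_trans gU).
apply: (@le_trans _ _ (\sum_(J : {set 'I_q}) (k ^+ m)%:E *
      \int[gauss 1 n]_h ((\1_(face nrm J) (cone_proj nrm h) : R)%:E *
         (expR ((1 - k ^+ 2) / 2 * psi h))%:E))).
  by apply: lee_sum => J _; have [] := VP J.
have i0 J h : 0 <= (\1_(face nrm J) (cone_proj nrm h) : R)%:E *
         (expR ((1 - k ^+ 2) / 2 * psi h))%:E by rewrite mule_ge0 ?lee_fin ?expR_ge0.
rewrite -ge0_sume_distrr; last by move=> J _; exact: integral_ge0.
rewrite lee_wpmul2l// -ge0_integral_sum//; last first.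
  by move=> J _; exact: emeasurable_funM.
apply: ge0_le_integral => //.
- by move=> h _; apply: sume_ge0.
- by apply: emeasurable_sum => J; exact: emeasurable_funM.
move=> h _; rewrite -ge0_sume_distrl; last by move=> J _; rewrite lee_fin.
rewrite -[leRHS]mul1e lee_wpmul2r ?lee_fin ?expR_ge0//.
have [/existsP[J JP]|/existsPn nJ] :=
    boolP [exists J : {set 'I_q}, cone_proj nrm h \in face nrm J].
  rewrite (bigD1 J)//= big1 ?adde0; first by rewrite lee_fin indicE lern1 leq_b1.
  move=> J' J'J; rewrite indicE memNset//; apply: contraNnot J'J => h'.
  by apply/eqP/(face_disjoint h'); move: JP; rewrite in_setE.
by rewrite big1// => J _; rewrite indicE (negbTE (nJ J)).
Qed.

(* If a nonzero [x] in the cone is in the kernel of [A], then for every [h] in the half-space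
   [0 < dot h x], of probability one half, the optimality conditions [kernel_kkt] put [h]
   stacked over [A] in the event [U] of [faces_bound]; Markov's inequality costs the factor 2. *)
Lemma cone_kernel_bound n q m (nrm : 'I_q -> 'rV[R]_n) (k : R) (psi : 'rV[R]_n -> R) :
  (0 < k)%R -> (k < 1)%R -> measurable_fun setT psi ->
  (forall f h, in_cone nrm f -> dot f (h - f) = 0 -> sqn f <= psi h)%R ->
  exists B : set 'M[R]_(m, n),
  [/\ measurable B,
    (forall A x, in_cone nrm x -> (A *m x^T = 0)%R -> x != 0%R -> B A),
    ((n <= m)%N -> gauss m n B = 0) &
    gauss m n B <= (2 * k ^+ m)%:E *
      \int[gauss 1 n]_h (expR ((1 - k ^+ 2) / 2 * psi h))%:E].
Proof.
move=> k0 k1 mpsi psif.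
have [U [mU UP U0 Ub]] := @faces_bound n q m nrm k psi k0 k1 mpsi psif.
pose g (A : 'M[R]_(m, n)) := \int[gauss 1 n]_h (\1_U (col_mx h A) : R)%:E.
have mUc : measurable_fun setT
    (fun Z : 'M[R]_(1, n) * 'M[R]_(m, n) => (\1_U (col_mx Z.1 Z.2) : R)%:E).
  exact: (measurableT_comp (measurable_indicE mU) (@measurable_col_mx R 1 m n)).
have Uc0 (Z : 'M[R]_(1, n) * 'M[R]_(m, n)) : 0 <= (\1_U (col_mx Z.1 Z.2) : R)%:E.
  by rewrite lee_fin.
have mg : measurable_fun setT g.
  exact: (@measurable_fun_fubini_tonelli_G _ _ _ _ _ (gauss 1 n) _ mUc Uc0).
have g0 A : 0 <= g A by apply: integral_ge0.
(* A superlevel set of the conditional probability is measurable by Fubini, whereas the existence of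
   a kernel vector in the cone is not directly a measurable condition. *)
pose B := [set A | (2^-1)%:E <= g A].
have mB : measurable B.
  by rewrite -[X in measurable X]setTI; exact: emeasurable_fun_c_infty.
have gB : gauss m n B <= 2%:E * gauss (1 + m) n U.
  rewrite (gauss_indic mU) (gauss_col_mx (measurable_indicE mU)) => [|X]; last by rewrite lee_fin.
  rewrite (gauss_exchange mUc Uc0) (gauss_indic mB).
  have two0 : 0 <= 2%:E :> \bar R by rewrite lee_fin.
  rewrite -(ge0_integralZl (gauss m n) measurableT mg (fun A _ => g0 A) two0).
  apply: ge0_le_integral => //.
  - exact: measurable_indicE.
  - exact: emeasurable_funM.
  move=> A _; have [AB|AB] := boolP (A \in B); last first.
    by rewrite indicE (negbTE AB); exact: mule_ge0.
  rewrite indicE AB; move: AB; rewrite in_setE => /(lee_wpmul2l two0).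
  by rewrite -EFinM divff.
exists B; split=> //.
- move=> A x Cx Ax x0; rewrite /B/= -(gauss_halfspace x0).
  have mh : measurable [set h : 'rV[R]_n | (0 < (h *m x^T) 0 0)%R].
    have mpos : measurable [set x : R | 0 < x]%R.
      by have -> : [set x : R | 0 < x]%R = `]0%R, +oo[%classic by rewrite set_itvE.
    by rewrite -[X in measurable X]setTI; exact: (measurable_dot x measurableT mpos).
  rewrite gauss_indic//; apply: ge0_le_integral => //.
  - exact: measurable_indicE.
  - exact: (measurable_fun_pair1 A mUc).
  move=> h _; have [hx|hx] := boolP (h \in [set h : 'rV[R]_n | (0 < (h *m x^T) 0 0)%R]); last first.
    by rewrite indicE (negbTE hx) lee_fin.
  have XU : U (col_mx h A).
    by move: hx; rewrite in_setE => hx; exact: (UP h A x Cx Ax hx).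
  by rewrite indicE hx indicE mem_set.
- move=> nm; apply/eqP; rewrite eq_le measure_ge0 andbT (le_trans gB)//.
  by rewrite U0// mule0.
apply: (le_trans gB); rewrite EFinM -muleA; apply: lee_wpmul2l => //.
Qed.

End cone_kernel.

(** * Gaussian tails and exponential moments *)

Section gaussian_tail.
Context {R : realType}.
Implicit Types (t u x c : R).
Local Notation leb := (@lebesgue_measure R).
Local Notation normal1 := (normal_prob (0 : R) 1).

(** Written through the integral up to [t], whose derivative the fundamental theorem of calculus
    gives. *)
Definition upper_tail t : R := 1 - (\int[leb]_(u in `]-oo, t]) phi u)%R.

Lemma phiN x : phi (- x) = phi x.
Proof. by rewrite /phi sqrrN. Qed.

Lemma is_derive_phi x : is_derive x 1 (@phi R) (- x * phi x).
Proof.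
have -> : @phi R = fun u => (Num.sqrt (pi *+ 2))^-1 *: expR (- 2^-1 * u ^+ 2).
  by apply/funext => u; rewrite /phi; congr (_ * expR _); field.
apply: is_derive_eq.
rewrite /GRing.scale /= !mulr1; set p := (Num.sqrt _)^-1; set e := expR _.
by clearbody p e; field.
Qed.

Lemma continuous_phi : continuous (@phi R).
Proof.
have -> : @phi R = normal_pdf 0 1 by apply/funext => x; rewrite phiE.
by apply: continuous_normal_pdf; rewrite oner_eq0.
Qed.

Lemma integrable_phi : leb.-integrable setT (EFin \o @phi R).
Proof.
have -> : @phi R = normal_pdf 0 1 by apply/funext => x; rewrite phiE.
exact: integrable_normal_pdf.
Qed.

Lemma is_derive_upper_tail t : is_derive t 1 upper_tail (- phi t).
Proof.
have i1 : leb.-integrable `]-oo, (t + 1)] (EFin \o @phi R).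
  by apply: integrableS integrable_phi.
have tt1 : t < t + 1 by rewrite ltrDl.
have [d1 d2] := continuous_FTC1 tt1 i1 (ltNyr _) (@continuous_phi t).
rewrite -d2 derive1E -[X in is_derive _ _ _ X]add0r /upper_tail.
apply: is_deriveB; exact: DeriveDef.
Qed.

Lemma lower_tailE t : normal1 `]-oo, t] = (1 - upper_tail t)%:E.
Proof.
rewrite /upper_tail opprB addrCA subrr addr0 /normal_prob /Rintegral fineK; last first.
  apply: integrable_fin_num => //; by apply: integrableS integrable_phi.
by apply: eq_integral => x _; rewrite phiE.
Qed.

Lemma upper_tailE t : normal1 `[t, +oo[ = (upper_tail t)%:E.
Proof.
have E2 : normal1 `[t, +oo[ = normal1 `]t, +oo[.
  apply/eqP; rewrite eq_le; apply/andP; split.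
    have -> : `[t, +oo[%classic = [set t] `|` `]t, +oo[%classic :> set R.
      by rewrite setU1itv.
    rewrite (le_trans (measureU2 _ _ _))//.
    by rewrite [X in (X + _)%E](_ : _ = 0%E) ?add0e//; exact: normal1_set1.
  apply: le_measure; rewrite ?inE//; apply: subset_itvr; by rewrite bnd_simp.
rewrite E2 -[X in normal1 X](setCK) setCitvr probability_setC//.
transitivity (1%:E - (1 - upper_tail t)%:E)%E; first by rewrite -lower_tailE.
by rewrite -EFinB; congr EFin; ring.
Qed.

Lemma upper_tail_ge0 t : 0 <= upper_tail t.
Proof. by rewrite -lee_fin -upper_tailE measure_ge0. Qed.

Lemma normal1_indic (B : set R) : measurable B ->
  (\int[normal1]_x (\1_B x)%:E)%E = normal1 B.
Proof. by move=> mB; rewrite integral_indic// setIT. Qed.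

Lemma upper_tailN t : upper_tail (- t) = 1 - upper_tail t.
Proof.
have mI : measurable (`[(- t), +oo[ : set R) by [].
have mJ : measurable (`]-oo, t] : set R) by [].
apply: EFin_inj; rewrite -upper_tailE -lower_tailE.
apply: (etrans (esym (normal1_indic mI))); apply: (etrans _ (normal1_indic mJ)).
rewrite (@normal1N R); last 2 first.
- by apply/measurable_EFinP.
- by move=> x; rewrite lee_fin.
apply: eq_integral => x _; rewrite !indicE; congr ((nat_of_bool _)%:R)%:E.
by apply/idP/idP; rewrite !in_setE/= !in_itv/= andbT lerN2.
Qed.

Lemma phi_le1 x : phi x <= 1.
Proof.
rewrite /phi -[leRHS]mulr1 ler_pM ?invr_ge0 ?sqrtr_ge0 ?expR_ge0//; last first.
  by rewrite -expR0 ler_expR mulNr oppr_le0 divr_ge0 ?sqr_ge0.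
have p1 : 1 <= pi *+ 2 :> R by have := pi_ge2 R; rewrite mulr2n; lra.
have s1 : 1 <= Num.sqrt (pi *+ 2) :> R by rewrite -[leLHS](@sqrtr1 R) ler_wsqrtr.
by rewrite invf_le1// (lt_le_trans ltr01).
Qed.

Lemma sqr_phi_le2 x : x ^+ 2 * phi x <= 2.
Proof.
have p1 : (Num.sqrt (pi *+ 2))^-1 <= 1 :> R.
  by have := phi_le1 0; rewrite /phi expr0n/= oppr0 mul0r expR0 mulr1.
have e1 := expR_ge1Dx (x ^+ 2 / 2).
have x0 := sqr_ge0 x.
rewrite /phi mulrCA; apply: (@le_trans _ _ (1 * (x ^+ 2 * expR (- x ^+ 2 / 2)))).
  by rewrite ler_wpM2r// mulr_ge0 ?expR_ge0.
rewrite mul1r mulNr expRN ler_pdivrMr ?expR_gt0//; nra.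
Qed.

Lemma cvgy_inv_bound (f : R -> R) c : (forall x, 1 <= x -> `|f x| * x <= c) ->
  f x @[x --> +oo] --> 0.
Proof.
move=> fc; apply/cvgrPdist_le => e e0; near=> x.
have x1 : 1 <= x by near: x; exact: nbhs_pinfty_ge.
have x0 : 0 < x by exact: lt_le_trans x1.
have xce : c / e <= x by near: x; apply: nbhs_pinfty_ge; rewrite num_real.
rewrite sub0r normrN -(ler_pM2r x0) (le_trans (fc _ x1))//.
by rewrite mulrC -ler_pdivrMr.
Unshelve. all: by end_near. Qed.

(** For [t > 0], the integral of [u * phi u] beyond [t] is exactly [phi t] and dominates [t] times
    the tail. *)
Lemma mills t : t * upper_tail t <= phi t.
Proof.
have [t0|t0] := leP t 0.
  by rewrite (@le_trans _ _ 0) ?phi_ge0// mulr_le0_ge0// upper_tail_ge0.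
have dN u : is_derive u 1 (fun u => - phi u) (u * phi u).
  have h := is_derive_phi u; apply: is_derive_eq; by rewrite mulNr opprK.
have cf : continuous (fun u : R => u * phi u).
  by move=> u; apply: cvgM; [exact: cvg_id|exact: continuous_phi].
have E : (\int[leb]_(u in `[t, +oo[) (u * phi u)%:E = 0%:E - (- phi t)%:E)%E.
  apply: (@ge0_continuous_FTC2y R (fun u => u * phi u) (fun u => - phi u)).
  - by move=> x tx; rewrite mulr_ge0 ?phi_ge0// (le_trans (ltW t0)).
  - exact: continuous_subspaceT.
  - apply: (@cvgy_inv_bound _ 2) => x x1; rewrite normrN ger0_norm ?phi_ge0// mulrC.
    apply: le_trans (sqr_phi_le2 x); rewrite ler_wpM2r ?phi_ge0//.
    by rewrite expr2 ler_peMl// (le_trans ler01).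
  - by move=> x tx; apply: ex_derive.
  - by apply: cvg_at_right_filter; apply: cvgN; exact: continuous_phi.
  - by move=> x _; rewrite derive1E derive_val.
move: E; rewrite sub0e -EFinN opprK => E.
rewrite -lee_fin -E EFinM -upper_tailE /normal_prob.
rewrite -ge0_integralZl//; last 3 first.
- by apply/measurable_EFinP/measurable_funTS; exact: measurable_normal_pdf.
- by move=> x _; rewrite lee_fin normal_pdf_ge0.
- by rewrite lee_fin ltW.
apply: ge0_le_integral => //.
- move=> x _; rewrite mule_ge0// lee_fin ?normal_pdf_ge0//; exact: ltW.
- apply/measurable_EFinP/measurable_funTS/measurable_funM => //.
  exact: measurable_normal_pdf.
- by apply/measurable_EFinP/measurable_funTS/measurable_funM => //; exact: measurable_phi.
- move=> x /=; rewrite in_itv/= andbT => tx.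
  by rewrite phiE -EFinM lee_fin ler_wpM2r ?phi_ge0.
Qed.

(** Mills' inequality at [- t]; it signs one factor of the derivative in [exp_pos_bound]. *)
Lemma millsN t : 0 <= phi t + t * (1 - upper_tail t).
Proof. by rewrite -upper_tailN; have := mills (- t); rewrite phiN mulNr; lra. Qed.

(** Closed form of the second moment of the positive part of [g - t] for a standard normal [g], see
    [tail_sqrE]. *)
Definition tail_sqr t : R := (1 + t ^+ 2) * upper_tail t - t * phi t.

Lemma tail_sqrE t :
  (\int[leb]_(u in `[t, +oo[) (((u - t) ^+ 2) * phi u)%:E = (tail_sqr t)%:E)%E.
Proof.
pose F u := - ((u - 2 * t) * phi u + (1 + t ^+ 2) * upper_tail u).
have dF u : is_derive u 1 F ((u - t) ^+ 2 * phi u).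
  have h1 := is_derive_phi u; have h2 := is_derive_upper_tail u.
  rewrite /F; apply: is_derive_eq; rewrite /GRing.scale /=; ring.
have cf : continuous (fun u : R => (u - t) ^+ 2 * phi u).
  move=> u; have h := is_derive_phi u.
  by apply: differentiable_continuous; apply/derivable1_diffP; apply: ex_derive.
rewrite (@ge0_continuous_FTC2y R (fun u => (u - t) ^+ 2 * phi u) F t 0).
- by rewrite sub0e -EFinN /F opprK /tail_sqr; congr EFin; ring.
- by move=> x tx; rewrite mulr_ge0 ?phi_ge0// sqr_ge0.
- exact: continuous_subspaceT.
(* The three summands bound the terms of [F x * x], by [x ^+ 2 * phi x <= 2], [x * phi x <= 2] and
   [x * upper_tail x <= phi x <= 1]. *)
- apply: (@cvgy_inv_bound _ (2 + 2 * `|t| * 2 + (1 + t ^+ 2))) => x x1.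
  have x0 : 0 <= x by lra.
  have p1 := phi_le1 x; have p0 := phi_ge0 x; have p2 := sqr_phi_le2 x.
  have q0 := upper_tail_ge0 x; have q1 := mills x; have t0 := normr_ge0 t.
  have xp : x * phi x <= 2 by apply: le_trans p2; rewrite expr2 -mulrA ler_peMl// mulr_ge0.
  have xxp : 0 <= x * phi x by rewrite mulr_ge0.
  rewrite /F normrN -[X in _ * X <= _](ger0_norm x0) -normrM.
  have -> : ((x - 2 * t) * phi x + (1 + t ^+ 2) * upper_tail x) * x =
    x ^+ 2 * phi x + - (2 * t * (x * phi x)) + (1 + t ^+ 2) * (x * upper_tail x) by ring.
  apply: (le_trans (ler_normD _ _)); apply: lerD.
    apply: (le_trans (ler_normD _ _)); apply: lerD.
      by rewrite ger0_norm// mulr_ge0 ?sqr_ge0.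
    rewrite normrN normrM (ger0_norm xxp) normrM normr_nat.
    by rewrite ler_wpM2l ?mulr_ge0.
  have t2 : 0 <= 1 + t ^+ 2 by rewrite addr_ge0 ?sqr_ge0.
  rewrite ger0_norm ?mulr_ge0// -[leRHS]mulr1 ler_wpM2l//; lra.
- by move=> x tx; apply: ex_derive.
- apply: cvg_at_right_filter; apply: differentiable_continuous.
  by apply/derivable1_diffP; apply: ex_derive.
- by move=> x _; rewrite derive1E derive_val.
Qed.

End gaussian_tail.

(** * Exponential moments of a squared excess *)

Section gaussian_exponential_tail.
Context {R : realType}.
Implicit Types (t u x c : R).
Local Notation normal1 := (normal_prob (0 : R) 1).

(* With [s = c / (1 + 2 c)] completing the square gives this value for the expectation of
   [expR (s (g - t) ^ 2)] on [g >= t]; [c] is a more convenient parameter than [s]. *)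
Definition exp_tail c t : R :=
  Num.sqrt (1 + 2 * c) * expR (c * t ^+ 2) * upper_tail (Num.sqrt (1 + 2 * c) * t).

Lemma sqr_sqrt_1D2 c : 0 <= c -> Num.sqrt (1 + 2 * c) ^+ 2 = 1 + 2 * c.
Proof. by move=> c0; rewrite sqr_sqrtr//; lra. Qed.

Lemma exp_tailE c t : 0 <= c ->
  (\int[normal1]_u (expR (c / (1 + 2 * c) * (u - t) ^+ 2) * \1_(`[t, +oo[) u)%:E
   = (exp_tail c t)%:E)%E.
Proof.
move=> c0; have k2 := sqr_sqrt_1D2 c0; rewrite /exp_tail; set k := Num.sqrt _ in k2 *.
have k0 : 0 < k by rewrite sqrtr_gt0; lra.
have k1 : k != 0 by rewrite gt_eqF.
have c1 : 1 + 2 * c != 0 by rewrite gt_eqF//; lra.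
(* After scaling by [k] the quadratic terms of the exponent cancel, since [s * k ^+ 2 = c]; [y] is
   the slope of the remaining linear term, which a Gaussian shift absorbs. *)
set s := c / (1 + 2 * c); pose y := - (2 * s * k * t).
have sk : s * k ^+ 2 = c by rewrite k2 /s divfK.
pose f u : \bar R := (expR (s * (u - t) ^+ 2) * \1_(`[t, +oo[) u)%:E.
have f0 u : (0 <= f u)%E by rewrite lee_fin mulr_ge0 ?expR_ge0.
have mf : measurable_fun setT f.
  apply/measurable_EFinP; apply: measurable_funM; last exact: measurable_indic.
  apply: measurableT_comp => //; apply: measurable_funM => //.
  by apply: measurable_funX; exact: measurable_funB.
rewrite -/(f _) (normal1_scale k0 mf f0).
pose g u : \bar R := (\1_(`[(t / k), +oo[) u)%:E.
have g0 u : (0 <= g u)%E by rewrite lee_fin.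
have mg : measurable_fun setT g by apply/measurable_EFinP; exact: measurable_indic.
have mw : measurable_fun setT (fun x : R => (expR (x * y - y ^+ 2 / 2))%:E).
  apply/measurable_EFinP; apply: measurableT_comp => //; apply: measurable_funB => //.
  exact: measurable_funM.
transitivity ((k * expR (c * t ^+ 2))%:E * \int[normal1]_u g (u + y)%R)%E.
  have gw0 (x : R) : (0 <= g x * (expR (x * y - y ^+ 2 / 2))%:E)%E.
    by rewrite mule_ge0// lee_fin expR_ge0.
  have ke0 : (0 <= (k * expR (c * t ^+ 2))%:E)%E by rewrite lee_fin mulr_ge0 ?expR_ge0// ltW.
  rewrite (normal1_shift y mg g0).
  rewrite -(ge0_integralZl normal1 measurableT (emeasurable_funM mg mw) (fun x _ => gw0 x) ke0).
  apply: eq_integral => x _; rewrite /f /g -!EFinM; congr EFin.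
  have -> : \1_(`[t, +oo[) (k * x) = \1_(`[(t / k), +oo[) x :> R.
    rewrite !indicE; congr ((nat_of_bool _)%:R); apply/idP/idP;
    by rewrite !in_setE/= !in_itv/= !andbT ler_pdivrMr// mulrC.
  transitivity (k * \1_(`[(t / k), +oo[) x * (expR (s * (k * x - t) ^+ 2) *
     expR (- ((k ^+ 2 - 1) * x ^+ 2 / 2)))); first by ring.
  transitivity (k * \1_(`[(t / k), +oo[) x * (expR (c * t ^+ 2) *
     expR (x * y - y ^+ 2 / 2))); last by ring.
  rewrite -!expRD; congr (_ * expR _).
  have -> : k ^+ 2 - 1 = 2 * c by rewrite k2; ring.
  have e1 : s * t ^+ 2 = c * t ^+ 2 - 2 * c * s * t ^+ 2.
    by rewrite -{1}(divfK c1 c) -/s; ring.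
  have -> : y ^+ 2 / 2 = 2 * (s * k ^+ 2) * s * t ^+ 2 by rewrite /y; field.
  have -> : s * (k * x - t) ^+ 2 = s * k ^+ 2 * x ^+ 2 - 2 * s * k * x * t + s * t ^+ 2.
    by ring.
  by rewrite sk /y e1; field.
rewrite [RHS]EFinM; congr (_ * _)%E.
have ty : t / k - y = k * t.
  apply: (mulfI k1); rewrite /y opprK mulrDr mulrCA divff// mulr1.
  have -> : k * (2 * s * k * t) = 2 * (s * k ^+ 2) * t by ring.
  by rewrite sk mulrA -expr2 k2; ring.
have mI : measurable (`[(k * t), +oo[ : set R) by [].
rewrite -upper_tailE; apply: (etrans _ (normal1_indic mI)).
apply: eq_integral => x _; rewrite /g !indicE; congr ((nat_of_bool _)%:R)%:E.
by apply/idP/idP; rewrite !in_setE/= !in_itv/= !andbT -ty lerBlDr.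
Qed.

Lemma upper_tail_le_exp_tail c t : 0 <= c -> upper_tail t <= exp_tail c t.
Proof.
move=> c0; have mI : measurable (`[t, +oo[ : set R) by [].
rewrite -lee_fin -exp_tailE// -upper_tailE.
have f0 (x : R) : (0 <= (expR (c / (1 + 2 * c) * (x - t) ^+ 2) * \1_(`[t, +oo[) x)%:E)%E.
  by rewrite lee_fin mulr_ge0 ?expR_ge0.
have le1f (x : R) : \1_(`[t, +oo[) x <= expR (c / (1 + 2 * c) * (x - t) ^+ 2) * \1_(`[t, +oo[) x.
  have s0 : 0 <= c / (1 + 2 * c) by rewrite divr_ge0//; lra.
  by rewrite ler_peMl// -[leLHS]expR0 ler_expR mulr_ge0 ?sqr_ge0.
apply: (@le_trans _ _ (\int[normal1]_x (\1_(`[t, +oo[) x)%:E)%E).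
  by rewrite le_eqVlt; apply/orP; left; apply/eqP; exact: esym (normal1_indic mI).
apply: ge0_le_integral => //.
- exact/measurable_EFinP/measurable_indic.
- apply/measurable_EFinP; apply: measurable_funM; last exact: measurable_indic.
  apply: measurableT_comp => //; apply: measurable_funM => //.
  by apply: measurable_funX; exact: measurable_funB.
- by move=> x _; rewrite lee_fin; exact: le1f.
Qed.

Lemma is_derive_exp_tail c t : 0 <= c ->
  is_derive t 1 (exp_tail c) (2 * c * t * exp_tail c t - (1 + 2 * c) * phi t).
Proof.
move=> c0; have k2 := sqr_sqrt_1D2 c0; rewrite /exp_tail; set k := Num.sqrt _ in k2 *.
have h : is_derive t 1 (fun t => upper_tail (k * t)) (- phi (k * t) * k).
  have h1 := is_derive_upper_tail (k * t).
  apply: (@is_derive1_comp _ upper_tail (fun t => k * t)).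
  by apply: is_derive_eq; rewrite /GRing.scale/= mulr1.
apply: is_derive_eq.
have -> : phi t = expR (c * t ^+ 2) * phi (k * t).
  rewrite /phi mulrCA -expRD; congr (_ * expR _).
  by rewrite exprMn k2; field.
rewrite -k2 /GRing.scale/= !mulr1; clearbody k; ring.
Qed.

Lemma is_derive_tail_sqr t :
  is_derive t 1 tail_sqr (- 2 * (phi t - t * upper_tail t)).
Proof.
have h1 := is_derive_phi t; have h2 := is_derive_upper_tail t.
rewrite /tail_sqr; apply: is_derive_eq.
by rewrite /GRing.scale/=; ring.
Qed.

Lemma tail_sqr_ge0 t : 0 <= tail_sqr t.
Proof.
rewrite -lee_fin -tail_sqrE; apply: integral_ge0 => x _.
by rewrite lee_fin mulr_ge0 ?sqr_ge0 ?phi_ge0.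
Qed.

Lemma tail_sqrDN t : tail_sqr t + tail_sqr (- t) = 1 + t ^+ 2.
Proof. by rewrite /tail_sqr phiN upper_tailN; ring. Qed.

(* The expectation of [expR (c / (1 + 2 c) * max (g - t, 0) ^ 2)], see [expR_excess]. *)
Definition exp_pos c t : R := 1 - upper_tail t + exp_tail c t.

Lemma exp_pos_ge1 c t : 0 <= c -> 1 <= exp_pos c t.
Proof. by move=> c0; have := upper_tail_le_exp_tail t c0; rewrite /exp_pos; lra. Qed.

(** Mills' inequality at [Num.sqrt (1 + 2 * c) * t], where [phi] is [expR (- (c * t ^+ 2))] times
    [phi t]. The bound supplies the limit at infinity. *)
Lemma exp_pos_decay c t : 0 <= c -> 1 <= t -> exp_pos c t <= 1 + t^-1.
Proof.
move=> c0 t1; have t0 : 0 < t by lra.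
have k2 := sqr_sqrt_1D2 c0.
have q0 := upper_tail_ge0 t.
suff : exp_tail c t <= t^-1 by rewrite /exp_pos; lra.
rewrite -(ler_pM2r t0) mulVf ?gt_eqF//; apply: le_trans (phi_le1 t).
have -> : phi t = expR (c * t ^+ 2) * phi (Num.sqrt (1 + 2 * c) * t).
  by rewrite /phi mulrCA -expRD; congr (_ * expR _); rewrite exprMn k2; field.
have := mills (Num.sqrt (1 + 2 * c) * t).
rewrite -(ler_pM2l (expR_gt0 (c * t ^+ 2))); apply: le_trans.
by rewrite /exp_tail le_eqVlt; apply/orP; left; apply/eqP; ring.
Qed.

(* [exp_pos c t * expR (- (c * tail_sqr t))] is nondecreasing: its derivative factors as
   [2 c (exp_tail - upper_tail) (phi t + t (1 - upper_tail t)) >= 0] up to the exponential,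
   and its limit at infinity is at most 1. *)
Lemma exp_pos_bound c t : 0 <= c -> exp_pos c t <= expR (c * tail_sqr t).
Proof.
move=> c0; pose g t := exp_pos c t * expR (- (c * tail_sqr t)).
have dg u : is_derive u 1 g (2 * c * (exp_tail c u - upper_tail u) *
    (phi u + u * (1 - upper_tail u)) * expR (- (c * tail_sqr u))).
  have h1 := is_derive_exp_tail u c0; have h2 := is_derive_tail_sqr u.
  have h3 := is_derive_upper_tail u.
  have h4 : is_derive u 1 (fun u => expR (- (c * tail_sqr u)))
      (expR (- (c * tail_sqr u)) * (2 * c * (phi u - u * upper_tail u))).
    apply: (@is_derive1_comp _ expR (fun u => - (c * tail_sqr u))).
    by apply: is_derive_eq; rewrite /GRing.scale/=; ring.
  rewrite /g /exp_pos; apply: is_derive_eq; rewrite /GRing.scale/=; ring.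
have ndg u v : u <= v -> g u <= g v.
  move=> uv; apply: (@ger0_derive1_le_cc _ g u v) => //.
  - move=> x _; rewrite derive1E; have [_ ->] := dg x.
    rewrite !mulr_ge0 ?expR_ge0 ?millsN ?subr_ge0 ?upper_tail_le_exp_tail//.
  - apply: continuous_subspaceT => x; apply: differentiable_continuous.
    by apply/derivable1_diffP; have [] := dg x.
  - by rewrite in_itv/= lexx.
  - by rewrite in_itv/= lexx andbT.
suff g1 : g t <= 1.
  by move: g1; rewrite /g expRN ler_pdivrMr ?expR_gt0// mul1r.
apply/ler_addgt0Pr => e e0.
(* A point beyond [t] at which the decay bound is at most [1 + e]. *)
pose v := Num.max t (Num.max 1 e^-1).
have v1 : 1 <= v by rewrite /v !le_max lexx orbT.
have ve : v^-1 <= e.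
  by rewrite -[leRHS]invrK lef_pV2 ?posrE ?invr_gt0// ?(lt_le_trans ltr01)// /v !le_max lexx !orbT.
have tv : t <= v by rewrite /v le_max lexx.
apply: (le_trans (ndg _ _ tv)); apply: (@le_trans _ _ (exp_pos c v)).
  rewrite /g ler_piMr//; first by rewrite (le_trans ler01)// exp_pos_ge1.
  by rewrite -expR0 ler_expR oppr_le0 mulr_ge0 ?tail_sqr_ge0.
by apply: (le_trans (exp_pos_decay c0 v1)); rewrite lerD2l.
Qed.

End gaussian_exponential_tail.

(** * Moments of one coordinate of the squared distance *)

Section coordinate_moments.
Context {R : realType}.
Implicit Types (t u x c : R).
Local Notation normal1 := (normal_prob (0 : R) 1).
Local Notation leb := (@lebesgue_measure R).

Definition excess t u : R := Num.max (u - t) 0.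

Lemma measurable_excess t : measurable_fun setT (excess t).
Proof. by apply: measurable_maxr => //; exact: measurable_funB. Qed.

Lemma measurable_expR_excess (s t : R) :
  measurable_fun setT (fun u => (expR (s * excess t u ^+ 2))%:E).
Proof.
apply/measurable_EFinP; apply: measurableT_comp => //; apply: measurable_funM => //.
by apply: measurable_funX; exact: measurable_excess.
Qed.

Lemma expR_excess c t : 0 <= c ->
  (\int[normal1]_u (expR (c / (1 + 2 * c) * excess t u ^+ 2))%:E = (exp_pos c t)%:E)%E.
Proof.
move=> c0; set s := c / _.
have mI : measurable (`[t, +oo[ : set R) by [].
have m1 := measurable_expR_excess s t.
have m2 : measurable_fun setT (fun u => (\1_(`[t, +oo[) u)%:E : \bar R).
  by apply/measurable_EFinP; exact: measurable_indic.
have m3 : measurable_fun setT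
    (fun u => (expR (s * (u - t) ^+ 2) * \1_(`[t, +oo[) u)%:E : \bar R).
  apply/measurable_EFinP; apply: measurable_funM; last exact: measurable_indic.
  apply: measurableT_comp => //; apply: measurable_funM => //.
  by apply: measurable_funX; exact: measurable_funB.
have p1 u : (0 <= (expR (s * excess t u ^+ 2))%:E)%E by rewrite lee_fin expR_ge0.
have p2 u : (0 <= (\1_(`[t, +oo[) u)%:E :> \bar R)%E by rewrite lee_fin.
have p3 u : (0 <= (expR (s * (u - t) ^+ 2) * \1_(`[t, +oo[) u)%:E)%E.
  by rewrite lee_fin mulr_ge0 ?expR_ge0.
have q2 : (\int[normal1]_u (\1_(`[t, +oo[) u)%:E = (upper_tail t)%:E)%E.
  by rewrite -upper_tailE; exact: normal1_indic.
(* Adding the indicator of [[t, +oo[] on one side and 1 on the other gives a pointwise identity of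
   nonnegative functions, avoiding subtraction under the integral. *)
have E : (\int[normal1]_u (expR (s * excess t u ^+ 2))%:E + (upper_tail t)%:E =
    1 + (exp_tail c t)%:E)%E.
  rewrite -q2 -(exp_tailE t c0) -/s -(ge0_integralD normal1 measurableT (fun x _ => p1 x) m1 (fun x _ => p2 x) m2).
  have -> : (1 = \int[normal1]_u (1%:E : \bar R))%E.
    by rewrite integral_cst// mul1e; apply: esym; exact: probability_setT.
  rewrite -ge0_integralD//.
  apply: eq_integral => u _; rewrite -!EFinD; congr EFin.
  rewrite indicE /excess; have [tu|ut] := leP t u.
    rewrite mem_set /=; last by rewrite in_itv/= tu.
    by rewrite max_l ?subr_ge0// mulr1 addrC.
  rewrite memNset/=; last by rewrite in_itv/= andbT leNgt ut.
  by rewrite max_r ?subr_le0 ?(ltW ut)// expr0n/= mulr0 expR0 mulr0.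
rewrite -[LHS](@addeK _ (upper_tail t)%:E)// E.
by congr EFin; rewrite /exp_pos; ring.
Qed.

Lemma expR_excess_le c t : 0 <= c ->
  (\int[normal1]_u (expR (c / (1 + 2 * c) * excess t u ^+ 2))%:E
   <= (expR (c * tail_sqr t))%:E)%E.
Proof. by move=> c0; rewrite expR_excess// lee_fin exp_pos_bound. Qed.

Lemma expR_excessN c t : 0 <= c ->
  (\int[normal1]_u (expR (c / (1 + 2 * c) * excess t (- u) ^+ 2))%:E = (exp_pos c t)%:E)%E.
Proof.
move=> c0; rewrite -(expR_excess t c0); apply: esym.
apply: (@normal1N _ (fun u => (expR (c / (1 + 2 * c) * excess t u ^+ 2))%:E)).
  exact: measurable_expR_excess.
by move=> x; rewrite lee_fin expR_ge0.
Qed.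

(* As at most one of the two excesses is nonzero, the exponential of the sum is the sum of the
   two exponentials minus 1; then [x + y - 1 <= x * y] for [x, y >= 1]. *)
Lemma expR_excess2_le c t t' : 0 <= c -> 0 <= t + t' ->
  (\int[normal1]_u (expR (c / (1 + 2 * c) *
      (excess t u ^+ 2 + excess t' (- u) ^+ 2)))%:E
   <= (expR (c * (tail_sqr t + tail_sqr t')))%:E)%E.
Proof.
move=> c0 tt'; set s := c / _.
have m1 := measurable_expR_excess s t.
have m2 : measurable_fun setT (fun u => (expR (s * excess t' (- u) ^+ 2))%:E).
  exact: (measurableT_comp (measurable_expR_excess s t')).
have m3 : measurable_fun setT
    (fun u => (expR (s * (excess t u ^+ 2 + excess t' (- u) ^+ 2)))%:E).
  apply/measurable_EFinP; apply: measurableT_comp => //; apply: measurable_funM => //.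
  apply: measurable_funD; apply: measurable_funX; first exact: measurable_excess.
  by apply: measurableT_comp => //; exact: measurable_excess.
have p1 u : (0 <= (expR (s * excess t u ^+ 2))%:E)%E by rewrite lee_fin expR_ge0.
have p2 u : (0 <= (expR (s * excess t' (- u) ^+ 2))%:E)%E by rewrite lee_fin expR_ge0.
have p3 u : (0 <= (expR (s * (excess t u ^+ 2 + excess t' (- u) ^+ 2)))%:E)%E.
  by rewrite lee_fin expR_ge0.
have E : (\int[normal1]_u (expR (s * (excess t u ^+ 2 + excess t' (- u) ^+ 2)))%:E + 1 =
    (exp_pos c t)%:E + (exp_pos c t')%:E)%E.
  rewrite -(expR_excess t c0) -(expR_excessN t' c0) -/s.
  have -> : (1 = \int[normal1]_u (1%:E : \bar R))%E.
    by rewrite integral_cst// mul1e; apply: esym; exact: probability_setT.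
  rewrite -!ge0_integralD//.
  apply: eq_integral => u _; rewrite -!EFinD; congr EFin.
  rewrite /excess; have [tu|ut] := leP u t.
    by rewrite (@max_r _ _ (u - t)) ?subr_le0// expr0n/= add0r mulr0 expR0 addrC.
  rewrite (@max_r _ _ (- u - t')); last by lra.
  by rewrite expr0n/= addr0 mulr0 expR0.
have -> : (\int[normal1]_u (expR (s * (excess t u ^+ 2 + excess t' (- u) ^+ 2)))%:E =
    (exp_pos c t + exp_pos c t' - 1)%:E)%E.
  by rewrite -[LHS](@addeK _ 1%:E)// E.
rewrite lee_fin mulrDr expRD.
have := exp_pos_bound t c0; have := exp_pos_bound t' c0.
have := exp_pos_ge1 t c0; have := exp_pos_ge1 t' c0.
nra.
Qed.

(** By the reflection [u -> - u], both extreme labels contribute the same integral. *)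
Lemma bound_funE (khat kL1 kL2 k0 : nat) t :
  bound_fun khat kL1 kL2 k0 t =
  (khat%:R * (1 + t ^+ 2) + (kL1 + kL2)%:R * tail_sqr (- t) + k0%:R * (2 * tail_sqr t))%:E.
Proof.
rewrite /bound_fun.
have E1 : (\int[leb]_(u in Ige (- t)) (((u + t) ^+ 2) * phi u)%:E = (tail_sqr (- t))%:E)%E.
  by rewrite -tail_sqrE; apply: eq_integral => u _; rewrite opprK.
have E2 : (\int[leb]_(u in Ige t) (((u - t) ^+ 2) * phi u)%:E = (tail_sqr t)%:E)%E.
  exact: tail_sqrE.
have E3 : (\int[leb]_(u in Ile t) (((u - t) ^+ 2) * phi u)%:E = (tail_sqr (- t))%:E)%E.
  rewrite -E1 [LHS]integral_mkcond [RHS]integral_mkcond.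
  rewrite integral_lebesgueN; last 2 first.
  - apply/(measurable_restrictT _ _).1; first exact: measurable_itv.
    apply/measurable_EFinP/measurable_funTS/measurable_funM; last exact: measurable_phi.
    by apply: measurable_funX; exact: measurable_funB.
  - by move=> x; rewrite erestrict_ge0// => y _; rewrite lee_fin mulr_ge0 ?sqr_ge0 ?phi_ge0.
  apply: eq_integral => u _; rewrite !patchE phiN.
  have -> : (- u \in Ile t) = (u \in Ige (- t)).
    by apply/idP/idP; rewrite /Ile /Ige !in_setE/= !in_itv/= andbT lerNl.
  by case: ifP => // _; congr (_ * _)%:E; ring.
rewrite E1 E2 E3 -!EFinM -!EFinD; congr EFin.
by rewrite natrD mulr2n natrD; ring.
Qed.

End coordinate_moments.

(** * Recovery by l1 minimization under box constraints *)

Section descent_cone.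
Context {R : realType}.
Variables (N L1 L2 : nat) (c : 'I_N -> int).
Hypotheses (L1_gt0 : (0 < L1)%N) (L2_gt0 : (0 < L2)%N).
Implicit Types (x : 'cV[R]_N) (f h : 'rV[R]_N) (tau u : R).

Definition label_sign j : R := Num.sg (c j)%:~R.

(* [inl e] runs over the subgradients of the norm at [x0] with extreme entries on the zero
   coordinates, [inr j] over the active box constraints (with zero vectors elsewhere). *)
Definition descent_normal (i : {ffun 'I_N -> bool} + 'I_N) : 'rV[R]_N :=
  match i with
  | inl e => \row_j (if c j == 0 then (-1) ^+ e j else label_sign j)
  | inr j => if c j == - L1%:Z then - delta_mx 0 j
             else if c j == L2%:Z then delta_mx 0 j else 0
  end.

Definition descent_nrm (i : 'I_#|{: {ffun 'I_N -> bool} + 'I_N}|) :=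
  descent_normal (enum_val i).

Lemma descent_coneP f :
  in_cone descent_nrm f <-> forall i, dot f (descent_normal i) <= 0.
Proof.
split=> Cf i; last exact: Cf.
by have := Cf (enum_rank i); rewrite /descent_nrm enum_rankK.
Qed.

Lemma dotE f h : dot f h = \sum_j f 0 j * h 0 j.
Proof. by rewrite /dot mxE; apply: eq_bigr => j _; rewrite mxE. Qed.

Lemma dot_delta f j : dot f (delta_mx 0 j) = f 0 j.
Proof.
rewrite dotE (bigD1 j)//= mxE !eqxx mulr1 big1 ?addr0// => i ij.
by rewrite mxE (negbTE ij) andbF mulr0.
Qed.

Lemma lower_label_neq_upper : - L1%:Z != L2%:Z.
Proof. by apply/eqP => e; move: L1_gt0 L2_gt0 e; lia. Qed.

(** The subgradient inequality, coordinate by coordinate, handles the norm; an active box constraint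
    fixes the sign of the difference. *)
Lemma feasible_descent m (A : 'M[R]_(m, N)) (b : 'cV[R]_m) x :
  feasible L1 L2 A b x -> norm1 x <= norm1 (x0_of (R:=R) c) ->
  in_cone descent_nrm (x - x0_of c)^T.
Proof.
move=> [_ xb] nx; apply/descent_coneP => -[e|j] /=.
  apply: (@le_trans _ _ (norm1 x - norm1 (x0_of (R:=R) c))); last by rewrite subr_le0.
  rewrite dotE /norm1 -sumrB; apply: ler_sum => j _; rewrite !mxE.
  have [cj|cj] := eqVneq (c j) 0.
    rewrite cj normr0 !subr0 (le_trans (ler_norm _))//.
    by rewrite normrM normrX normrN1 expr1n mulr1.
  rewrite mulrBl lerB//.
    rewrite (le_trans (ler_norm _))// normrM normr_sg intr_eq0 cj mulr1//.
  by rewrite mulrC -normrEsg.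
have /andP[xl xu] := xb j.
case: eqP => [cj|_].
  rewrite dotNr dot_delta !mxE cj oppr_le0 subr_ge0.
  by rewrite mulrNz.
case: eqP => [cj|_]; last by rewrite dot0r.
by rewrite dot_delta !mxE cj subr_le0.
Qed.

(* The squared distance from [u] to the interval of admissible values of [tau] times a
   subgradient, plus any outward multiple of an active box constraint. *)
Definition coord_dist2 tau j u : R :=
  if c j == - L1%:Z then excess (- tau) u ^+ 2
  else if c j == L2%:Z then excess (- tau) (- u) ^+ 2
  else if c j == 0 then excess tau u ^+ 2 + excess tau (- u) ^+ 2
  else if 0 < c j then excess tau u ^+ 2 + excess (- tau) (- u) ^+ 2
  else excess (- tau) u ^+ 2 + excess tau (- u) ^+ 2.

Lemma excess_geB t u : u - t <= excess t u.
Proof. by rewrite /excess le_max lexx. Qed.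

Lemma excess_sqrD t u : excess t u ^+ 2 + excess (- t) (- u) ^+ 2 = (u - t) ^+ 2.
Proof.
rewrite /excess; have [ut|ut] := leP t u.
  by rewrite max_l ?subr_ge0// max_r ?expr0n ?addr0//; lra.
by rewrite max_r ?subr_le0 ?ltW// max_l ?expr0n ?add0r/=; [ring|lra].
Qed.

(** The signs of [f] select the extreme subgradient, so that on a zero label the subtracted term is
    [tau * |f|]. What is left is at most the distance times [|f|], and the arithmetic-geometric
    inequality splits it. *)
Lemma coord_dist2_ge tau j u f : 0 <= tau ->
  (c j = - L1%:Z -> 0 <= f 0 j) -> (c j = L2%:Z -> f 0 j <= 0) ->
  u * f 0 j - tau * (f 0 j * descent_normal (inl [ffun i => f 0 i < 0]) 0 j)
  <= 2^-1 * coord_dist2 tau j u + 2^-1 * f 0 j ^+ 2.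
Proof.
move=> tau0 fl fu; rewrite mxE ffunE /coord_dist2 /label_sign.
set y := f 0 j in fl fu *.
have amgm (a b : R) : a * b <= 2^-1 * a ^+ 2 + 2^-1 * b ^+ 2.
  by have := sqr_ge0 (a - b); nra.
have [cj|cl] := eqVneq (c j) (- L1%:Z).
  have -> : (c j == 0) = false by rewrite cj; move: L1_gt0; lia.
  have -> : Num.sg (c j)%:~R = -1 :> R.
    by apply: ltr0_sg; rewrite ltrz0 cj; move: L1_gt0; lia.
  have := amgm (excess (- tau) u) y; have := excess_geB (- tau) u; have := fl cj.
  rewrite opprK; nra.
have [cj|cu] := eqVneq (c j) L2%:Z.
  have -> : (c j == 0) = false by rewrite cj; move: L2_gt0; lia.
  have -> : Num.sg (c j)%:~R = 1 :> R.
    by apply: gtr0_sg; rewrite ltr0z cj; move: L2_gt0; lia.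
  have := amgm (excess (- tau) (- u)) (- y); have := excess_geB (- tau) (- u).
  have := fu cj; rewrite opprK sqrrN; nra.
have [cj|c0] := eqVneq (c j) 0.
  have e1 := excess_geB tau u; have e2 := excess_geB tau (- u).
  have a1 := amgm (excess tau u) y; have a2 := amgm (excess tau (- u)) (- y).
  have s1 := sqr_ge0 (excess tau u); have s2 := sqr_ge0 (excess tau (- u)).
  have [y0|y0] := ltP y 0; rewrite ?expr1 ?expr0; first by rewrite sqrrN in a2; nra.
  nra.
have := ltrgtP 0 (c j); have [cp|cn] := ltP 0 (c j) => _.
  rewrite gtr0_sg ?ltr0z// excess_sqrD; have := amgm (u - tau) y; nra.
have cn' : c j < 0 by rewrite lt_neqAle c0 cn.
rewrite ltr0_sg ?ltrz0//.
have -> : excess (- tau) u ^+ 2 + excess tau (- u) ^+ 2 = (u + tau) ^+ 2.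
  by rewrite -{2}(opprK tau) excess_sqrD opprK.
have := amgm (u + tau) y; nra.
Qed.

(** Summing over the coordinates gives [|f|^2 <= dist^2 / 2 + |f|^2 / 2]: orthogonality turns
    [dot h f] into [|f|^2], and the chosen subgradient pairs nonpositively with [f]. *)
Lemma descent_dist2 tau f h : 0 <= tau -> in_cone descent_nrm f ->
  dot f (h - f) = 0 -> sqn f <= \sum_j coord_dist2 tau j (h 0 j).
Proof.
move=> tau0 /descent_coneP Cf; rewrite dotBr => /eqP; rewrite subr_eq0 => /eqP fh.
have ff : sqn f = dot f f by [].
have S : \sum_j (h 0 j * f 0 j -
      tau * (f 0 j * descent_normal (inl [ffun i => f 0 i < 0]) 0 j)) <=
    \sum_j (2^-1 * coord_dist2 tau j (h 0 j) + 2^-1 * f 0 j ^+ 2).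
  apply: ler_sum => j _; apply: coord_dist2_ge => // cj.
    have := Cf (inr j); rewrite /= cj eqxx dotNr dot_delta; lra.
  have := Cf (inr j); rewrite /= cj eqxx eq_sym (negbTE lower_label_neq_upper) dot_delta.
  by [].
have T := Cf (inl [ffun i => f 0 i < 0]).
move: S; rewrite sumrB big_split/= -!mulr_sumr -sqnE -!dotE dotC fh -ff.
nra.
Qed.

Lemma measurable_coord_dist2 tau j : measurable_fun setT (coord_dist2 tau j).
Proof.
have me t : measurable_fun setT (fun u : R => excess t u ^+ 2).
  by apply: measurable_funX; exact: measurable_excess.
have mN t : measurable_fun setT (fun u : R => excess t (- u) ^+ 2).
  exact: (measurableT_comp (me t)).
rewrite /coord_dist2; case: eqP => _; first exact: me.
case: eqP => _; first exact: mN.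
case: eqP => _; first exact: measurable_funD.
by have [_|_] := boolP (0 < c j); exact: measurable_funD.
Qed.

End descent_cone.

(** * Failure probability in terms of the bound at [tau] *)

Section recovery.
Context {R : realType}.
Variables (N L1 L2 : nat) (c : 'I_N -> int).
Hypotheses (L1_gt0 : (0 < L1)%N) (L2_gt0 : (0 < L2)%N).
Implicit Types (tau u : R).
Local Notation normal1 := (normal_prob (0 : R) 1).

(** The Gaussian mean of [coord_dist2] for labels in the prescribed range, written with class
    indicators so that summation counts each class. *)
Definition coord_moment tau (j : 'I_N) : R :=
  (j \in Khat L1 L2 c)%:R * (1 + tau ^+ 2)
  + ((j \in Kset c (- L1%:Z)) + (j \in Kset c L2%:Z))%:R * tail_sqr (- tau)
  + (j \in Kset c 0)%:R * (2 * tail_sqr tau).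

Lemma sum_coord_moment tau :
  (\sum_j coord_moment tau j)%:E =
  bound_fun #|Khat L1 L2 c| #|Kset c (- L1%:Z)| #|Kset c L2%:Z| #|Kset c 0| tau.
Proof.
have card (A : {set 'I_N}) : \sum_j (j \in A)%:R = #|A|%:R :> R.
  by rewrite -natr_sum -sum1_card [in RHS]big_mkcond; congr (_%:R); apply: eq_bigr => j _; case: ifP.
rewrite bound_funE; congr EFin; rewrite !big_split/= -!mulr_suml !card.
congr (_ + _ * _ + _); under eq_bigr do rewrite natrD.
by rewrite big_split/= !card natrD.
Qed.

Lemma expR_coord_dist2 u tau j : 0 <= u -> 0 <= tau ->
  (\int[normal1]_x (expR (u / (1 + 2 * u) * coord_dist2 L1 L2 c tau j x))%:E
   <= (expR (u * coord_moment tau j))%:E)%E.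
Proof.
move=> u0 tau0; rewrite /coord_moment /coord_dist2 !inE.
have [cl|cl] := eqVneq (c j) (- L1%:Z).
  have -> : (c j == 0) = false by rewrite cl; move: L1_gt0; lia.
  have -> : (c j == L2%:Z) = false.
    by rewrite cl; exact/negbTE/lower_label_neq_upper.
  rewrite /= !mul0r add0r addr0 mul1r.
  exact: expR_excess_le.
have [cu|cu] := eqVneq (c j) (L2%:Z).
  have -> : (c j == 0) = false by rewrite cu; move: L2_gt0; lia.
  rewrite /= !mul0r add0r addr0 mul1r.
  by rewrite expR_excessN// lee_fin exp_pos_bound.
rewrite /= andbT mul0r addr0.
have [c0|c0] := eqVneq (c j) 0.
  rewrite mul0r add0r mul1r.
  have -> : 2 * tail_sqr tau = tail_sqr tau + tail_sqr tau by ring.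
  by apply: (expR_excess2_le u0); rewrite addr_ge0.
(* For the other labels the distance is a full square, whose mean [1 + tau ^+ 2] is split into two
   opposite tails to reuse the two-sided estimate. *)
rewrite mul1r mul0r addr0 -tail_sqrDN.
have [_|_] := boolP (0 < c j).
  by apply: (expR_excess2_le u0); rewrite subrr.
by rewrite (addrC (tail_sqr tau)); apply: (expR_excess2_le u0); rewrite addNr.
Qed.

Lemma expR_descent_dist2 u tau : 0 <= u -> 0 <= tau ->
  (\int[gauss 1 N]_h (expR (u / (1 + 2 * u) *
      \sum_j coord_dist2 L1 L2 c tau j (h 0 j)))%:E
   <= (expR (u * \sum_j coord_moment tau j))%:E)%E.
Proof.
move=> u0 tau0; under eq_integral do rewrite mulr_sumr expR_sum.
rewrite (gauss_prod (h := fun j x => expR (u / (1 + 2 * u) * coord_dist2 L1 L2 c tau j x))).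
- rewrite mulr_sumr expR_sum -prodEFin.
  suff : (0 <= \prod_j \int[normal1]_x (expR (u / (1 + 2 * u) * coord_dist2 L1 L2 c tau j x))%:E /\
     \prod_j \int[normal1]_x (expR (u / (1 + 2 * u) * coord_dist2 L1 L2 c tau j x))%:E <=
     \prod_j (expR (u * coord_moment tau j))%:E)%E by case.
  apply: (big_ind2 (fun x y => (0 <= x /\ x <= y)%E)).
  - by rewrite lexx lee01.
  - by move=> x1 x2 y1 y2 [? ?] [? ?]; rewrite mule_ge0// lee_pmul.
  move=> j _; split; last exact: (expR_coord_dist2 _ u0 tau0).
  by apply: integral_ge0 => x _; rewrite lee_fin expR_ge0.
- move=> j; apply: measurableT_comp => //; apply: measurable_funM => //.
  exact: measurable_coord_dist2.
- by move=> j x; rewrite expR_ge0.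
Qed.

Lemma recovery_bound m u tau : 0 < u -> 0 <= tau ->
  exists B : set 'M[R]_(m, N),
  [/\ measurable B,
    (forall A f, in_cone (descent_nrm (R := R) L1 L2 c) f -> A *m f^T = 0 -> f != 0 -> B A),
    ((N <= m)%N -> gauss m N B = 0%E) &
    (gauss m N B <= (2 * (Num.sqrt (1 + 2 * u))^-1 ^+ m *
       expR (u * \sum_j coord_moment tau j))%:E)%E].
Proof.
move=> u0 tau0; have q0 := ltW u0; set k := (Num.sqrt _)^-1.
have s1 : 1 < Num.sqrt (1 + 2 * u).
  by rewrite -[ltLHS](@sqrtr1 R) ltr_sqrt; lra.
have k0 : 0 < k by rewrite invr_gt0 (lt_trans ltr01).
have k1 : k < 1 by rewrite invf_lt1// (lt_trans ltr01).
have ku : (1 - k ^+ 2) / 2 = u / (1 + 2 * u).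
  by rewrite exprVn sqr_sqrt_1D2//; field; rewrite gt_eqF//; lra.
have mpsi : measurable_fun setT
    (fun h : 'rV[R]_N => \sum_j coord_dist2 L1 L2 c tau j (h 0 j)).
  apply: measurable_sum => j; apply: measurableT_comp; first exact: measurable_coord_dist2.
  exact: measurable_entry_comp.
have [B [mB badB B0 leB]] := @cone_kernel_bound R N _ m _ k _ k0 k1 mpsi
  (fun f h => descent_dist2 L1_gt0 L2_gt0 tau0 (h := h)).
exists B; split => //; apply: (le_trans leB); rewrite [X in (_ <= X)%E]EFinM; apply: lee_pmul => //.
- by rewrite lee_fin mulr_ge0// exprn_ge0// ltW.
- by apply: integral_ge0 => h _; rewrite lee_fin expR_ge0.
- by rewrite ku; exact: expR_descent_dist2.
Qed.

End recovery.

(** * Optimizing the exponent *)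

Section chernoff_exponent.
Context {R : realType}.
Implicit Types (x u t : R).

(** Equivalent to [ln (1 + x) >= x - x ^+ 2 / 2]; the quotient of the two sides has derivative
    [x ^+ 2] times an exponential. *)
Lemma expR_le_1Dx x : 0 <= x -> expR (x - x ^+ 2 / 2) <= 1 + x.
Proof.
move=> x0; pose g x : R := (1 + x) * expR (2^-1 * x ^+ 2 - x).
have dg (y : R) : is_derive y 1 g (y ^+ 2 * expR (2^-1 * y ^+ 2 - y)).
  have h : is_derive y 1 (fun y => expR (2^-1 * y ^+ 2 - y)) (expR (2^-1 * y ^+ 2 - y) * (y - 1)).
    apply: (@is_derive1_comp _ expR (fun y => 2^-1 * y ^+ 2 - y)).
    by apply: is_derive_eq; rewrite /GRing.scale/= !mulr1; field.
  by rewrite /g; apply: is_derive_eq; rewrite /GRing.scale/=; ring.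
have : g 0 <= g x.
  apply: (@ger0_derive1_le_cc _ g 0 x) => //.
  - by move=> y _; rewrite derive1E; have [_ ->] := dg y; rewrite mulr_ge0 ?sqr_ge0 ?expR_ge0.
  - apply: continuous_subspaceT => y; apply: differentiable_continuous.
    by apply/derivable1_diffP; have [] := dg y.
  - by rewrite in_itv/= lexx.
  - by rewrite in_itv/= lexx andbT.
rewrite /g expr0n/= mulr0 subr0 expR0 addr0 mulr1.
have -> : 2^-1 * x ^+ 2 - x = - (x - x ^+ 2 / 2) by field.
by rewrite expRN ler_pdivlMr ?expR_gt0// mul1r.
Qed.

Lemma sqrt_exprV_le m u : 0 <= u ->
  (Num.sqrt (1 + 2 * u))^-1 ^+ m <= expR (m%:R * (u ^+ 2 - u)).
Proof.
move=> u0; rewrite expRM_natl; apply: lerXn2r; rewrite ?nnegrE ?invr_ge0 ?sqrtr_ge0 ?expR_ge0//.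
rewrite -[leRHS]invrK lef_pV2 ?posrE ?sqrtr_gt0 ?invr_gt0 ?expR_gt0//; last by lra.
rewrite -expRN -[leLHS]ger0_norm ?expR_ge0// -sqrtr_sqr ler_wsqrtr//.
have := expR_le_1Dx (mulr_ge0 (ler0n R 2) u0); rewrite -expRM_natl; apply: le_trans.
by rewrite ler_expR; lra.
Qed.

End chernoff_exponent.

Section failure_probability.
Context {R : realType}.
Implicit Types (eps delta : R).

(** With [w = m - delta], the exponent is at most [N u ^+ 2 - u w = - w ^+ 2 / (4 N)], which uses
    [m < N]. The factor 3/4 leaves [w ^+ 2 >= 9/2 ln (4 / eps) N], above the needed 4, and the final
    value is at most [eps / 2]. *)
Lemma chernoff_exponent (m N : nat) eps delta : 0 < eps -> eps <= 1 -> (m < N)%N ->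
  m%:R - delta >= 3 / 4 * Num.sqrt (8 * ln (4 / eps) * N%:R) ->
  let u := (m%:R - delta) / (2 * N%:R) in
  0 < u /\ 2 * (Num.sqrt (1 + 2 * u))^-1 ^+ m * expR (u * delta) < eps.
Proof.
move=> e0 e1 mN; set w := m%:R - delta => hd u.
have N0 : 0 < N%:R :> R by rewrite ltr0n; case: (N) mN.
have mN' : m%:R <= N%:R :> R by rewrite ler_nat ltnW.
have e4 : 1 < 4 / eps by rewrite ltr_pdivlMr//; lra.
have l0 : 0 < ln (4 / eps) by rewrite ln_gt0.
set S := 8 * ln (4 / eps) * N%:R in hd.
have S0 : 0 < S by rewrite !mulr_gt0.
set t := Num.sqrt S in hd; have t0 : 0 < t by rewrite sqrtr_gt0.
have t2 : t ^+ 2 = S by rewrite sqr_sqrtr// ltW.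
have w0 : 0 < w by apply: lt_le_trans hd; rewrite mulr_gt0.
have u0 : 0 < u by rewrite divr_gt0// mulr_gt0.
have uN : u * (2 * N%:R) = w by rewrite divfK// gt_eqF// mulr_gt0.
split => //.
have k1 := sqrt_exprV_le m (ltW u0).
apply: (@le_lt_trans _ _ (2 * expR (- ln (4 / eps)))); last first.
  by rewrite expRN lnK ?posrE ?divr_gt0// invf_div; lra.
rewrite -mulrA ler_pM2l//.
apply: (le_trans (ler_wpM2r (expR_ge0 _) k1)); rewrite -expRD ler_expR.
have -> : m%:R * (u ^+ 2 - u) + u * delta = m%:R * u ^+ 2 - u * w by rewrite /w; ring.
have h1 : m%:R * u ^+ 2 <= N%:R * u ^+ 2 by rewrite ler_wpM2r// sqr_ge0.
have h2 : w ^+ 2 >= 9 / 16 * S.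
  rewrite -t2 -(_ : (3 / 4 * t) ^+ 2 = 9 / 16 * t ^+ 2); last by field.
  by rewrite ler_pXn2r// nnegrE ltW// mulr_gt0.
have h3 : ln (4 / eps) * N%:R <= u ^+ 2 * N%:R * N%:R.
  have : w ^+ 2 = 4 * (u ^+ 2 * N%:R * N%:R) by rewrite -uN; ring.
  by rewrite /S in h2; nra.
have h4 : ln (4 / eps) <= u ^+ 2 * N%:R by rewrite -(ler_pM2r N0).
by rewrite -uN; nra.
Qed.

End failure_probability.

(** * From independent entries to the Gaussian matrix law *)

Section gaussian_law.
Context {R : realType} {d : measure_display} {T : measurableType d}.
Variables (P : probability T R) (m N : nat) (a : 'I_m -> 'I_N -> T -> R).
Hypothesis iid_a : iid_std_gaussian P a.

Let entries w : 'M[R]_(m, N) := \matrix_(i, j) a i j w.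

Lemma measurable_iid_mx : measurable_fun setT entries.
Proof.
case: iid_a => ma _ _; apply: measurable_mxP => i j.
by under eq_fun do rewrite mxE; exact: ma.
Qed.

Lemma iid_mx_law S : measurable S -> P (entries @^-1` S) = gauss m N S.
Proof.
move=> mS; have mE := measurable_iid_mx.
have gE : is_gauss_mx (pushforward P entries).
  move=> B mB; case: iid_a => ma na pa; rewrite /pushforward.
  transitivity (P [set w | forall i j, B i j (a i j w)]).
    congr (P _); apply/seteqP; split => w /= Bw i j; have := Bw i j; by rewrite mxE.
  rewrite pa//; apply: eq_bigr => i _; apply: eq_bigr => j _; exact: na.
pose F : {mfun T >-> 'M[R]_(m, N)} := HB.pack entries (isMeasurableFun.Build _ _ _ _ entries mE).
rewrite -[LHS]/(distribution P F S); apply: mx_measure_unique => // B mB.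
by rewrite gaussE// -gE.
Qed.

End gaussian_law.

Theorem theorem4p9 (R : realType) (d : measure_display) (T : measurableType d)
  (P : probability T R) (eps : R) (m N L1 L2 : nat)
  (c : 'I_N -> int) (a : 'I_m -> 'I_N -> T -> R) :
  0 < eps -> (0 < L1)%N -> (0 < L2)%N ->
  (forall j, - (L1%:Z) <= c j <= L2%:Z) ->
  iid_std_gaussian P a ->
  ((m%:R)%:E >=
     ereal_inf (bound_fun #|Khat L1 L2 c| #|Kset c (- (L1%:Z))|
                         #|Kset c (L2%:Z)| #|Kset c 0|
                @` [set tau : R | (0 <= tau)%R])
     + (Num.sqrt (8 * ln (4 / eps) * N%:R))%:E)%E ->
  exists E : set T, [/\ measurable E,
    E `<=` [set w | unique_solution L1 L2 (gauss_mx a w)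
                      (gauss_mx a w *m x0_of (R:=R) c) (x0_of (R:=R) c)] &
    ((1 - eps)%:E < P E)%E].
Proof.
move=> e0 L1_gt0 L2_gt0 cb iid_a hm.
(* For [eps > 1] the empty event is enough; otherwise [ln (4 / eps)] is positive. *)
have [e1|e1] := ltP 1 eps.
  by exists set0; split => //; rewrite measure0 lte_fin subr_lt0.
pose X w : 'M[R]_(m, N) := \matrix_(i, j) a i j w.
suff [B [mB badB leB]] : exists B : set 'M[R]_(m, N), [/\ measurable B,
    (forall A f, in_cone (descent_nrm (R := R) L1 L2 c) f -> A *m f^T = 0 -> f != 0 -> B A) &
    (gauss m N B < eps%:E)%E].
  have mX : measurable_fun setT X := measurable_iid_mx iid_a.
  have mXB : measurable (X @^-1` B) by rewrite -[X in measurable X]setTI; exact: mX.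
  exists (~` (X @^-1` B)); split; first exact: measurableC.
    move=> w /= nB; split.
      split => // j; rewrite mxE; have /andP[lj uj] := cb j.
      by move: lj uj; rewrite -!(ler_int R) mulrNz => lj uj; apply/andP.
    move=> x fx xx0; rewrite ltNge; apply/negP => nx; apply: nB.
    apply: (badB (X w) (x - x0_of c)^T (feasible_descent fx nx)); last first.
      by apply/eqP => /(congr1 trmx)/eqP; rewrite trmxK trmx0 subr_eq0 => /eqP.
    rewrite trmxK mulmxBr; case: fx => + _; rewrite /gauss_mx -/(X w) -!scalemxAl.
    (* Without rows the normalizing factor is 0, but there is then no equation to satisfy; otherwise
       it is invertible and cancels. *)
    have [m0|m0] := posnP m; first by move=> _; apply/matrixP => i; have := ltn_ord i; rewrite {2}m0.
    have sm : (Num.sqrt (m%:R : R))^-1 != 0.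
      by rewrite invr_eq0 gt_eqF// sqrtr_gt0 ltr0n.
    by move/(scalerI sm) => ->; rewrite subrr.
  rewrite probability_setC// iid_mx_law// EFinB.
  rewrite -(fineK (fin_num_measure _ _ mB)) in leB *.
  by rewrite -!EFinB lte_fin ltrD2l ltrN2 -lte_fin.
have [Nm|mN] := leqP N m.
  (* The values [u = 1] and [tau = 0] are arbitrary: only the nullity of the bad event is kept. *)
  have [B [mB badB /(_ Nm) B0 _]] := recovery_bound (R := R) c L1_gt0 L2_gt0 m ltr01 (lexx 0).
  by exists B; split => //; rewrite B0 lte_fin.
have l0 : 0 < 8 * ln (4 / eps) * N%:R.
  have N0 : 0 < N%:R :> R by rewrite ltr0n; case: (N) mN.
  have e4 : 1 < 4 / eps by rewrite ltr_pdivlMr//; lra.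
  by rewrite !mulr_gt0// ln_gt0.
set t := Num.sqrt _ in hm.
have t0 : 0 < t by rewrite sqrtr_gt0.
(* The infimum need not be attained: giving up a quarter of the margin produces a [tau] with a
   strict inequality. *)
have : (ereal_inf (bound_fun #|Khat L1 L2 c| #|Kset c (- (L1%:Z))|
    #|Kset c (L2%:Z)| #|Kset c 0| @` [set tau : R | (0 <= tau)%R]) <
    (m%:R - 3 / 4 * t)%:E)%E.
  apply: (@le_lt_trans _ _ (m%:R - t)%:E); last by rewrite lte_fin; lra.
  by rewrite EFinB leeBrDr.
move=> /ereal_inf_lt[_ [tau /= tau0 <-]]; rewrite -sum_coord_moment lte_fin => hd.
have hd' : 3 / 4 * t <= m%:R - \sum_j coord_moment L1 L2 c tau j by lra.
have [u0 small] := chernoff_exponent e0 e1 mN hd'.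
have [B [mB badB _ leB]] := recovery_bound c L1_gt0 L2_gt0 m u0 tau0.
by exists B; split => //; apply: (le_lt_trans leB); rewrite lte_fin.
Qed.
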